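(* Let $D=(-1,1)$ and $t\in(0,2/3)$. For any open subset $A$ of $D$ satisfying $(\psi,\chi_A)\le t$ it holds that $$(G\chi_A,\chi_A)\le (G\chi_{A_t},\chi_{A_t}),$$ and equality occurs precisely when either $A=A_t$ or $A=-A_t$.
   Context: $(\cdot,\cdot)$ is the standard inner product of $L^2(D)$ with respect to Lebesgue measure on $D=(-1,1)$, and $\chi_A$ is the indicator function of $A$. $G$ is the Green operator of the non-negative Dirichlet Laplacian on $D$: for $f\in L^2(D)$, $u=Gf$ is the unique element of $W^{1,2}_0(D)\cap W^{2,2}(D)$ with $-u''=f$ a.e. The torsion function is $\psi:=G\chi_D$, so $\psi(x)=\tfrac12(1-x^2)$ and $(\psi,1)=2/3$. Define $\varphi:D\to(0,2/3)$ by $\varphi(x):=(\chi_{(x,1)},\psi)$; for $t\in(0,2/3)$ let $\xi_t\in(-1,1)$ be the unique point with $\varphi(\xi_t)=t$, and set $A_t:=(\xi_t,1)$. Also $-A_t:=\{-x:x\in A_t\}$.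
   Formalization: In the equality case, ''A = A_t or A = -A_t'' is proved up to Lebesgue-null sets; literal set equality fails, e.g. for A equal to A_t minus one point, which is open with the same values of (ψ,χ_A) and (Gχ_A,χ_A). *)

(* Defs.v *)
From mathcomp Require Import all_boot all_order all_algebra.
From mathcomp Require Import all_classical all_reals all_analysis.

Set Implicit Arguments.
Unset Strict Implicit.
Unset Printing Implicit Defensive.

Import Order.TTheory GRing.Theory Num.Theory.
Import numFieldNormedType.Exports.

Local Open Scope classical_set_scope.
Local Open Scope ring_scope.

Definition D (R : realType) : set R := `]-1, 1[.
Arguments D : clear implicits.

Definition inner {R : realType} (f g : R -> R) : R :=
  \int[@lebesgue_measure R]_(x in D R) (f x * g x).

(* Elements of L^2(D) are represented by functions on all of [R]; the values
   outside [D R] are irrelevant. *)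
Definition L2 {R : realType} (f : R -> R) : Prop :=
  measurable_fun (D R) f /\
  (@lebesgue_measure R).-integrable (D R) (fun x => ((f x) ^+ 2)%:E).

(* The space of test functions C_c^oo(D). *)
Definition test_fun {R : realType} (phi : R -> R) : Prop :=
  (forall (n : nat) (x : R), derivable (derive1n n phi) x 1) /\
  compact (closure [set x | phi x != 0]) /\
  closure [set x | phi x != 0] `<=` D R.

(* [v] is a weak derivative of order [k] of [u] on [D]. *)
Definition weak_deriv {R : realType} (k : nat) (u v : R -> R) : Prop :=
  forall phi : R -> R, test_fun phi ->
    inner u (derive1n k phi) = (-1) ^+ k * inner v phi.

(* The Sobolev space W^{k,2}(D). *)
Definition sobolev {R : realType} (k : nat) (u : R -> R) : Prop :=
  L2 u /\
  forall j : nat, (j <= k)%N -> exists v : R -> R, L2 v /\ weak_deriv j u v.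

(* W^{1,2}_0(D), the closure of C_c^oo(D) in the norm of W^{1,2}(D); here
   [v] is the weak derivative of [u]. *)
Definition sobolev0 {R : realType} (u : R -> R) : Prop :=
  L2 u /\
  exists v : R -> R, L2 v /\ weak_deriv 1 u v /\
    forall e : R, 0 < e -> exists phi : R -> R, test_fun phi /\
      Num.sqrt (inner (u \- phi) (u \- phi)
                + inner (v \- derive1 phi) (v \- derive1 phi)) < e.

Definition is_green {R : realType} (f u : R -> R) : Prop :=
  sobolev0 u /\ sobolev 2 u /\
  exists w : R -> R, L2 w /\ weak_deriv 2 u w /\
    {ae @lebesgue_measure R, forall x, D R x -> - w x = f x}.

(* The Green operator. The solution of [is_green f u] is unique only as an
   element of L^2(D), so [xget] picks a representative. *)
Definition G {R : realType} (f : R -> R) : R -> R :=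
  xget (fun=> 0) [set u | is_green f u].

Definition psi {R : realType} : R -> R := G \1_(D R).

Definition varphi {R : realType} (x : R) : R := inner \1_(`]x, 1[) psi.

(* For 0 < t < 2/3 the set below is a singleton. *)
Definition xi {R : realType} (t : R) : R :=
  xget 0 [set x | D R x /\ varphi x = t].

Definition At {R : realType} (t : R) : set R := `]xi t, 1[.

(* Equality of sets up to a Lebesgue-null set, that is, equality of their
   indicator functions as elements of L^2. An open set of full measure in
   [At t] (for instance [At t] minus a point) has the same value of
   (G chi_A, chi_A) as [At t], so the equality case can only determine the
   set in this sense. *)
Definition eq_mod_null {R : realType} (A B : set R) : Prop :=
  (@lebesgue_measure R).-negligible (A `+` B).

(* Main.v *)
(* Write u = G f for f = chi_A and consider P(h) = int max(u - h psi, 0), a convex function of h.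
   Since 0 <= f <= 1, (u, f) <= P(h) + h (psi, f) for all h, so it suffices to bound P(a/2) by its
   value for the interval (1 - a, 1) = A_t, for which the inequality is an equality.  For that
   interval P is an explicit profile p(h).  At an interior maximum h of P - p, convexity of P forces
   the level set {u > h psi} to have the mass s = - p'(h), and forces
   sum_i psi(p_i)^3 / |q(p_i)| <= p''(h) over the points p_i where u = h psi; here
   q = u' psi - u psi' satisfies q' = u - f psi, so integrating over {u > h psi} also bounds
   sum_i |q(p_i)| by min(s, t) - P(h) - h s.  By AM-GM and the isoperimetric inequality for the
   weight psi^(3/2), these bounds leave room only for P(h) <= p(h), and in the case of equality only
   for one level point, so that {u > h psi} is A_t or -A_t.  If equality holds in the theorem, then
   A agrees with {u > (a/2) psi} almost everywhere. *)
Require Import Defs.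
From mathcomp Require Import all_boot all_order all_algebra.
From mathcomp Require Import all_classical all_reals all_analysis.
From mathcomp Require Import measurable_realfun.
From mathcomp Require Import ring lra.
Set Implicit Arguments.
Unset Strict Implicit.
Unset Printing Implicit Defensive.
Import Order.TTheory GRing.Theory Num.Theory.
Import numFieldNormedType.Exports.
Local Open Scope classical_set_scope.
Local Open Scope ring_scope.

(** * Bounded measurable functions and indefinite integrals *)

Section BoundedIntegrals.
Variable R : realType.
Notation mu := (@lebesgue_measure R).
Implicit Types (f g F G : R -> R) (a b c d x y : R) (X : set R).

(** The weight is dictated by the level points. Since (u / psi)' = q / psi^2, the second derivative
    of P is formally the sum of psi(p_i) / |(u / psi)'(p_i)| = psi(p_i)^3 / |q(p_i)|, and by
    Cauchy-Schwarz its product with the sum of the |q(p_i)| is at least the square of the sum of the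
    psi(p_i)^(3/2). For the interval there is one level point x0 and both bounds are equalities, so
    p solves the differential equation (min(s, t) - p - h s) p'' = psi(x0)^3, where s = - p' is the
    mass of (x0, 1). A positive maximum of P - p makes the corresponding product for P strictly
    smaller than psi(x0)^3, which is too small for any level set of mass s. The level a/2 is the
    value of u / psi at the end point 1 - a of the interval. The obstacle is regularity: f is an
    indicator, u is only C^1 with Lipschitz derivative, and nothing is known in advance about P'' or
    about the number of level points. Hence densities appear in integrated form, P is only touched
    by a Taylor polynomial, and one or two level points are used at a time. *)

Definition bdm X f := measurable_fun X f /\ exists C, forall x, X x -> `|f x| <= C.

Lemma bdm_cst X c : bdm X (fun=> c).
Proof. by split; [exact: measurable_cst|exists `|c|]. Qed.

Lemma bdmD X f g : bdm X f -> bdm X g -> bdm X (fun x => f x + g x).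
Proof.
move=> [mf [C hC]] [mg [C' hC']]; split; first exact: measurable_funD.
by exists (C + C') => x Xx; rewrite (le_trans (ler_normD _ _))// lerD// ?hC ?hC'.
Qed.

Lemma bdmM X f g : bdm X f -> bdm X g -> bdm X (fun x => f x * g x).
Proof.
move=> [mf [C hC]] [mg [C' hC']]; split; first exact: measurable_funM.
by exists (C * C') => x Xx; rewrite normrM ler_pM// ?hC ?hC'.
Qed.

Lemma bdmN X f : bdm X f -> bdm X (fun x => - f x).
Proof.
move=> [mf [C hC]]; split; first exact: measurableT_comp.
by exists C => x Xx; rewrite normrN hC.
Qed.

Lemma bdmB X f g : bdm X f -> bdm X g -> bdm X (fun x => f x - g x).
Proof. by move=> hf hg; apply: bdmD => //; exact: bdmN. Qed.

Lemma bdm_norm X f : bdm X f -> bdm X (fun x => `|f x|).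
Proof.
move=> [mf [C hC]]; split; first exact: measurableT_comp.
by exists C => x Xx; rewrite normr_id hC.
Qed.

Lemma bdm_max X f g : bdm X f -> bdm X g -> bdm X (fun x => Num.max (f x) (g x)).
Proof.
move=> [mf [C hC]] [mg [C' hC']]; split; first exact: measurable_maxr.
exists (Num.max C C') => x Xx; case: (leP (f x) (g x)) => _.
  by rewrite le_max hC'// orbT.
by rewrite le_max hC.
Qed.

Lemma bdm_ind X A : measurable A -> bdm X (\1_A : R -> R).
Proof.
move=> mA; split; first exact: measurable_indic.
by exists 1 => x _; rewrite indicE; case: (_ \in _); rewrite ?normr1 ?normr0.
Qed.

Lemma bdmS X X' f : measurable X -> X' `<=` X -> bdm X f -> bdm X' f.
Proof.
move=> mX sX [mf [C hC]]; split; first exact: measurable_funS mf.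
by exists C => x /sX; exact: hC.
Qed.

Lemma bdm_int X f : measurable X -> (mu X < +oo)%E -> bdm X f ->
  mu.-integrable X (EFin \o f).
Proof.
move=> mX fX [mf [C hC]]; apply: measurable_bounded_integrable => //.
exists `|C|; split; first by rewrite normr_real.
move=> M CM x Xx; apply: le_trans (hC _ Xx) _.
exact/ltW/(le_lt_trans (ler_norm _)).
Qed.

Lemma itv_fin a b (b0 b1 : bool) : (mu [set` Interval (BSide b0 a) (BSide b1 b)] < +oo)%E.
Proof. by rewrite lebesgue_measure_itv/=; case: ifP => _; rewrite ltry. Qed.

Definition itg f a b : R := \int[mu]_(x in `]a, b[) f x.

Lemma bdm_itg f a b : bdm `]a, b[ f -> mu.-integrable `]a, b[ (EFin \o f).
Proof. by apply: bdm_int => //; exact: itv_fin. Qed.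

Lemma itgD f g a b : bdm `]a, b[ f -> bdm `]a, b[ g ->
  itg (fun x => f x + g x) a b = itg f a b + itg g a b.
Proof. by move=> hf hg; rewrite /itg RintegralD//; exact/bdm_itg. Qed.

Lemma itgB f g a b : bdm `]a, b[ f -> bdm `]a, b[ g ->
  itg (fun x => f x - g x) a b = itg f a b - itg g a b.
Proof. by move=> hf hg; rewrite /itg RintegralB//; exact/bdm_itg. Qed.

Lemma itgZ f c a b : bdm `]a, b[ f ->
  itg (fun x => c * f x) a b = c * itg f a b.
Proof. by move=> hf; rewrite /itg RintegralZl//; exact: bdm_itg. Qed.

Lemma itgN f a b : bdm `]a, b[ f -> itg (fun x => - f x) a b = - itg f a b.
Proof.
move=> hf; rewrite -mulN1r -itgZ//; apply: eq_Rintegral => x _.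
by rewrite mulN1r.
Qed.

Lemma le_itg f g a b : bdm `]a, b[ f -> bdm `]a, b[ g ->
  (forall x, a < x < b -> f x <= g x) -> itg f a b <= itg g a b.
Proof.
move=> hf hg fg; apply: le_Rintegral => //; exact: bdm_itg.
Qed.

Lemma eq_itg f g a b : (forall x, a < x < b -> f x = g x) -> itg f a b = itg g a b.
Proof.
by move=> fg; apply: eq_Rintegral => x; rewrite inE/= in_itv/=; exact: fg.
Qed.

Lemma itg_cst c a b : a <= b -> itg (fun=> c) a b = c * (b - a).
Proof.
move=> ab; have mab : mu `]a, b[%classic = (b - a)%:E.
  rewrite lebesgue_measure_itv/= lte_fin.
  case: ltP => //= ba; have -> : a = b by apply/eqP; rewrite eq_le ab.
  by rewrite subrr.
rewrite /itg Rintegral_cst//; congr (_ * _).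
exact: (congr1 fine mab).
Qed.

Lemma itg_norm f C a b : a <= b -> bdm `]a, b[ f ->
  (forall x, a < x < b -> `|f x| <= C) -> `|itg f a b| <= C * (b - a).
Proof.
move=> ab hf hC; rewrite (le_trans (le_normr_Rintegral _ _))//.
  exact: bdm_itg.
rewrite -itg_cst//; apply: le_itg => //; [exact: bdm_norm|exact: bdm_cst].
Qed.

Lemma sub_oo a b c d : a <= c -> d <= b -> `]c, d[%classic `<=` (`]a, b[%classic : set R).
Proof.
move=> ac db x /=; rewrite !in_itv/= => /andP[cx xd].
by rewrite (le_lt_trans ac cx) (lt_le_trans xd db).
Qed.

Lemma bdm_sub a b c d f : a <= c -> d <= b -> bdm `]a, b[ f -> bdm `]c, d[ f.
Proof. by move=> ac db; apply: bdmS => //; exact: sub_oo. Qed.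

Lemma itg_cat f a b c : a <= b -> b <= c -> bdm `]a, c[ f ->
  itg f a c = itg f a b + itg f b c.
Proof.
move=> ab bc hf.
case: (ltgtP a b) ab => // [{}ab _|-> _]; last first.
  by rewrite {2}/itg set_itvoo0 Rintegral_set0 add0r.
case: (ltgtP b c) bc => // [{}bc _|-> _]; last first.
  by rewrite {3}/itg set_itvoo0 Rintegral_set0 addr0.
have hac := bdm_itg hf.
rewrite /itg (@Rintegral_itv_bndo_bndc _ (BRight a) b); last first.
  by apply: integrableS hac => //; apply: sub_oo => //; exact: ltW.
rewrite -(@Rintegral_itvB _ f (BRight a) (BLeft c) b) ?bnd_simp//; last exact: ltW.
by rewrite addrC subrK.
Qed.

(** Absolute continuity in integrated form: the density may be discontinuous, as an indicator is,
    and no almost everywhere derivative is involved. *)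
Definition prim f F a b := forall x y, a <= x -> x <= y -> y <= b ->
  F y - F x = itg f x y.

Lemma prim_sub f F a b c d : a <= c -> d <= b -> prim f F a b -> prim f F c d.
Proof. by move=> ac db h x y cx xy yd; apply: h => //; lra. Qed.

Lemma prim_lip f F a b : bdm `]a, b[ f -> prim f F a b ->
  exists2 C, 0 <= C & forall x y, a <= x <= b -> a <= y <= b -> `|F y - F x| <= C * `|y - x|.
Proof.
move=> hf hF; have [C hC] := hf.2; exists `|C| => // x y.
wlog xy : x y / x <= y => [H hx hy|].
  case: (leP x y) => [xy|/ltW yx]; first exact: H.
  by rewrite distrC (distrC y); exact: H.
move=> hx hy; rewrite hF//; try lra.
rewrite (ger0_norm (x := y - x)) ?subr_ge0//.
apply: itg_norm => //.
  by apply: bdm_sub hf; lra.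
move=> z hz; rewrite (le_trans (hC z _)) ?ler_norm//=.
by rewrite in_itv/=; lra.
Qed.

Lemma lip_within C F a b :
  (forall x y, a <= x <= b -> a <= y <= b -> `|F y - F x| <= C * `|y - x|) ->
  {within `[a, b], continuous F}.
Proof.
move=> h; have [C0 C00 hC] : exists2 C', 0 < C' &
    forall x y, a <= x <= b -> a <= y <= b -> `|F y - F x| <= C' * `|y - x|.
  exists (`|C| + 1); first by rewrite ltr_pwDr.
  move=> x y hx hy; rewrite (le_trans (h _ _ hx hy))// ler_wpM2r//.
  by rewrite (le_trans (ler_norm _))// lerDl.
apply/subspace_continuousP => x /=; rewrite in_itv/= => hx.
apply/cvgrPdist_le => /= e e0; rewrite near_withinE; near=> y => hy.
rewrite distrC (le_trans (hC _ _ hx hy))//.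
rewrite mulrC -ler_pdivlMr// distrC; near: y.
by apply: (@cvgr_dist_le _ _ _ _ _ id x); [exact: cvg_id|rewrite divr_gt0].
Unshelve. all: by end_near. Qed.

Lemma bdm_within F a b : {within `[a, b], continuous F} -> bdm `[a, b] F.
Proof.
case: (leP a b) => [ab cF|ba _]; last first.
  rewrite set_itv_ge ?bnd_simp -?ltNge//.
  by split; [exact: measurable_fun_set0|exists 0 => ?].
split; first exact: subspace_continuous_measurable_fun.
have [c _ hc] := EVT_max ab cF; have [d _ hd] := EVT_min ab cF.
exists (Num.max `|F c| `|F d|) => x /= hx.
have := hc _ hx; have := hd _ hx; rewrite le_max.
move=> h1 h2; case: (lerP 0 (F x)) => Fx.
  by apply/orP; left; rewrite ger0_norm// (le_trans h2)// ler_norm.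
by apply/orP; right; have := ler_norm (- F d); rewrite normrN (ltr0_norm Fx); lra.
Qed.

Lemma prim_within f F a b : bdm `]a, b[ f -> prim f F a b ->
  {within `[a, b], continuous F}.
Proof. by move=> hf /(prim_lip hf)[C _]; exact: lip_within. Qed.

Lemma prim_bdm f F a b : bdm `]a, b[ f -> prim f F a b -> bdm `]a, b[ F.
Proof.
move=> hf hF; apply: (@bdmS `[a, b]) => //; first exact: subset_itv_oo_cc.
by apply: bdm_within; exact: prim_within hF.
Qed.

(** Over [n + 1] equal pieces the increments add up to at most [C (b - a)^2 / (n + 1)]. This plays
    the role of a vanishing derivative for functions not known to be differentiable. *)
Lemma quad_const F C a b : a <= b ->
  (forall x y, a <= x -> x <= y -> y <= b -> `|F y - F x| <= C * (y - x) ^+ 2) ->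
  F a = F b.
Proof.
move=> ab h.
have hn n : `|F b - F a| <= C * (b - a) ^+ 2 / n.+1%:R.
  pose d := (b - a) / n.+1%:R.
  have d0 : 0 <= d by rewrite divr_ge0 ?subr_ge0.
  have hk k : (k <= n.+1)%N -> `|F (a + k%:R * d) - F a| <= C * d ^+ 2 * k%:R.
    elim: k => [_|k IH kn]; first by rewrite mul0r addr0 subrr normr0 mulr0.
    have e : a + k.+1%:R * d = a + k%:R * d + d by rewrite -natr1 mulrDl mul1r addrA.
    have hb : a + k.+1%:R * d <= b.
      rewrite -lerBrDl /d mulrCA ler_piMr ?subr_ge0// ler_pdivrMr// mul1r.
      by rewrite ler_nat.
    move: hb; rewrite e; set p := a + k%:R * d => hb.
    have pa : a <= p by rewrite lerDl mulr_ge0.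
    have pd : p <= p + d by rewrite lerDl.
    have := h p (p + d) pa pd hb; rewrite [p + d - p]addrAC subrr add0r => h1.
    rewrite -(subrKA (F p)) (le_trans (ler_normD _ _))//.
    by rewrite -natr1 mulrDr mulr1 addrC lerD// IH// ltnW.
  have := hk n.+1 (leqnn _).
  have -> : a + n.+1%:R * d = b by rewrite /d mulrC divfK// addrC subrK.
  move=> /le_trans; apply.
  suff -> : C * d ^+ 2 * n.+1%:R = C * (b - a) ^+ 2 / n.+1%:R by [].
  have : n.+1%:R != 0 :> R by rewrite pnatr_eq0.
  by rewrite /d; move: (n.+1%:R : R) => N N0; field.
apply/eqP; rewrite eq_sym -subr_eq0 -normr_eq0 eq_le normr_ge0 andbT leNgt.
apply/negP => F0; have := hn (Num.truncn (C * (b - a) ^+ 2 / `|F b - F a|)).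
rewrite leNgt ltr_pdivrMr// (mulrC `|_|) -ltr_pdivrMr// => /negP; apply.
exact: truncnS_gt.
Qed.

Lemma primD f F g G a b : bdm `]a, b[ f -> bdm `]a, b[ g ->
  prim f F a b -> prim g G a b ->
  prim (fun x => f x + g x) (fun x => F x + G x) a b.
Proof.
move=> hf hg hF hG x y ax xy yb; rewrite itgD; last 2 first.
- exact: bdm_sub hf.
- exact: bdm_sub hg.
by rewrite -hF// -hG//; ring.
Qed.

Lemma primN f F a b : bdm `]a, b[ f -> prim f F a b ->
  prim (fun x => - f x) (fun x => - F x) a b.
Proof.
move=> hf hF x y ax xy yb; rewrite itgN; last exact: bdm_sub hf.
by rewrite -hF//; ring.
Qed.

Lemma primB f F g G a b : bdm `]a, b[ f -> bdm `]a, b[ g ->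
  prim f F a b -> prim g G a b ->
  prim (fun x => f x - g x) (fun x => F x - G x) a b.
Proof. by move=> *; apply: primD => //; [exact: bdmN|exact: primN]. Qed.

Lemma eq_prim f f' F F' a b : (forall x, a < x < b -> f x = f' x) ->
  (forall x, a <= x <= b -> F x = F' x) -> prim f F a b -> prim f' F' a b.
Proof.
move=> ff FF h x y ax xy yb; rewrite -!FF; try lra.
by rewrite h//; apply: eq_itg => z hz; apply: ff; lra.
Qed.

(** Over a short interval the two sides differ by [O((y - x)^2)], because [F] and [G] are Lipschitz
    and [f] and [g] are bounded; [quad_const] removes the error. This yields integration by parts
    without continuity of the densities. *)
Lemma primM f F g G a b : bdm `]a, b[ f -> bdm `]a, b[ g ->
  prim f F a b -> prim g G a b ->
  prim (fun x => f x * G x + F x * g x) (fun x => F x * G x) a b.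
Proof.
move=> hf hg hF hG.
have hF' := prim_bdm hf hF; have hG' := prim_bdm hg hG.
have [C1 C10 l1] := prim_lip hf hF; have [C2 C20 l2] := prim_lip hg hG.
have [Cf hCf] := hf.2; have [Cg hCg] := hg.2.
set h := (fun x => f x * G x + F x * g x).
have hh : bdm `]a, b[ h by apply: bdmD; exact: bdmM.
pose K := C1 * C2 + `|Cf| * C2 + C1 * `|Cg|.
have key x y : a <= x -> x <= y -> y <= b ->
    `|F y * G y - F x * G x - itg h x y| <= K * (y - x) ^+ 2.
  move=> ax xy yb.
  have sf : bdm `]x, y[ f by exact: bdm_sub hf.
  have sg : bdm `]x, y[ g by exact: bdm_sub hg.
  have sF : bdm `]x, y[ F by exact: bdm_sub hF'.
  have sG : bdm `]x, y[ G by exact: bdm_sub hG'.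
  have e2 : itg (fun z => f z * (G z - G x)) x y =
      itg (fun z => f z * G z) x y - G x * itg f x y.
    rewrite -itgZ// -itgB; [|exact: bdmM|by apply: bdmM => //; exact: bdm_cst].
    by apply: eq_itg => z _; ring.
  have e3 : itg (fun z => (F z - F x) * g z) x y =
      itg (fun z => F z * g z) x y - F x * itg g x y.
    rewrite -itgZ// -itgB; [|exact: bdmM|by apply: bdmM => //; exact: bdm_cst].
    by apply: eq_itg => z _; ring.
  have -> : F y * G y - F x * G x - itg h x y =
     (F y - F x) * (G y - G x) - itg (fun z => f z * (G z - G x)) x y
        - itg (fun z => (F z - F x) * g z) x y.
    rewrite e2 e3 /h itgD; try exact: bdmM.
    by rewrite -hF// -hG//; ring.
  have d0 : 0 <= y - x by rewrite subr_ge0.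
  have b1 z : x <= z <= y -> `|F z - F x| <= C1 * (y - x).
    move=> hz; have := l1 x z; rewrite (ger0_norm (x := z - x)); last lra.
    move=> /(_ _ _)/le_trans; apply; [lra|lra|].
    by rewrite ler_wpM2l//; lra.
  have b2 z : x <= z <= y -> `|G z - G x| <= C2 * (y - x).
    move=> hz; have := l2 x z; rewrite (ger0_norm (x := z - x)); last lra.
    move=> /(_ _ _)/le_trans; apply; [lra|lra|].
    by rewrite ler_wpM2l//; lra.
  have n1 : `|(F y - F x) * (G y - G x)| <= C1 * C2 * (y - x) ^+ 2.
    rewrite normrM (_ : _ * _ ^+ 2 = (C1 * (y - x)) * (C2 * (y - x))); last by ring.
    by apply: ler_pM => //; [apply: b1|apply: b2]; lra.
  have n2 : `|itg (fun z => f z * (G z - G x)) x y| <= `|Cf| * C2 * (y - x) ^+ 2.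
    rewrite (_ : _ * _ ^+ 2 = (`|Cf| * (C2 * (y - x))) * (y - x)); last by ring.
    apply: itg_norm => //; first by apply: bdmM => //; apply: bdmB => //; exact: bdm_cst.
    move=> z hz; rewrite normrM; apply: ler_pM => //; last by apply: b2; lra.
    by rewrite (le_trans (hCf _ _)) ?ler_norm//= in_itv/=; lra.
  have n3 : `|itg (fun z => (F z - F x) * g z) x y| <= C1 * `|Cg| * (y - x) ^+ 2.
    rewrite (_ : _ * _ ^+ 2 = ((C1 * (y - x)) * `|Cg|) * (y - x)); last by ring.
    apply: itg_norm => //; first by apply: bdmM => //; apply: bdmB => //; exact: bdm_cst.
    move=> z hz; rewrite normrM; apply: ler_pM => //; first by apply: b1; lra.
    by rewrite (le_trans (hCg _ _)) ?ler_norm//= in_itv/=; lra.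
  have -> : K * (y - x) ^+ 2 = C1 * C2 * (y - x) ^+ 2 +
      `|Cf| * C2 * (y - x) ^+ 2 + C1 * `|Cg| * (y - x) ^+ 2 by rewrite /K; ring.
  rewrite (le_trans (ler_normB _ _))// lerD//.
  by rewrite (le_trans (ler_normB _ _))// lerD.
move=> x y ax xy yb; pose L z := F z * G z - F x * G x - itg h x z.
suff : L x = L y.
  rewrite /L subrr /itg set_itvoo0 Rintegral_set0 subrr => /esym/eqP.
  by rewrite subr_eq0 => /eqP.
apply: (@quad_const _ K) => // z w xz zw wy.
have -> : L w - L z = F w * G w - F z * G z - itg h z w.
  rewrite /L (@itg_cat _ x z w)//; first by ring.
  by apply: bdm_sub hh; lra.
by apply: key; lra.
Qed.

Lemma prim_derive f F a b :
  (forall x, a <= x <= b -> is_derive x (1 : R) F (f x)) ->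
  {within `[a, b], continuous f} -> prim f F a b.
Proof.
move=> hF cf x y ax xy yb.
case: (ltgtP x y) xy => // [{}xy _|<- _]; last first.
  by rewrite /itg set_itvoo0 Rintegral_set0 subrr.
have cf' : {within `[x, y], continuous f}.
  by apply: continuous_subspaceW cf; apply: subset_itv; rewrite bnd_simp.
have cF z : a <= z <= b -> {for z, continuous F}.
  by move=> /hF[dF _]; apply: differentiable_continuous; apply/derivable1_diffP.
have h := @continuous_FTC2 R f F x y xy cf'.
have ic : mu.-integrable `[x, y] (EFin \o f).
  by apply: bdm_int => //; [exact: itv_fin|exact: bdm_within].
have io : mu.-integrable `[x, y[ (EFin \o f).
  by apply: integrableS ic => //; apply: subset_itv_co_cc.
have ioo : mu.-integrable `]x, y[ (EFin \o f).
  by apply: integrableS ic => //; apply: subset_itv_oo_cc.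
rewrite /itg Rintegral_itv_obnd_cbnd// Rintegral_itv_bndo_bndc//.
rewrite /Rintegral h//; last first.
  move=> z; rewrite in_itv/= => hz.
  by have [_ <-] := hF z ltac:(lra); rewrite derive1E.
split.
- by move=> z; rewrite in_itv/= => hz; have [] := hF z ltac:(lra).
- by apply: cvg_at_right_filter; apply: cF; lra.
- by apply: cvg_at_left_filter; apply: cF; lra.
Qed.

Lemma is_derive_prim f F a b x : bdm `]a, b[ f -> prim f F a b -> a < x < b ->
  {for x, continuous f} -> is_derive x (1 : R) F (f x).
Proof.
move=> hf hF /andP[ax xb] cf.
have est e : 0 < e -> \forall h \near (0 : R)^', `|f x - h^-1 *: (F (h *: (1 : R) + x) - F x)| <= e.
  move=> e0; have /cvgrPdist_le/(_ _ e0) := cf.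
  rewrite near_simpl => /nbhs_ballP[d /= d0 hd].
  near=> h.
  have h0 : h != 0 by near: h; exact: nbhs_dnbhs_neq.
  have hm : `|h| < Num.min d (Num.min (x - a) (b - x)).
    near: h; apply: dnbhs0_lt.
    by rewrite !lt_min d0 !subr_gt0 ax.
  move: hm; rewrite !lt_min => /and3P[h1 h2 h3].
  have est0 u v : a <= u -> u <= v -> v <= b -> (forall z, u < z < v -> `|x - z| < d) ->
      `|itg f u v - f x * (v - u)| <= e * (v - u).
    move=> au uv vb huv; rewrite -itg_cst// -itgB; last 2 first.
    - exact: bdm_sub hf.
    - exact: bdm_cst.
    apply: itg_norm => //.
      by apply: bdmB; [exact: bdm_sub hf|exact: bdm_cst].
    by move=> z hz; rewrite distrC; apply: hd; apply: huv.
  rewrite -(ler_pM2l (x := `|h|)) ?normr_gt0// -normrM.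
  have -> : h * (f x - h^-1 *: (F (h *: (1 : R) + x) - F x)) = f x * h - (F (h + x) - F x).
    rewrite -[_ *: (_ - _)]/(_ * (_ - _)) -[h *: 1]/(h * 1) mulr1 mulrBr mulrA.
    by rewrite mulfV// mul1r mulrC.
  rewrite distrC.
  have [hp|hn] := ltP 0 h.
    have := ler_norm h => hh.
    have := est0 x (h + x); rewrite addrK => E.
    rewrite (hF x (h + x)); try lra.
    rewrite (gtr0_norm hp) (mulrC h e); apply: E; try lra.
    by move=> z hz; rewrite ltr_distl; lra.
  have hh := ler_norm (- h); rewrite normrN in hh.
  have := est0 (h + x) x; rewrite (_ : x - (h + x) = - h); last by ring.
  have -> : F (h + x) - F x - f x * h = - (itg f (h + x) x - f x * - h).
    by rewrite -hF; [ring|lra|lra|lra].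
  rewrite (ler0_norm hn) normrN => E.
  rewrite (mulrC (- h)); apply: E; try lra.
  by move=> z hz; rewrite ltr_distl; lra.
have cv : h^-1 *: (F (h *: (1 : R) + x) - F x) @[h --> (0 : R)^'] --> f x.
  by apply/cvgrPdist_le => e e0; exact: est.
apply: DeriveDef; first by apply/cvg_ex; exists (f x).
by apply: cvg_lim => //; exact: Rhausdorff.
Unshelve. all: by end_near. Qed.

End BoundedIntegrals.

(** * Weak solutions and the Green operator *)

Section Smooth.
Variable R : realType.
Implicit Types (f g : R -> R) (a b c d x y : R).

(** Indexing by the power of [1 / x] makes the span of the family closed under differentiation: the
    derivative of [flat n] combines [flat n.+2] and [flat n.+1]. *)
Definition flat (n : nat) x : R := if 0 < x then x^-1 ^+ n * expR (- x^-1) else 0.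

(** A single term of the exponential series at [1 / x], the one of degree [n + 2], suffices. The
    factor [x ^+ 2] makes the derivative at the origin vanish. *)
Lemma flat_le n x : `|flat n x| <= n.+2`!%:R * x ^+ 2.
Proof.
rewrite /flat; case: ifP => x0; last by rewrite normr0 mulr_ge0// ?ler0n// sqr_ge0.
rewrite ger0_norm; last by rewrite mulr_ge0 ?expR_ge0// exprn_ge0// invr_ge0 ltW.
have y0 : 0 < x^-1 by rewrite invr_gt0.
rewrite expRN ler_pdivrMr ?expR_gt0//.
have := @expR_ge1Dxn R x^-1 n.+1 (ltW y0) => h.
have {h} : x^-1 ^+ n.+2 <= n.+2`!%:R * expR x^-1.
  by rewrite -ler_pdivrMl ?ltr0n ?fact_gt0// mulrC; lra.
move=> h.
rewrite (_ : x^-1 ^+ n = x^-1 ^+ n.+2 * x ^+ 2); last first.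
  by rewrite -addn2 exprD -mulrA -exprMn mulVf ?gt_eqF// expr1n mulr1.
by rewrite (mulrAC (n.+2`!%:R)) ler_wpM2r// sqr_ge0.
Qed.

Lemma is_derive_flat n x :
  is_derive x (1 : R) (flat n) (flat n.+2 x - n%:R * flat n.+1 x).
Proof.
have [x0|x0|<-] := ltgtP 0 x.
- have e : {near x, (fun y => y^-1 ^+ n * expR (- y^-1)) =1 flat n}.
    by near=> y; rewrite /flat ifT//; near: y; exact: lt_nbhsr.
  apply: (near_eq_is_derive e).
  have dV := @is_deriveV R id x 1 1 (lt0r_neq0 x0) (is_derive_id _ _).
  have dE : is_derive x (1 : R) (fun y : R => expR (- y^-1)) (expR (- x^-1) * (x ^- 2)).
    apply: (@is_derive1_comp _ expR (fun y : R => - y^-1)).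
    by apply: is_derive_eq; rewrite -[_ *: 1]/(_ * _) mulr1 opprK.
  have dX := @is_deriveX R _ _ n x 1 _ dV.
  have dM := @is_deriveM R _ _ _ x 1 _ _ dX dE.
  have -> : (fun y : R => y^-1 ^+ n * expR (- y^-1)) =
      (fun y : R => y^-1) ^+ n * (fun y : R => expR (- y^-1)).
    by apply/funext => y; rewrite !fctE.
  apply: (is_derive_eq dM); rewrite !fctE.
  rewrite /flat x0.
  rewrite -![_ *: _]/(_ * _) /= mulr1.
  rewrite -!exprVn; move: (x^-1) (expR _) => y E.
  by case: n {e dX dM} => [|m] /=; rewrite -?[m.+1%:R]natr1 ?exprS; ring.
- have e : {near x, (fun=> 0) =1 flat n}.
    by near=> y; rewrite /flat ifF//; apply/negbTE; rewrite -leNgt ltW//; near: y; exact: lt_nbhsl.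
  apply: (near_eq_is_derive e).
  rewrite /flat !(ltNge 0 x) (ltW x0) /= mulr0 subr0; exact: is_derive_cst.
- rewrite {2 3}/flat ltxx mulr0 subr0.
  have cv : h^-1 *: (flat n (h *: (1 : R) + 0) - flat n 0) @[h --> (0 : R)^'] --> (0 : R).
    apply/cvgrPdist_le => eps eps0; near=> h.
    have h0 : h != 0 by near: h; exact: nbhs_dnbhs_neq.
    have hm : `|h| < eps / n.+2`!%:R.
      near: h; apply: dnbhs0_lt.
      by rewrite divr_gt0// ltr0n fact_gt0.
    rewrite {2}/flat ltxx subr0 addr0 sub0r normrN -[h *: 1]/(h * 1) mulr1.
    rewrite -[_ *: _]/(_ * _) normrM normfV mulrC ler_pdivrMr ?normr_gt0//.
    rewrite (le_trans (flat_le _ _))// -real_normK ?num_real// expr2 mulrA ler_wpM2r//.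
    by rewrite mulrC -ler_pdivlMr ?ltr0n ?fact_gt0// ltW.
  apply: DeriveDef; first by apply/cvg_ex; exists 0.
  by apply: cvg_lim => //; exact: Rhausdorff.
Unshelve. all: by end_near. Qed.

(* A class of smooth functions closed under differentiation and containing the bump functions. *)
Inductive flatfun : (R -> R) -> Prop :=
| flatfun_flat n c d : flatfun (fun x => flat n (c * x + d))
| flatfun_cst c : flatfun (fun=> c)
| flatfunD f g : flatfun f -> flatfun g -> flatfun (fun x => f x + g x)
| flatfunM f g : flatfun f -> flatfun g -> flatfun (fun x => f x * g x).

Lemma flatfun_derive f : flatfun f ->
  exists2 g, flatfun g & forall x, is_derive x (1 : R) f (g x).
Proof.
elim=> [n c d|c|{}f g _ [f' hf' df] _ [g' hg' dg]|{}f g hf [f' hf' df] hg [g' hg' dg]].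
- exists (fun x => (flat n.+2 (c * x + d) + - n%:R * flat n.+1 (c * x + d)) * c).
    apply: flatfunM; last exact: flatfun_cst.
    apply: flatfunD; first exact: flatfun_flat.
    by apply: flatfunM; [exact: flatfun_cst|exact: flatfun_flat].
  move=> x; rewrite mulNr.
  apply: (@is_derive1_comp _ (flat n) (fun x => c * x + d)); first exact: is_derive_flat.
  by apply: is_derive_eq; rewrite addr0 -[c *: 1]/(c * 1) mulr1.
- by exists (fun=> 0); [exact: flatfun_cst|move=> x; exact: is_derive_cst].
- exists (fun x => f' x + g' x); first exact: flatfunD.
  by move=> x; exact: is_deriveD.
- exists (fun x => f x * g' x + g x * f' x).
    by apply: flatfunD; exact: flatfunM.
  by move=> x; exact: is_deriveM.
Qed.

Definition smooth f := forall (n : nat) x, derivable (derive1n n f) x 1.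

Lemma flatfun_smooth f : flatfun f -> smooth f.
Proof.
move=> hf n; elim: n f hf => [|n IH] f hf x.
  by have [g _ dg] := flatfun_derive hf; have [] := dg x.
have [g hg dg] := flatfun_derive hf.
rewrite derive1Sn (_ : derive1 f = g); first exact: IH.
by apply/funext => y; rewrite derive1E; have [] := dg y.
Qed.

Lemma smooth_prim f g : smooth f -> (forall x, is_derive x (1 : R) g (f x)) -> smooth g.
Proof.
move=> sf dg [|n] x; first by have [] := dg x.
rewrite derive1Sn (_ : derive1 g = f); first exact: sf.
by apply/funext => y; rewrite derive1E; have [] := dg y.
Qed.

End Smooth.

(** * The inner product of L^2(D) *)

Section InnerProduct.
Variable R : realType.
Notation mu := (@lebesgue_measure R).
Implicit Types (f g h : R -> R) (a b c d x y : R).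

Lemma innerE f g : inner f g = itg (fun x => f x * g x) (-1) 1.
Proof. by []. Qed.

Lemma innerC f g : inner f g = inner g f.
Proof. by apply: eq_Rintegral => x _; rewrite mulrC. Qed.

Lemma measurable_D : measurable (D R).
Proof. exact: measurable_itv. Qed.

Lemma L2_bdm f : bdm (D R) f -> L2 f.
Proof.
move=> hf; split; first exact: hf.1.
have := bdm_itg (bdmM hf hf); congr (_.-integrable _ _).
Qed.

Lemma L2_mul f g : L2 f -> L2 g -> mu.-integrable (D R) (fun x => (f x * g x)%:E).
Proof.
move=> [mf if2] [mg ig2].
have hs : mu.-integrable (D R) (fun x => ((f x) ^+ 2 + (g x) ^+ 2)%:E).
  by apply: integrableD if2 ig2; exact: measurable_D.
apply: le_integrable hs; first exact: measurable_D.
- by apply/measurable_EFinP; exact: measurable_funM.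
- move=> x _; rewrite /= lee_fin (ger0_norm (x := _ ^+ 2 + _)); last first.
    by rewrite addr_ge0 ?sqr_ge0.
  rewrite ler_norml; apply/andP; split; nra.
Qed.

Lemma L2Z c f : L2 f -> L2 (fun x => c * f x).
Proof.
move=> [mf if2]; split; first by apply: measurable_funM.
under [X in integrable _ _ X]eq_fun do rewrite exprMn EFinM.
by apply: integrableZl if2; exact: measurable_D.
Qed.

Lemma L2D f g : L2 f -> L2 g -> L2 (fun x => f x + g x).
Proof.
move=> hf hg; have hfg := L2_mul hf hg; move: hf hg => [mf if2] [mg ig2].
split; first exact: measurable_funD.
have -> : (fun x => ((f x + g x) ^+ 2)%:E) =
    (fun x => ((f x)^+2)%:E + (2%:E * (f x * g x)%:E + ((g x)^+2)%:E))%E.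
  by apply/funext => x; rewrite -!EFinM -!EFinD; congr (_%:E); ring.
apply: integrableD => //; first exact: measurable_D.
apply: integrableD => //; first exact: measurable_D.
by apply: integrableZl => //; exact: measurable_D.
Qed.

Lemma L2N f : L2 f -> L2 (fun x => - f x).
Proof. by move=> /(L2Z (-1)); under eq_fun do rewrite mulN1r. Qed.

Lemma L2B f g : L2 f -> L2 g -> L2 (fun x => f x - g x).
Proof. by move=> hf hg; apply: L2D => //; exact: L2N. Qed.

Lemma innerDl f g h : L2 f -> L2 g -> L2 h ->
  inner (fun x => f x + g x) h = inner f h + inner g h.
Proof.
move=> hf hg hh; rewrite /inner -RintegralD; [|exact: measurable_D|exact: L2_mul..].
by apply: eq_Rintegral => x _; rewrite mulrDl.
Qed.

Lemma innerZl c f h : L2 f -> L2 h -> inner (fun x => c * f x) h = c * inner f h.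
Proof.
move=> hf hh; rewrite /inner -RintegralZl; [|exact: measurable_D|exact: L2_mul].
by apply: eq_Rintegral => x _; rewrite mulrA.
Qed.

Lemma innerZr c f h : L2 f -> L2 h -> inner h (fun x => c * f x) = c * inner h f.
Proof. by move=> hf hh; rewrite innerC innerZl// innerC. Qed.

Lemma innerNl f h : L2 f -> L2 h -> inner (fun x => - f x) h = - inner f h.
Proof.
move=> hf hh; rewrite -mulN1r -innerZl//; apply: eq_Rintegral => x _.
by rewrite mulN1r.
Qed.

Lemma innerBl f g h : L2 f -> L2 g -> L2 h ->
  inner (fun x => f x - g x) h = inner f h - inner g h.
Proof. by move=> hf hg hh; rewrite innerDl ?innerNl//; exact: L2N. Qed.

Lemma inner_ge0 f : 0 <= inner f f.
Proof. by apply: Rintegral_ge0 => x _; rewrite -expr2 sqr_ge0. Qed.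

Lemma inner_sumsq f g : L2 f -> L2 g ->
  inner (fun x => f x + g x) (fun x => f x + g x) =
  inner f f + 2 * inner f g + inner g g.
Proof.
move=> hf hg; have hs := L2D hf hg.
rewrite innerDl// innerC (innerC g) !innerDl// (innerC g f); ring.
Qed.

Lemma inner_add_le f g : L2 f -> L2 g ->
  inner (fun x => f x + g x) (fun x => f x + g x) <= 2 * (inner f f + inner g g).
Proof.
move=> hf hg; rewrite inner_sumsq//.
have := inner_ge0 (fun x => f x + -1 * g x).
rewrite inner_sumsq//; last exact: L2Z.
rewrite innerZr// innerZl ?innerZr//; last exact: L2Z.
by nra.
Qed.

(** Cauchy-Schwarz without square roots: the square norm of [f + s g] is non-negative at [s = e] and
    at [s = - e]. *)
Lemma inner_small e f g : L2 f -> L2 g -> 0 < e -> inner f f <= e ^+ 2 ->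
  `|inner f g| <= e * (1 + inner g g).
Proof.
move=> hf hg e0 fe.
have key s : 0 <= inner f f + 2 * s * inner f g + s ^+ 2 * inner g g.
  have := inner_ge0 (fun x => f x + s * g x).
  rewrite inner_sumsq//; last exact: L2Z.
  rewrite innerZr// innerZl ?innerZr//; last exact: L2Z.
  by nra.
have := key e; have := key (- e); have g0 := inner_ge0 g.
move: (inner f g) (inner f f) (inner g g) fe g0 => p q r fe g0 h1 h2.
rewrite ler_norml; apply/andP; split.
  rewrite -(ler_pM2l e0); nra.
rewrite -(ler_pM2l e0); nra.
Qed.

End InnerProduct.

(** * Approximation in L^2(D) by smooth functions with compact support *)

Section Density.
Variable R : realType.
Implicit Types (f g h k z : R -> R) (a b c d x y : R).

Lemma flatfun_continuous f : flatfun f -> continuous f.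
Proof.
move=> /flatfun_derive[g _ dg] x; apply: differentiable_continuous.
by apply/derivable1_diffP; have [] := dg x.
Qed.

Lemma flatfun_bdm f a b : flatfun f -> bdm `]a, b[ f.
Proof.
move=> /flatfun_continuous cf; apply: (@bdmS _ `[a, b]) => //.
  exact: subset_itv_oo_cc.
by apply: bdm_within; exact: continuous_subspaceT.
Qed.

Definition vanish f b := b < 1 /\ forall x, b <= `|x| -> f x = 0.

Lemma vanishD f g b b' : vanish f b -> vanish g b' ->
  vanish (fun x => f x + g x) (Num.max b b').
Proof.
move=> [b1 fb] [b1' gb]; split; first by rewrite gt_max b1.
by move=> x; rewrite ge_max => /andP[h1 h2]; rewrite fb// gb// addr0.
Qed.

Lemma vanishZ f c b : vanish f b -> vanish (fun x => c * f x) b.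
Proof. by move=> [b1 fb]; split => // x hx; rewrite fb// mulr0. Qed.

Lemma expRN_ge (y : R) : 1 - expR (- y) <= y.
Proof. by have := @expR_ge1Dx R (- y); lra. Qed.

Lemma bump_exists a b e : -1 <= a -> a < b -> b <= 1 -> 0 < e ->
  exists g, [/\ flatfun g, exists r, vanish g r, forall x, 0 <= g x <= 1,
    (forall x, ~~ (a < x < b) -> g x = 0) & b - a - e <= itg g a b].
Proof.
move=> a1 ab b1 e0.
pose eta := Num.min (e / 8) ((b - a) / 8).
have eta0 : 0 < eta by rewrite lt_min !divr_gt0// subr_gt0.
have eta1 : eta <= e / 8 by rewrite ge_min lexx.
have eta2 : eta <= (b - a) / 8 by rewrite ge_min lexx orbT.
(* At distance [eta] inside its ramp a factor has argument at least [K * eta = 16 / e], where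
   [1 - expR (- y^-1) <= y^-1] leaves a loss of at most [e / 16]. The margin [eta] keeps the support
   away from -1 and 1 even if [a] or [b] is an end point. *)
pose K := 16 / (eta * e).
have K0 : 0 < K by rewrite divr_gt0// mulr_gt0.
pose g x := flat 0 (K * x + (- K * (a + eta))) * flat 0 (- K * x + K * (b - eta)).
have fg : flatfun g by apply: flatfunM; exact: flatfun_flat.
have fl01 (y : R) : 0 <= flat 0 y <= 1.
  rewrite /flat; case: ifP => y0; last by rewrite lexx ler01.
  by rewrite expr0 mul1r expR_ge0/= expR_le1 oppr_le0 invr_ge0 ltW.
have g01 x : 0 <= g x <= 1.
  have /andP[h1 h2] := fl01 (K * x + (- K * (a + eta))).
  have /andP[h3 h4] := fl01 (- K * x + K * (b - eta)).
  by rewrite mulr_ge0//= mulr_ile1.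
have g0 x : ~~ (a + eta < x < b - eta) -> g x = 0.
  rewrite negb_and -!leNgt => hx; rewrite /g /flat.
  case: ifP => h1; last by rewrite mul0r.
  case: ifP => h2; last by rewrite mulr0.
  by case/orP: hx; nra.
have glow x : a + 2 * eta <= x <= b - 2 * eta -> 1 - e / 4 <= g x.
  move=> /andP[h1 h2].
  have ineq (y : R) : K * eta <= y -> 1 - e / 8 <= flat 0 y.
    move=> hy; have y0 : 0 < y by apply: lt_le_trans hy; exact: mulr_gt0.
    rewrite /flat y0 expr0 mul1r.
    have := expRN_ge y^-1.
    have : y^-1 <= (K * eta)^-1 by rewrite lef_pV2// posrE mulr_gt0.
    have -> : (K * eta)^-1 = e / 16 by rewrite /K; field; rewrite !gt_eqF.
    lra.
  have i1 : 1 - e / 8 <= flat 0 (K * x + (- K * (a + eta))) by apply: ineq; nra.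
  have i2 : 1 - e / 8 <= flat 0 (- K * x + K * (b - eta)) by apply: ineq; nra.
  have /andP[h3 h4] := fl01 (K * x + (- K * (a + eta))).
  have /andP[h5 h6] := fl01 (- K * x + K * (b - eta)).
  rewrite /g; nra.
exists g; split => //.
- exists (1 - eta); split; first lra.
  move=> x hx; apply: g0; apply/negP => /andP[h1 h2].
  have : `|x| < 1 - eta by rewrite ltr_norml; lra.
  lra.
- by move=> x hx; apply: g0; apply: contra hx; lra.
- have gb : bdm `]a, b[ g by exact: flatfun_bdm.
  rewrite (@itg_cat _ g a (a + 2 * eta) b)//; try lra.
  rewrite (@itg_cat _ g (a + 2 * eta) (b - 2 * eta) b); try lra; last exact: flatfun_bdm.
  have n1 u v : 0 <= itg g u v by apply: Rintegral_ge0 => x _; have := g01 x; lra.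
  have n2 : (1 - e / 4) * ((b - 2 * eta) - (a + 2 * eta)) <= itg g (a + 2 * eta) (b - 2 * eta).
    rewrite -itg_cst; last lra.
    by apply: le_itg; [exact: bdm_cst|exact: flatfun_bdm|move=> x hx; apply: glow; lra].
  have := n1 a (a + 2 * eta); have := n1 (b - 2 * eta) b.
  nra.
Qed.

(* [k] is an L^2-limit of functions in C_c^oo(D). *)
Definition approx k := bdm (D R) k /\ forall e, 0 < e ->
  exists g, [/\ flatfun g, exists r, vanish g r &
    inner (fun x => k x - g x) (fun x => k x - g x) < e].

Lemma flatfun_L2 g : flatfun g -> L2 g.
Proof. by move=> fg; apply: L2_bdm; exact: flatfun_bdm. Qed.

Lemma approxD k1 k2 : approx k1 -> approx k2 -> approx (fun x => k1 x + k2 x).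
Proof.
move=> [b1 h1] [b2 h2]; split; first exact: bdmD.
move=> e e0; have e4 : 0 < e / 4 by rewrite divr_gt0.
have [g1 [fg1 [r1 v1] i1]] := h1 _ e4; have [g2 [fg2 [r2 v2] i2]] := h2 _ e4.
exists (fun x => g1 x + g2 x); split.
- exact: flatfunD.
- by exists (Num.max r1 r2); exact: vanishD.
- rewrite (_ : (fun x => _) = (fun x => (k1 x - g1 x) + (k2 x - g2 x))); last first.
    by apply/funext => x; ring.
  apply: le_lt_trans (inner_add_le _ _) _; last lra.
  + by apply: L2B; [exact: L2_bdm|exact: flatfun_L2].
  + by apply: L2B; [exact: L2_bdm|exact: flatfun_L2].
Qed.

Lemma approxZ c k : approx k -> approx (fun x => c * k x).
Proof.
move=> [b1 h1]; split; first by apply: bdmM => //; exact: bdm_cst.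
move=> e e0; have c0 : 0 < c ^+ 2 + 1 by rewrite ltr_wpDl// sqr_ge0.
have [g1 [fg1 [r1 v1] i1]] := h1 _ (divr_gt0 e0 c0).
have L : L2 (fun x => k x - g1 x) by apply: L2B; [exact: L2_bdm|exact: flatfun_L2].
exists (fun x => c * g1 x); split.
- by apply: flatfunM => //; exact: flatfun_cst.
- by exists r1; exact: vanishZ.
- rewrite (_ : (fun x => _) = (fun x => c * (k x - g1 x))); last first.
    by apply/funext => x; ring.
  rewrite innerZl// ?innerZr//; last exact: L2Z.
  move: i1; rewrite ltr_pdivlMr//; have := inner_ge0 (fun x => k x - g1 x); nra.
Qed.

(** Half-open intervals tile under bisection. Since [0 <= 1 - g <= 1], the square of [1 - g] is at
    most [1 - g], so the L^1 deficit of the bump also controls its L^2 distance. *)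
Lemma approx_indic a b : -1 <= a -> a <= b -> b <= 1 -> approx (\1_(`]a, b]) : R -> R).
Proof.
move=> a1 ab b1; split; first exact: bdm_ind.
move=> e e0.
case: (ltgtP a b) ab => // [{}ab _|<- _]; last first.
  exists (fun=> 0); split; first exact: flatfun_cst.
    by exists 0; split.
  rewrite set_itv_ge ?bnd_simp ?ltxx// innerE (eq_itg (g := fun=> 0)).
    by rewrite itg_cst// mul0r.
  by move=> x _; rewrite indic0 subrr mulr0.
have [g [fg vg g01 g0 ig]] := bump_exists a1 ab b1 (divr_gt0 e0 (ltr0n _ 2)).
exists g; split => //.
set w := (fun x => _ - _).
have wb c d : bdm `]c, d[ w by apply: bdmB; [exact: bdm_ind|exact: flatfun_bdm].
have wb2 c d : bdm `]c, d[ (fun x => w x * w x) by exact: bdmM.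
rewrite innerE (@itg_cat _ _ (-1) a 1)//; try lra.
rewrite (@itg_cat _ _ a b 1)//; try lra.
have z1 : itg (fun x => w x * w x) (-1) a = 0.
  rewrite (eq_itg (g := fun=> 0)) ?itg_cst ?mul0r// => x hx.
  rewrite /w indicE g0; last by apply/negP; lra.
  by rewrite memNset ?subrr ?mulr0//= in_itv/=; lra.
have z2 : itg (fun x => w x * w x) b 1 = 0.
  rewrite (eq_itg (g := fun=> 0)) ?itg_cst ?mul0r// => x hx.
  rewrite /w indicE g0; last by apply/negP; lra.
  by rewrite memNset ?subrr ?mulr0//= in_itv/=; lra.
rewrite z1 z2 addr0 add0r.
have : itg (fun x => w x * w x) a b <= itg (fun x => 1 - g x) a b.
  apply: le_itg => //; first by apply: bdmB; [exact: bdm_cst|exact: flatfun_bdm].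
  move=> x hx; rewrite /w indicE mem_set/=; last by rewrite in_itv/=; lra.
  have := g01 x; nra.
rewrite itgB; [|exact: bdm_cst|exact: flatfun_bdm].
rewrite itg_cst; [lra|exact: ltW].
Qed.

(* Bisection approximates a Lipschitz function uniformly by step functions. *)
Lemma lip_step k L n c d :
  (forall x y, -1 <= x <= 1 -> -1 <= y <= 1 -> `|k y - k x| <= L * `|y - x|) ->
  0 <= L -> -1 <= c -> c <= d -> d <= 1 ->
  exists s, [/\ approx s, forall x, ~~ (c < x <= d) -> s x = 0 &
    forall x, c < x <= d -> `|k x - s x| <= L * (d - c) / 2 ^+ n].
Proof.
move=> hL L0; elim: n c d => [|n IH] c d c1 cd d1.
  exists (fun x => k d * \1_(`]c, d]) x); split.
  - by apply: approxZ; exact: approx_indic.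
  - by move=> x hx; rewrite indicE memNset ?mulr0//= in_itv/=; exact/negP.
  - move=> x hx; rewrite indicE mem_set/= ?in_itv//= mulr1 expr0 divr1.
    have := hL d x ltac:(lra) ltac:(lra); rewrite (ler0_norm (x := x - d)); last lra.
    by move=> /le_trans; apply; rewrite ler_wpM2l//; lra.
have [s1 [A1 z1 e1]] := IH c ((c + d) / 2) c1 ltac:(lra) ltac:(lra).
have [s2 [A2 z2 e2]] := IH ((c + d) / 2) d ltac:(lra) ltac:(lra) d1.
exists (fun x => s1 x + s2 x); split.
- exact: approxD.
- move=> x hx; rewrite z1 ?z2 ?addr0//; apply: contra hx; lra.
- move=> x hx.
  have -> : L * (d - c) / 2 ^+ n.+1 = L * ((d - c) / 2) / 2 ^+ n.
    by rewrite exprS invfM; ring.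
  case: (leP x ((c + d) / 2)) => hm.
    rewrite z2 ?addr0; last by apply/negP; lra.
    rewrite (_ : (d - c) / 2 = (c + d) / 2 - c); last by field.
    by apply: e1; lra.
  rewrite z1 ?add0r; last by apply/negP; lra.
  rewrite (_ : (d - c) / 2 = d - (c + d) / 2); last by field.
  by apply: e2; lra.
Qed.

Lemma approx_lim k : bdm (D R) k ->
  (forall e, 0 < e -> exists2 s, approx s & forall x, D R x -> `|k x - s x| <= e) ->
  approx k.
Proof.
move=> hk h; split => // e e0.
pose d := Num.min 1 (e / 16).
have d0 : 0 < d by rewrite lt_min ltr01/= divr_gt0.
have [d1 d2] : d <= 1 /\ d <= e / 16 by rewrite !ge_min !lexx orbT.
have [s [bs hs] ks] := h d d0.
have [g [fg vg ig]] := hs (e / 4) ltac:(lra).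
exists g; split => //.
rewrite (_ : (fun x => _) = (fun x => (k x - s x) + (s x - g x))); last first.
  by apply/funext => x; ring.
apply: le_lt_trans (inner_add_le _ _) _.
- by apply: L2_bdm; exact: bdmB.
- by apply: L2B; [exact: L2_bdm|exact: flatfun_L2].
have : `|inner (fun x => k x - s x) (fun x => k x - s x)| <= d * d * (1 - -1).
  rewrite innerE; apply: itg_norm; [by lra|by apply: bdmM; exact: bdmB|].
  by move=> x hx; rewrite normrM ler_pM//; apply: ks; rewrite /D/= in_itv/=.
move=> /(le_trans (ler_norm _)); nra.
Qed.

Lemma approx_lip k L :
  (forall x y, -1 <= x <= 1 -> -1 <= y <= 1 -> `|k y - k x| <= L * `|y - x|) ->
  approx k.
Proof.
move=> hL0.
have hL x y : -1 <= x <= 1 -> -1 <= y <= 1 -> `|k y - k x| <= `|L| * `|y - x|.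
  by move=> hx hy; rewrite (le_trans (hL0 _ _ hx hy))// ler_wpM2r// ler_norm.
apply: approx_lim.
  apply: (@bdmS _ `[(-1), 1]) => //; first exact: subset_itv_oo_cc.
  by apply: bdm_within; exact: lip_within hL.
move=> e e0.
pose n := Num.truncn (`|L| * 2 / e).
have hn : `|L| * 2 / e < 2 ^+ n :> R.
  apply: lt_le_trans (truncnS_gt _) _; rewrite -natrX ler_nat; exact: ltn_expl.
have h11 : -1 <= 1 :> R by lra.
have [s [As zs es]] := lip_step n hL (normr_ge0 _) (lexx _) h11 (lexx _).
exists s => // x; rewrite /D/= in_itv/= => hx.
apply: le_trans (es x _) _; first lra.
rewrite ler_pdivrMr ?exprn_gt0//; move: hn; rewrite ltr_pdivrMr//.
move: (2 ^+ n) => N; lra.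
Qed.

Lemma prim_itg f a b : bdm `]a, b[ f -> prim f (itg f a) a b.
Proof.
move=> hf x y ax xy yb; rewrite (@itg_cat _ f a x y)//; first by ring.
exact: bdm_sub hf.
Qed.

(** Expand the integral of the square of [f - m / 2], where [m] is the integral of [f]; the constant
    2 is the length of [D]. *)
Lemma sqr_itg_le f a b : -1 <= a -> a <= b -> b <= 1 -> bdm (D R) f ->
  itg f a b ^+ 2 <= 2 * inner f f.
Proof.
move=> a1 ab b1 hf.
have hs : bdm `]a, b[ f by exact: bdm_sub hf.
have hq : bdm `](-1), 1[ (fun x => f x * f x) by exact: bdmM.
have n1 u v : 0 <= itg (fun x => f x * f x) u v.
  by apply: Rintegral_ge0 => x _; rewrite -expr2 sqr_ge0.
have : itg (fun x => f x * f x) a b <= inner f f.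
  rewrite innerE (@itg_cat _ _ (-1) a 1)//; try lra.
  rewrite (@itg_cat _ _ a b 1)//; try lra; last exact: bdm_sub hq.
  by have := n1 (-1) a; have := n1 b 1; lra.
set m := itg f a b; set q := itg _ a b => qi.
have key : 0 <= q - m * m + (m / 2) ^+ 2 * (b - a).
  have : 0 <= itg (fun x => (f x - m / 2) * (f x - m / 2)) a b.
    by apply: Rintegral_ge0 => x _; rewrite -expr2 sqr_ge0.
  rewrite (eq_itg (g := fun x => (f x * f x - m * f x) + (m / 2) ^+ 2)) => [|x _]; last by field.
  have hm : bdm `]a, b[ (fun x => m * f x) by apply: bdmM => //; exact: bdm_cst.
  rewrite itgD; [|by apply: bdmB => //; exact: bdmM|exact: bdm_cst].
  rewrite itgB; [|exact: bdmM|exact: hm].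
  by rewrite itgZ// itg_cst.
nra.
Qed.

Lemma vanish_mono f b b' : b <= b' -> b' < 1 -> vanish f b -> vanish f b'.
Proof. by move=> bb b1 [_ h]; split => // x hx; apply: h; exact: le_trans hx. Qed.

(** The vanishing mean makes the primitive of [g] return to 0 to the right of the support of [g], so
    it is compactly supported in [D]. *)
Lemma test_fun_prim g r : flatfun g -> vanish g r -> itg g (-1) 1 = 0 ->
  exists phi, [/\ test_fun phi, derive1 phi = g &
    forall x, -1 <= x <= 1 -> phi x = itg g (-1) x].
Proof.
move=> fg vg0 ig.
have [b [b0 vg]] : exists b, 0 <= b /\ vanish g b.
  exists (Num.max 0 r); split; first by rewrite le_max lexx.
  apply: vanish_mono (vg0); first by rewrite le_max lexx orbT.
  by rewrite gt_max ltr01; case: vg0.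
have [b1 gz] := vg.
have gz1 x : x <= - b -> g x = 0.
  by move=> hx; apply: gz; rewrite ler_normr; apply/orP; right; lra.
have gz2 x : b <= x -> g x = 0.
  by move=> hx; apply: gz; rewrite ler_normr hx.
have gB c d : bdm `]c, d[ g by exact: flatfun_bdm.
(* The base point -2 lies to the left of the support, so every [x >= - b] is interior to an interval
   on which [phi] is a primitive. For [x < -2] the interval of integration is empty and the value 0
   is the right one. *)
pose phi x := itg g (-2) x.
have it0 c d : c <= d -> (forall x, c < x < d -> g x = 0) -> itg g c d = 0.
  by move=> cd h; rewrite (eq_itg (g := fun=> 0)) ?itg_cst ?mul0r.
have phi0 x : x <= - b -> phi x = 0.
  move=> hx; rewrite /phi; case: (leP (-2) x) => h2.
    by apply: it0 => // y hy; apply: gz1; lra.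
  by rewrite /itg set_itv_ge ?Rintegral_set0// bnd_simp -leNgt ltW.
have phiE x : -1 <= x -> phi x = itg g (-1) x.
  move=> hx; rewrite /phi (@itg_cat _ g (-2) (-1) x)//; last lra.
  by rewrite (it0 (-2)) ?add0r; [by []|lra|move=> y hy; apply: gz1; lra].
have phi1 x : b <= x -> phi x = 0.
  move=> hx; rewrite phiE; last lra.
  case: (leP x 1) => x1.
    rewrite -ig (@itg_cat _ g (-1) x 1)//; last lra.
    by rewrite (it0 x) ?addr0// => y hy; apply: gz2; lra.
  rewrite (@itg_cat _ g (-1) 1 x)//; try lra; rewrite ig add0r.
  by apply: it0; [lra|move=> y hy; apply: gz2; lra].
have dphi x : is_derive x (1 : R) phi (g x).
  have [xb|xb] := ltP x (- b).
    have e : {near x, (fun=> 0) =1 phi}.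
      near=> y; rewrite phi0//; near: y; have := lt_nbhsl xb; apply: filterS => y; exact: ltW.
    by apply: (near_eq_is_derive e); rewrite gz1 ?ltW//; exact: is_derive_cst.
  apply: (@is_derive_prim _ g phi (-2) (x + 1)) => //; last exact: flatfun_continuous.
    exact: prim_itg.
  by lra.
exists phi; split.
- split; first exact: smooth_prim (flatfun_smooth fg) dphi.
  have sub : [set x | phi x != 0] `<=` `[(- b), b].
    move=> x /= hx; rewrite in_itv/=; apply/andP; split; rewrite leNgt; apply/negP => h.
      by move: hx; rewrite phi0 ?eqxx// ltW.
    by move: hx; rewrite phi1 ?eqxx// ltW.
  have sub' : closure [set x | phi x != 0] `<=` `[(- b), b].
    by rewrite closureE; apply: smallest_sub => //; exact: interval_closed.
  split.
    apply: (@subclosed_compact _ _ `[(- b), b]%classic) => //; first exact: closed_closure.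
    exact: segment_compact.
  by move=> x /sub' /=; rewrite /D/= !in_itv/=; lra.
- by apply/funext => x; rewrite derive1E; have [] := dphi x.
- by move=> x /andP[h _]; exact: phiE.
Unshelve. all: by end_near. Qed.

End Density.

(** * Existence, self-adjointness and independence of the representative for the Green operator *)

Section Green.
Variable R : realType.
Notation mu := (@lebesgue_measure R).
Implicit Types (f g h k z u v phi : R -> R) (a b c d x y e : R).

(** Approximate the derivative [k] rather than [z]. As [k] has mean 0, a smooth approximant has
    small mean, which a small multiple of a fixed bump [r0] cancels; integrating the result gives
    the test function. *)
Lemma test_fun_dense k z L :
  (forall x y, -1 <= x <= 1 -> -1 <= y <= 1 -> `|k y - k x| <= L * `|y - x|) ->
  prim k z (-1) 1 -> z (-1) = 0 -> z 1 = 0 ->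
  forall e, 0 < e -> exists2 phi, test_fun phi &
    inner (fun x => z x - phi x) (fun x => z x - phi x) +
    inner (fun x => k x - derive1 phi x) (fun x => k x - derive1 phi x) < e.
Proof.
move=> kL zk z0 z1 e e0.
have [bk ak] := approx_lip kL.
have ik : itg k (-1) 1 = 0 by rewrite -zk ?lexx ?z0 ?z1 ?subrr//; lra.
have [r0 [fr0 [br0 vr0] r01 r0z ir0]] : exists g, [/\ flatfun g, exists r, vanish g r,
    forall x, 0 <= g x <= 1, (forall x, ~~ (-1 < x < 1) -> g x = 0) & 1 - -1 - 1 <= itg g (-1) (1 : R)].
  by apply: bump_exists; lra.
pose m0 := itg r0 (-1) 1.
have m01 : 1 <= m0 by rewrite (le_trans _ ir0)//; lra.
pose C := inner r0 r0 / m0 ^+ 2.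
have C0 : 0 <= C by rewrite divr_ge0 ?inner_ge0 ?sqr_ge0.
have d0 : 0 < e / (5 * (2 + 4 * C)) by rewrite divr_gt0//; lra.
have [g [fg [bg vg] ig]] := ak _ d0.
pose m := itg g (-1) 1.
pose G := fun x => g x + (- m / m0) * r0 x.
have fG : flatfun G.
  by apply: flatfunD => //; apply: flatfunM => //; exact: flatfun_cst.
have iG : itg G (-1) 1 = 0.
  rewrite /G itgD; [|exact: flatfun_bdm|by apply: flatfun_bdm; apply: flatfunM => //; exact: flatfun_cst].
  rewrite itgZ; last exact: flatfun_bdm.
  by rewrite -/m0 mulfVK ?subrr// gt_eqF//; lra.
have vG : vanish G (Num.max bg br0) by apply: vanishD => //; exact: vanishZ.
have [phi [tphi dphi phiE]] := test_fun_prim fG vG iG.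
exists phi => //; rewrite dphi.
have bkG : bdm (D R) (fun x => k x - G x) by apply: bdmB => //; exact: flatfun_bdm.
have Lkg : L2 (fun x => k x - g x) by apply: L2B; [exact: L2_bdm|exact: flatfun_L2].
set q := inner (fun x => k x - g x) _ in ig.
set Q := inner (fun x => k x - G x) _.
have mq : m ^+ 2 <= 2 * q.
  have -> : m ^+ 2 = (itg (fun x => k x - g x) (-1) 1) ^+ 2.
    by rewrite itgB//; [rewrite ik sub0r sqrrN|exact: flatfun_bdm].
  by apply: sqr_itg_le; [lra|lra|lra|apply: bdmB => //; exact: flatfun_bdm].
have hQ : Q <= (2 + 4 * C) * q.
  rewrite /Q (_ : (fun x => _) = (fun x => (k x - g x) + (m / m0) * r0 x)); last first.
    by apply/funext => x; rewrite /G; ring.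
  apply: le_trans (inner_add_le _ _) _ => //; first by apply: L2Z; exact: flatfun_L2.
  rewrite innerZl ?innerZr//; [|exact: flatfun_L2..|by apply: L2Z; exact: flatfun_L2].
  rewrite -/q (_ : m / m0 * _ = m ^+ 2 * C); last by rewrite /C; field; lra.
  nra.
have Q0 : 0 <= Q by exact: inner_ge0.
have zQ : `|inner (fun x => z x - phi x) (fun x => z x - phi x)| <= 2 * Q * (1 - -1).
  have bz : bdm (D R) (fun x => z x - phi x).
    apply: bdmB; first exact: prim_bdm zk.
    apply: (@prim_bdm _ G); first exact: flatfun_bdm.
    apply: (@eq_prim _ G G (itg G (-1))) => //; first by move=> x hx; rewrite phiE.
    by apply: prim_itg; exact: flatfun_bdm.
  rewrite innerE; apply: itg_norm; [lra|exact: bdmM|].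
  move=> x hx; rewrite phiE; last lra.
  have -> : z x - itg G (-1) x = itg (fun y => k y - G y) (-1) x.
    rewrite itgB; [|by apply: bdm_sub bk; lra|exact: flatfun_bdm].
    by rewrite -(zk (-1) x) ?z0 ?subr0//; lra.
  rewrite -expr2 ger0_norm ?sqr_ge0//; apply: sqr_itg_le => //; lra.
move: zQ => /(le_trans (ler_norm _)) zQ.
have : 5 * Q < e.
  move: ig; rewrite ltr_pdivlMr; last lra.
  nra.
lra.
Qed.

Lemma derive1n_test phi n : test_fun phi -> test_fun (derive1n n phi).
Proof.
elim: n phi => [//|n IH] phi tphi; rewrite derive1Sn; apply: IH.
move: tphi => [sphi [cphi sub]].
have z0 x : (~` closure [set x | phi x != 0]) x -> derive1 phi x = 0.
  move=> hx; have e : {near x, (fun=> 0) =1 phi}.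
    have : nbhs x (~` closure [set x | phi x != 0]).
      by apply: open_nbhs_nbhs; split => //; rewrite openC; exact: closed_closure.
    apply: filterS => y hy; apply/esym/eqP/negPn/negP => py; apply: hy.
    exact: subset_closure.
  rewrite derive1E -(near_eq_derive _ e); exact: derive_cst.
have sub1 : closure [set x | derive1 phi x != 0] `<=` closure [set x | phi x != 0].
  rewrite [X in X `<=` _]closureE; apply: smallest_sub; first exact: closed_closure.
  by move=> x /= /eqP hx; apply: contrapT => hx'; apply: hx; exact: z0.
split; first by move=> m x; rewrite -derive1Sn; exact: sphi.
split; last exact: subset_trans sub.
by apply: subclosed_compact sub1 => //; exact: closed_closure.
Qed.

Lemma test_fun_props phi : test_fun phi ->
  [/\ prim (derive1 phi) phi (-1) 1, phi (-1) = 0, phi 1 = 0,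
     bdm (D R) phi & bdm (D R) (derive1 phi)].
Proof.
move=> tphi; have tphi' := derive1n_test 1 tphi; move: (tphi) => [sphi [cphi sub]].
have cont f : test_fun f -> continuous f.
  move=> [sf _] x; apply: differentiable_continuous; apply/derivable1_diffP.
  exact: (sf 0%N).
have bd f : test_fun f -> bdm (D R) f.
  move=> tf; apply: (@bdmS _ `[(-1), 1]) => //; first exact: subset_itv_oo_cc.
  by apply: bdm_within; apply: continuous_subspaceT; exact: cont.
have z x : ~ D R x -> phi x = 0.
  move=> hx; apply/eqP/negPn/negP => hx'; apply: hx; apply: sub.
  exact: subset_closure.
split; [| | |exact: bd|exact: bd].
- apply: prim_derive; last by apply: continuous_subspaceT; exact: (cont _ tphi').
  move=> x _; rewrite derive1E; apply: DeriveDef => //; exact: (sphi 0%N).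
- by apply: z; rewrite /D/= in_itv/= ltxx.
- by apply: z; rewrite /D/= in_itv/= ltxx andbF.
Qed.

(* [z] solves [- z'' = f], [z = 0] at both ends, with [k = z'], in integrated form; [f] bounded. *)
Definition green_data f k z :=
  [/\ prim (fun x => - f x) k (-1) 1, prim k z (-1) 1, z (-1) = 0 & z 1 = 0].

Lemma ae_Rintegral f g (X : set R) : measurable X ->
  measurable_fun X f -> measurable_fun X g ->
  {ae mu, forall x, X x -> f x = g x} ->
  \int[mu]_(x in X) f x = \int[mu]_(x in X) g x.
Proof.
move=> mX mf mg fg; congr fine; apply: ae_eq_integral => //.
- exact/measurable_EFinP.
- exact/measurable_EFinP.
- move: fg; apply: filterS; first exact: (ae_filter_ringOfSetsType mu).
  by move=> x h Xx; rewrite h.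
Qed.

Lemma ae_inner f g h : measurable_fun (D R) f -> measurable_fun (D R) g ->
  measurable_fun (D R) h ->
  {ae mu, forall x, D R x -> f x = g x} -> inner f h = inner g h.
Proof.
move=> mf mg mh fg; apply: ae_Rintegral.
- exact: measurable_D.
- exact: measurable_funM.
- exact: measurable_funM.
- move: fg; apply: filterS; first exact: (ae_filter_ringOfSetsType mu).
  by move=> x hx Dx; rewrite hx.
Qed.

Lemma green_data_exists f : bdm (D R) f -> exists k z, green_data f k z.
Proof.
move=> bf; have bN := bdmN bf.
pose H := itg (fun x => - f x) (-1).
have pH : prim (fun x => - f x) H (-1) 1 by exact: prim_itg.
have bH := prim_bdm bN pH.
pose C := itg H (-1) 1 / 2.
pose k x := H x - C.
have bk : bdm (D R) k by apply: bdmB => //; exact: bdm_cst.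
exists k, (itg k (-1)); split.
- by move=> x y ax xy yb; rewrite -pH// /k; ring.
- exact: prim_itg.
- by rewrite /itg set_itvoo0 Rintegral_set0.
- rewrite itgB//; last exact: bdm_cst.
  rewrite itg_cst; last lra.
  by rewrite /C; field.
Qed.

Lemma green_data_bdm f k z : bdm (D R) f -> green_data f k z ->
  bdm (D R) k /\ bdm (D R) z.
Proof.
move=> bf [pk pz _ _]; have bk := prim_bdm (bdmN bf) pk.
by split => //; exact: prim_bdm pz.
Qed.

Lemma prim_weak f F phi : bdm (D R) f -> prim f F (-1) 1 -> test_fun phi ->
  inner F (derive1 phi) = - inner f phi.
Proof.
move=> bf pF /test_fun_props[pphi p0 p1 bp bp'].
have bF := prim_bdm bf pF.
have pM := primM bf bp' pF pphi.
have := pM (-1) 1 (lexx _) ltac:(lra) (lexx _).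
rewrite p0 p1 !mulr0 subrr itgD; [|exact: bdmM|exact: bdmM].
rewrite !innerE; lra.
Qed.

Lemma green_weak f k z phi : bdm (D R) f -> green_data f k z -> test_fun phi ->
  inner k (derive1 phi) = inner f phi /\ inner z (derive1 phi) = - inner k phi.
Proof.
move=> bf gd tphi; have [bk bz] := green_data_bdm bf gd; case: gd => pk pz _ _.
split; last exact: prim_weak.
rewrite (prim_weak (bdmN bf) pk)// innerNl ?opprK//; apply: L2_bdm => //.
by have [] := test_fun_props tphi.
Qed.

(** Membership in [sobolev0] is where the Lipschitz continuity of [k] enters, through
    [test_fun_dense]; the other clauses are integrations by parts. *)
Lemma green_is_green f k z : bdm (D R) f -> green_data f k z -> is_green f z.
Proof.
move=> bf gd; have [bk bz] := green_data_bdm bf gd.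
have w1 : weak_deriv 1 z k.
  move=> phi tphi; have [_ h] := green_weak bf gd tphi.
  by rewrite expr1 mulN1r -h.
have w2 : weak_deriv 2 z (fun x => - f x).
  move=> phi tphi; have [h1 _] := green_weak bf gd tphi.
  have [_ h2] := green_weak bf gd (derive1n_test 1 tphi).
  rewrite /derive1n /= in h2 *; rewrite h2 h1 innerNl; first by rewrite expr2; ring.
    exact: L2_bdm.
  by apply: L2_bdm; have [] := test_fun_props tphi.
have [L L0 kL] := prim_lip (bdmN bf) (let: And4 h _ _ _ := gd in h).
split; last split.
- split; first exact: L2_bdm.
  exists k; split; first exact: L2_bdm.
  split=> // e e0; case: gd => pk pz z0 z1.
  have [phi tphi h] := test_fun_dense kL pz z0 z1 (exprn_gt0 2 e0).
  exists phi; split => //.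
  rewrite -[X in _ < X](@gtr0_norm _ e)// -sqrtr_sqr ltr_sqrt ?exprn_gt0//.
- split; first exact: L2_bdm.
  case=> [|[|[|//]]] _.
  + exists z; split; first exact: L2_bdm.
    by move=> phi _; rewrite expr0 mul1r.
  + by exists k; split => //; exact: L2_bdm.
  + by exists (fun x => - f x); split => //; apply: L2_bdm; exact: bdmN.
- exists (fun x => - f x); split; first by apply: L2_bdm; exact: bdmN.
  split=> //; apply: aeW => x _; exact: opprK.
Qed.

Lemma test_fun_L2 phi : test_fun phi -> L2 phi /\ L2 (derive1 phi).
Proof. by move=> /test_fun_props[_ _ _ b1 b2]; split; exact: L2_bdm. Qed.

Lemma eq_of_small (x : R) C : (forall e, 0 < e -> `|x| <= e * C) -> x = 0.
Proof.
move=> h; apply/eqP/negPn/negP; rewrite -normr_gt0 => x0.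
have C0 : 0 <= C by have := h 1 ltr01; rewrite mul1r; apply: le_trans.
have C1 : 0 < 2 * C + 1 by lra.
have := h (`|x| / (2 * C + 1)) (divr_gt0 x0 C1).
rewrite mulrAC ler_pdivlMr// ; nra.
Qed.

(* Self-adjointness determines every weak solution [u] through its inner products, so no
   regularity theory for the Sobolev space is needed. *)
Lemma is_green_inner f h k z u : bdm (D R) f -> bdm (D R) h ->
  is_green f u -> green_data h k z -> inner u h = inner f z.
Proof.
move=> bf bh [[Lu [v [Lv [wuv dens]]]] [_ [w [Lw [wuw wf]]]]] gd.
have [bk bz] := green_data_bdm bh gd.
have Lf := L2_bdm bf; have Lh := L2_bdm bh; have Lk := L2_bdm bk; have Lz := L2_bdm bz.
(* The weak derivative of [v] is [- f]: compare the first order identity tested with [derive1 phi]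
   and the second order one tested with [phi]. *)
have vphi phi : test_fun phi -> inner v (derive1 phi) = inner f phi.
  move=> tphi; have h1 := wuv _ (derive1n_test 1 tphi); have h2 := wuw _ tphi.
  have : inner u (derive1n 2 phi) = - inner v (derive1 phi).
    by rewrite /derive1n /= in h1 *; rewrite h1 expr1 mulN1r.
  rewrite h2 expr2 mulrNN !mul1r => h3.
  have -> : inner f phi = - inner w phi; last by rewrite h3 opprK.
  have [Lphi _] := test_fun_L2 tphi.
  rewrite -innerNl//; apply/esym; apply: ae_inner wf; [exact: (L2N Lw).1|exact: Lf.1|exact: Lphi.1].
have e1 : inner u h = inner v k.
  apply/eqP; rewrite -subr_eq0; apply/eqP.
  apply: (@eq_of_small _ (2 + inner h h + inner k k)) => e e0.
  have [phi [tphi hphi]] := dens _ e0.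
  have [Lphi Lphi'] := test_fun_L2 tphi.
  have [hk _] := green_weak bh gd tphi.
  have LA : L2 (fun x => u x - phi x) by exact: L2B.
  have LB : L2 (fun x => v x - derive1 phi x) by exact: L2B.
  have -> : inner u h - inner v k = inner (fun x => u x - phi x) h -
      inner (fun x => v x - derive1 phi x) k.
    by rewrite !innerBl// (innerC (derive1 phi)) hk (innerC h); ring.
  have /andP[i1 i2] : (inner (fun x => u x - phi x) (fun x => u x - phi x) <= e ^+ 2) &&
     (inner (fun x => v x - derive1 phi x) (fun x => v x - derive1 phi x) <= e ^+ 2).
    move: hphi; have := inner_ge0 (fun x => u x - phi x); have := inner_ge0 (fun x => v x - derive1 phi x).
    rewrite -[X in _ < X -> _](@gtr0_norm _ e)// -sqrtr_sqr ltr_sqrt ?exprn_gt0//.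
    move=> h1 h2; rewrite /GRing.sub_fun /= => h3; apply/andP; split; lra.
  have := inner_small LA Lh e0 i1; have := inner_small LB Lk e0 i2 => j1 j2.
  rewrite (le_trans (ler_normB _ _))//; lra.
rewrite e1.
(* The roles are exchanged: now [z] and [k] are replaced by a test function and its derivative,
   while [v] and [f] are paired with them. *)
apply/eqP; rewrite -subr_eq0; apply/eqP.
apply: (@eq_of_small _ (2 + inner v v + inner f f)) => e e0.
have [L L0 kL] := prim_lip (bdmN bh) (let: And4 h _ _ _ := gd in h).
case: gd => pk pz z0 z1.
have [phi tphi hphi] := test_fun_dense kL pz z0 z1 (exprn_gt0 2 e0).
have [Lphi Lphi'] := test_fun_L2 tphi.
have LA : L2 (fun x => z x - phi x) by exact: L2B.
have LB : L2 (fun x => k x - derive1 phi x) by exact: L2B.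
have i1 := inner_ge0 (fun x => z x - phi x).
have i2 := inner_ge0 (fun x => k x - derive1 phi x).
have -> : inner v k - inner f z = inner (fun x => k x - derive1 phi x) v -
    inner (fun x => z x - phi x) f.
  by rewrite !innerBl// (innerC (derive1 phi)) vphi// (innerC phi) (innerC k) (innerC z); ring.
have := inner_small LA Lf e0 ltac:(lra); have := inner_small LB Lv e0 ltac:(lra) => j1 j2.
rewrite (le_trans (ler_normB _ _))//; lra.
Qed.

(** Whichever representative [xget] picks, its inner products are those of the explicit solution.
    Existence of a solution excludes the default value of [xget]. *)
Lemma inner_G f h k z : bdm (D R) f -> bdm (D R) h -> green_data h k z ->
  inner (G f) h = inner f z.
Proof.
move=> bf bh gd; apply: is_green_inner gd => //.
have [kf [zf gf]] := green_data_exists bf.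
rewrite /G; case: xgetP => [u -> //|/(_ zf)].
by case; exact: green_is_green gf.
Qed.

Lemma green_data_ae f g k z : bdm (D R) f -> bdm (D R) g ->
  {ae mu, forall x, D R x -> f x = g x} -> green_data f k z -> green_data g k z.
Proof.
move=> bf bg fg [pk pz z0 z1]; split => // x y ax xy yb; rewrite pk//.
have sD : `]x, y[%classic `<=` D R by apply: sub_oo.
apply: ae_Rintegral => //.
- by have [] : bdm `]x, y[ (fun x => - f x) by apply: bdmN; exact: bdm_sub bf.
- by have [] : bdm `]x, y[ (fun x => - g x) by apply: bdmN; exact: bdm_sub bg.
- move: fg; apply: filterS; first exact: (ae_filter_ringOfSetsType mu).
  by move=> w h /sD/h ->.
Qed.

End Green.

(** * Superlevel sets of u / psi *)

Section Torsion.
Variable R : realType.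
Implicit Types (x y : R).

(* The explicit torsion function; [cap y] is its integral over [(1 - y, 1)]. *)
Definition tors x : R := (1 - x ^+ 2) / 2.
Definition cap x : R := x ^+ 2 / 2 - x ^+ 3 / 6.

Lemma prim_horner (p : {poly R}) a b : prim (horner (deriv p)) (horner p) a b.
Proof.
by apply: prim_derive; apply: continuous_subspaceT; exact: continuous_horner.
Qed.

Lemma tors_horner x : tors x = ((1 - 'X^2) * (2^-1)%:P).[x].
Proof. by rewrite /tors !hornerE. Qed.

Lemma prim_tors a b : prim (fun x => - x) tors a b.
Proof.
have h := @prim_horner ((1 - 'X^2) * (2^-1)%:P) a b.
apply: eq_prim h => x _; last by rewrite -tors_horner.
by rewrite !poly.derivE !hornerE; field.
Qed.

Lemma prim_capl a b : prim tors (fun x => cap (1 + x)) a b.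
Proof.
have h := @prim_horner ('X * (2^-1)%:P - 'X^3 * (6^-1)%:P + (3^-1)%:P) a b.
apply: eq_prim h => x _.
  by rewrite !poly.derivE !hornerE /tors; field.
by rewrite !hornerE /cap; field.
Qed.

Lemma prim_id (a b : R) : prim (fun=> 1) (fun x : R => x) a b.
Proof. by move=> x y _ xy _; rewrite itg_cst// mul1r. Qed.

Lemma bdm_id a b : bdm `]a, b[ (fun x : R => x).
Proof. exact: (prim_bdm (bdm_cst _ 1) (@prim_id a b)). Qed.

Lemma bdm_tors a b : bdm `]a, b[ tors.
Proof. by apply: (prim_bdm _ (@prim_tors a b)); apply: bdmN; exact: bdm_id. Qed.

Lemma tors_gt0 x : -1 < x < 1 -> 0 < tors x.
Proof. by rewrite /tors; nra. Qed.

Lemma tors_le1 x : tors x <= 1.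
Proof. by rewrite /tors; have := sqr_ge0 x; lra. Qed.

Lemma green_data_tors : green_data (fun=> 1) (fun x => - x) tors.
Proof.
split; [|exact: prim_tors|by rewrite /tors; field|by rewrite /tors; field].
by move=> x y _ xy _; rewrite itg_cst//; ring.
Qed.

End Torsion.

(** * First and second differences of the convex function [excess] *)

Section Level.
Variable R : realType.
Implicit Types (x y h d e : R) (E : set R).
Variables f k u : R -> R.
Hypothesis bf : bdm (D R) f.
Hypothesis gd : green_data f k u.

Let bk : bdm (D R) k. Proof. by have [] := green_data_bdm bf gd. Qed.
Let bu : bdm (D R) u. Proof. by have [] := green_data_bdm bf gd. Qed.

Definition excess h := itg (fun x => Num.max (u x - h * tors x) 0) (-1) 1.

(* The [psi]-mass of [E]. *)
Definition tmass E := inner (@tors R) \1_E.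

Lemma bdm_level h : bdm (D R) (fun x => u x - h * tors x).
Proof. by apply: bdmB => //; apply: bdmM; [exact: bdm_cst|exact: bdm_tors]. Qed.

Lemma measurable_level (g : R -> R) : measurable_fun (D R) g ->
  measurable (D R `&` [set x | 0 < g x]) /\ measurable (D R `&` [set x | 0 <= g x]).
Proof.
move=> mg; split.
- have -> : [set x | 0 < g x] = g @^-1` `]0, +oo[ by apply/seteqP; split => x /=; rewrite in_itv/= andbT.
  by apply: mg => //; exact: measurable_D.
- have -> : [set x | 0 <= g x] = g @^-1` `[0, +oo[ by apply/seteqP; split => x /=; rewrite in_itv/= andbT.
  by apply: mg => //; exact: measurable_D.
Qed.

Let bmax h : bdm (D R) (fun x => Num.max (u x - h * tors x) 0).
Proof. by apply: bdm_max; [exact: bdm_level|exact: bdm_cst]. Qed.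

(** Convexity of the positive part, applied pointwise. Any set between the open and the closed
    superlevel set gives a subgradient, so once the slope is known all these sets have the same
    mass, and a convenient interval may be chosen. *)
Lemma excess_subgrad h h' E : measurable E ->
  (forall x, D R x -> 0 < u x - h * tors x -> E x) ->
  (forall x, D R x -> E x -> 0 <= u x - h * tors x) ->
  excess h - (h' - h) * tmass E <= excess h'.
Proof.
move=> mE E1 E2; rewrite /tmass innerE -itgZ; last first.
  by apply: bdmM; [exact: bdm_tors|exact: bdm_ind].
rewrite -itgB//; last first.
  by apply: bdmM; [exact: bdm_cst|apply: bdmM; [exact: bdm_tors|exact: bdm_ind]].
apply: le_itg => //.
  apply: bdmB => //.
  by apply: bdmM; [exact: bdm_cst|apply: bdmM; [exact: bdm_tors|exact: bdm_ind]].
move=> x hx; have Dx : D R x by rewrite /D/= in_itv/=.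
have := E1 x Dx; have := E2 x Dx; rewrite indicE.
have [Ex h2 _|Ex _ h1] := boolP (x \in E).
  move: h2 => /(_ (set_mem Ex)) h2; rewrite max_l// mulr1 le_max; apply/orP; left; lra.
rewrite mulr0n mulr0 mulr0 subr0 max_r ?le_max ?lexx ?orbT// leNgt; apply/negP => h3.
by move/negP: Ex; apply; rewrite inE; exact: h1.
Qed.

(** The second difference of a positive part is a tent around its kink, here of height [d * tors x].
    It acts as a smoothed Dirac mass on the level set. *)
Lemma excess_diff2 h d : 0 <= d ->
  itg (fun x => Num.max (d * tors x - `|u x - h * tors x|) 0) (-1) 1 =
  excess (h + d) + excess (h - d) - 2 * excess h.
Proof.
move=> d0; rewrite /excess -itgZ// -itgD// -itgB//; last 2 first.
- by apply: bdmD.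
- by apply: bdmM; [exact: bdm_cst|].
apply: eq_itg => x hx; have t0 := tors_gt0 hx.
have dt : 0 <= d * tors x by rewrite mulr_ge0// ltW.
rewrite !mulrDl mulNr; move: (d * tors x) (h * tors x) dt => a b a0.
case: (leP 0 (u x - b)) => h1; [rewrite (ger0_norm h1)|rewrite (ltr0_norm h1)];
do 3! (case: leP => ?); lra.
Qed.

Variables h0 s0 R2 : R.
(* Encodes that at [h0] the convex function [excess] touches, from below, a function with slope
   [- s0] and second derivative [R2]. *)
Hypothesis taylor : forall e, 0 < e -> exists2 d1 : R, 0 < d1 & forall d, `|d| < d1 ->
  excess (h0 + d) <= excess h0 - s0 * d + (R2 / 2 + e) * d ^+ 2.

Let w x := u x - h0 * tors x.

(** The subgradient [- tmass E] supports [excess] from below at [h0], and [taylor] bounds it from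
    above with slope [- s0]. Small steps of either sign force the two slopes to agree. *)
Lemma tmass_level E : measurable E ->
  (forall x, D R x -> 0 < w x -> E x) ->
  (forall x, D R x -> E x -> 0 <= w x) -> tmass E = s0.
Proof.
move=> mE E1 E2; have sg h := excess_subgrad h mE E1 E2.
have [d1 d10 hd1] := taylor ltr01.
pose K := `|R2 / 2 + 1| + 1.
have K0 : 0 < K by rewrite ltr_wpDl.
have hK : R2 / 2 + 1 <= K by rewrite /K; have := ler_norm (R2 / 2 + 1); lra.
have key d : `|d| < d1 -> (s0 - tmass E) * d <= K * d ^+ 2.
  move=> hd; have := sg (h0 + d); have := hd1 d hd.
  have := sqr_ge0 d; rewrite (addrC h0 d) addrK; nra.
(* Small enough for the quadratic term to be at most half of the linear one. *)
pose dd := Num.min (d1 / 2) (`|s0 - tmass E| / (2 * K)).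
apply/eqP; rewrite eq_sym -subr_eq0; apply/negPn/negP => ne.
have n0 : 0 < `|s0 - tmass E| by rewrite normr_gt0.
have dd0 : 0 < dd by rewrite lt_min !divr_gt0// mulr_gt0.
have dd1 : dd < d1 by apply: (@le_lt_trans _ _ (d1 / 2)); [rewrite ge_min lexx|lra].
have dd2 : dd * (2 * K) <= `|s0 - tmass E|.
  by rewrite -ler_pdivlMr ?mulr_gt0// ge_min lexx orbT.
have := key dd; have := key (- dd); rewrite normrN gtr0_norm// => /(_ dd1) k1 /(_ dd1) k2.
move: dd2 n0; have [p|p] := ger0P (s0 - tmass E); nra.
Qed.

Lemma excess_diff2_le e : 0 < e -> exists2 d1 : R, 0 < d1 & forall d, 0 < d < d1 ->
  itg (fun x => Num.max (d * tors x - `|w x|) 0) (-1) 1 <= (R2 + e) * d ^+ 2.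
Proof.
move=> e0; have [d1 d10 hd] := taylor (divr_gt0 e0 (ltr0n _ 2)).
exists d1 => // d /andP[d0 dd]; rewrite excess_diff2; last exact: ltW.
have := hd d; have := hd (- d); rewrite normrN gtr0_norm// => /(_ dd) k1 /(_ dd) k2.
move: k1 k2. lra.
Qed.

Lemma bdm_band d : bdm (D R) (fun x => Num.max (d * tors x - `|w x|) 0).
Proof.
apply: bdm_max; last exact: bdm_cst.
apply: bdmB; last by apply: bdm_norm; exact: bdm_level.
by apply: bdmM; [exact: bdm_cst|exact: bdm_tors].
Qed.

(** A Markov inequality for the tent integral. It says that the layer in which a smoothed indicator
    differs from the sharp one has mass of order [d]. *)
Lemma tmass_band : exists (K d1 : R), [/\ 0 <= K, 0 < d1 & forall d E, 0 < d < d1 ->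
  measurable E -> (forall x, D R x -> E x -> `|w x| <= d * tors x) -> tmass E <= K * d].
Proof.
have [d1 d10 hd] := excess_diff2_le ltr01.
exists (4 * `|R2 + 1|), (d1 / 2); split; [by rewrite mulr_ge0|by rewrite divr_gt0|].
move=> d E /andP[d0 dd] mE hE.
(* With the doubled scale the tent is still at least [d * tors x] wherever [|w x| <= d * tors x]. *)
have := hd (2 * d) ltac:(lra) => h1.
have {h1} h1 : itg (fun x => Num.max (2 * d * tors x - `|w x|) 0) (-1) 1 <= `|R2 + 1| * (2 * d) ^+ 2.
  by rewrite (le_trans h1)// ler_wpM2r ?sqr_ge0// ler_norm.
rewrite -(ler_pM2l d0); apply: (@le_trans _ _ (`|R2 + 1| * (2 * d) ^+ 2)); last by nra.
apply: le_trans h1; rewrite /tmass innerE -itgZ; last first.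
  by apply: bdmM; [exact: bdm_tors|exact: bdm_ind].
apply: le_itg; [|exact: bdm_band|].
  by apply: bdmM; [exact: bdm_cst|apply: bdmM; [exact: bdm_tors|exact: bdm_ind]].
move=> x hx; have Dx : D R x by rewrite /D/= in_itv/=.
rewrite indicE; have [Ex|Ex] := boolP (x \in E); last by rewrite !mulr0 le_max lexx orbT.
have := hE x Dx (set_mem Ex); rewrite mulr1 le_max => hh; apply/orP; left; lra.
Qed.

End Level.

(** * A continuously differentiable ramp *)

Section Smoothstep.
Variable R : realType.
Implicit Types x r : R.

Lemma is_derive_sqr_max x :
  is_derive x (1 : R) (fun y : R => Num.max y 0 ^+ 2) (2 * Num.max x 0).
Proof.
have [x0|x0|<-] := ltgtP 0 x.
- have e : {near x, (fun y : R => y ^+ 2) =1 (fun y : R => Num.max y 0 ^+ 2)}.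
    by near=> y; rewrite max_l// ltW//; near: y; exact: lt_nbhsr.
  apply: (near_eq_is_derive e).
  by apply: is_derive_eq; rewrite -[x%:A]/(x * 1) mulr1; ring.
- have e : {near x, (fun y : R => 0) =1 (fun y : R => Num.max y 0 ^+ 2)}.
    by near=> y; rewrite max_r ?expr0n//= ltW//; near: y; exact: lt_nbhsl.
  by apply: (near_eq_is_derive e); rewrite mulr0; exact: is_derive_cst.
- rewrite mulr0.
  have cv : h^-1 *: (Num.max (h *: (1 : R) + 0) 0 ^+ 2 - Num.max (0 : R) 0 ^+ 2) @[h --> (0 : R)^'] --> (0 : R).
    apply/cvgrPdist_le => eps eps0; near=> h.
    have h0 : h != 0 by near: h; exact: nbhs_dnbhs_neq.
    have hm : `|h| < eps by near: h; exact: dnbhs0_lt.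
    rewrite maxxx expr0n /= subr0 addr0 sub0r normrN -[h *: 1]/(h * 1) mulr1.
    rewrite -[_ *: _]/(_ * _) normrM normfV mulrC ler_pdivrMr ?normr_gt0//.
    rewrite ger0_norm ?sqr_ge0//; case: (leP h 0) => hh; first by rewrite expr0n/= mulr_ge0// ltW.
    by rewrite expr2 (gtr0_norm hh) ler_wpM2r// ltW// (le_lt_trans (ler_norm _)).
  apply: DeriveDef; first by apply/cvg_ex; exists 0.
  by apply: cvg_lim => //; exact: Rhausdorff.
Unshelve. all: by end_near. Qed.

(* A C^1 ramp from 0 to 1 across [(-1, 1)], with derivative [dstep]. *)
Definition step r := (Num.max (r + 1) 0 ^+ 2 - 2 * Num.max r 0 ^+ 2 + Num.max (r - 1) 0 ^+ 2) / 2.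
Definition dstep r := Num.max (r + 1) 0 - 2 * Num.max r 0 + Num.max (r - 1) 0.

Lemma step0 r : r <= -1 -> step r = 0.
Proof. by move=> h; rewrite /step !max_r ?expr0n/=; [ring|lra|lra|lra]. Qed.

Lemma step1 r : 1 <= r -> step r = 1.
Proof. by move=> h; rewrite /step !max_l; [field|lra|lra|lra]. Qed.

Lemma step01 r : 0 <= step r <= 1.
Proof.
rewrite /step; case: (leP (r + 1) 0) => h1; case: (leP r 0) => h2; case: (leP (r - 1) 0) => h3;
  rewrite ?expr0n/=; nra.
Qed.

Lemma dstep_ge0 r : 0 <= dstep r.
Proof.
by rewrite /dstep; case: (leP (r + 1) 0) => h1; case: (leP r 0) => h2;
  case: (leP (r - 1) 0) => h3; lra.
Qed.

Lemma continuous_relu (c : R) : continuous (fun y : R => Num.max (y + c) 0).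
Proof.
move=> y; apply: (@continuous_max R R (fun y : R^o => y + c) (fun=> 0) y); last exact: cvg_cst.
by apply: cvgD; [exact: cvg_id|exact: cvg_cst].
Qed.

Lemma continuous_dstep : continuous dstep.
Proof.
move=> x; apply: cvgD; last exact: (@continuous_relu (-1)).
apply: cvgB; first exact: continuous_relu.
apply: cvgM; first exact: cvg_cst.
have := @continuous_relu 0 x; rewrite /continuous_at addr0.
by rewrite (_ : (fun y : R => _) = (fun y => Num.max y 0))//; apply/funext => y; rewrite addr0.
Qed.

Lemma is_derive_step r : is_derive r (1 : R) step (dstep r).
Proof.
have d1 c : is_derive r (1 : R) (fun y => Num.max (y + c) 0 ^+ 2) (2 * Num.max (r + c) 0 * 1).
  apply: (@is_derive1_comp _ (fun y : R => Num.max y 0 ^+ 2) (fun y => y + c)).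
    exact: is_derive_sqr_max.
  by apply: is_derive_eq; rewrite addr0.
have d0 := is_derive_sqr_max r.
have -> : step = (fun y => 2^-1 * (Num.max (y + 1) 0 ^+ 2 - 2 * Num.max y 0 ^+ 2 + Num.max (y + -1) 0 ^+ 2)).
  by apply/funext => y; rewrite /step mulrC.
apply: is_derive_eq; rewrite /dstep -?[_ *: _]/(_ * _).
by field.
Qed.

End Smoothstep.

(** * The Wronskian of [u] and [tors], and smoothed superlevel sets *)

Section Flux.
Variable R : realType.
Implicit Types (x y h d e p c b : R) (E : set R).

Lemma prim_continuous (f F : R -> R) a b x : bdm `]a, b[ f -> prim f F a b ->
  a < x < b -> {for x, continuous F}.
Proof.
move=> bf pF hx; have h := prim_within bf pF.
have : {within `]a, b[, continuous F}.
  by apply: continuous_subspaceW h; exact: subset_itv_oo_cc.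
by rewrite continuous_open_subspace//; apply; rewrite inE/= in_itv/=.
Qed.

Variables f k u : R -> R.
Hypothesis bf : bdm (D R) f.
Hypothesis f01 : forall x, D R x -> 0 <= f x <= 1.
Hypothesis gd : green_data f k u.

Let bk : bdm (D R) k. Proof. by have [] := green_data_bdm bf gd. Qed.
Let bu : bdm (D R) u. Proof. by have [] := green_data_bdm bf gd. Qed.
Let pk : prim (fun x => - f x) k (-1) 1. Proof. by case: gd. Qed.
Let pu : prim k u (-1) 1. Proof. by case: gd. Qed.

(* [tors ^ 2] times the derivative of the ratio [u / tors]. *)
Definition wronsk x := k x * tors x + x * u x.

Lemma prim_wronsk : prim (fun x => u x - f x * tors x) wronsk (-1) 1.
Proof.
have b1 : bdm (D R) (fun=> 1) by exact: bdm_cst.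
have bt := @bdm_tors R (-1) 1; have bi := @bdm_id R (-1) 1.
have P1 := primM (bdmN bf) (bdmN bi) pk (@prim_tors R (-1) 1).
have P2 := primM b1 bk (@prim_id R (-1) 1) pu.
have P := primD (bdmD (bdmM (bdmN bf) bt) (bdmM bk (bdmN bi)))
  (bdmD (bdmM b1 bu) (bdmM bi bk)) P1 P2.
apply: eq_prim P => x _ //; ring.
Qed.

Let bw : bdm (D R) (fun x => u x - f x * tors x).
Proof. by apply: bdmB => //; apply: bdmM => //; exact: bdm_tors. Qed.

Lemma wronsk_ends : wronsk (-1) = 0 /\ wronsk 1 = 0.
Proof.
by case: gd => _ _ u0 u1; rewrite /wronsk /tors u0 u1; split; field.
Qed.

(** A Lipschitz function vanishing at both ends is at most a constant times the distance to the
    boundary, and [tors] is at least half of that distance. *)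
Lemma green_le_tors : exists2 C : R, 0 <= C & forall x, D R x -> `|u x| <= C * tors x.
Proof.
have [C C0 hC] := prim_lip bk pu; case: gd => _ _ u0 u1.
exists (2 * C); first by rewrite mulr_ge0.
move=> x; rewrite /D/= in_itv/= => hx.
have := hC (-1) x ltac:(lra) ltac:(lra); have := hC 1 x ltac:(lra) ltac:(lra).
rewrite u0 u1 !subr0 (ler0_norm (x := x - 1)) ?(ger0_norm (x := x - -1)); try lra.
rewrite /tors; case: (leP 0 x) => x0 h1 h2; nra.
Qed.

Lemma is_derive_green x : -1 < x < 1 -> is_derive x (1 : R) u (k x).
Proof.
by move=> hx; apply: is_derive_prim pu (hx) _ => //; exact: prim_continuous (bdmN bf) pk (hx).
Qed.

Lemma is_derive_tors x : is_derive x (1 : R) (@tors R) (- x).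
Proof.
apply: (@is_derive_prim _ _ _ (x - 1) (x + 1)).
- by apply: bdmN; exact: bdm_id.
- exact: prim_tors.
- by lra.
- by apply: cvgN; exact: cvg_id.
Qed.

Lemma is_derive_ratio x : -1 < x < 1 ->
  is_derive x (1 : R) (fun y => u y / tors y) (wronsk x / tors x ^+ 2).
Proof.
move=> hx; have t0 := tors_gt0 hx.
have du := is_derive_green hx; have dt := is_derive_tors x.
have dV := @is_deriveV R _ x _ 1 (lt0r_neq0 t0) dt.
apply: is_derive_eq; rewrite -![_ *: _]/(_ * _) /wronsk.
by field; exact: lt0r_neq0.
Qed.

Lemma continuous_wronsk x : -1 < x < 1 -> {for x, continuous wronsk}.
Proof. by move=> hx; exact: prim_continuous bw prim_wronsk hx. Qed.

Lemma continuous_tors : continuous (@tors R).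
Proof.
move=> x; apply: differentiable_continuous; apply/derivable1_diffP.
by have [] := is_derive_tors x.
Qed.

Section smoothed.
Variables (h d : R).
Hypothesis d0 : 0 < d.

Definition ratio x := (u x / tors x - h) / d.
(* A smoothed indicator of the superlevel set [u > h * tors], and its derivative. *)
Definition eta x := step (ratio x).
Definition deta x := dstep (ratio x) * (wronsk x / tors x ^+ 2 / d).

Lemma is_derive_eta x : -1 < x < 1 -> is_derive x (1 : R) eta (deta x).
Proof.
move=> hx; have dr := is_derive_ratio hx.
apply: (@is_derive1_comp _ (@step R) ratio); first exact: is_derive_step.
rewrite (_ : ratio = fun y => d^-1 * (u y / tors y + - h)); last by apply/funext => y; rewrite /ratio mulrC.
by apply: is_derive_eq; rewrite subr0 -![_ *: _]/(_ * _) mulrC.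
Qed.

Lemma continuous_deta x : -1 < x < 1 -> {for x, continuous deta}.
Proof.
move=> hx; have t0 := tors_gt0 hx.
have cu := prim_continuous bk pu hx.
have cV : {for x, continuous (fun y : R => (tors y)^-1)}.
  by apply: cvgV; [exact: lt0r_neq0|exact: continuous_tors].
have cr : {for x, continuous ratio}.
  apply: cvgM; last exact: cvg_cst.
  by apply: cvgB; [exact: cvgM|exact: cvg_cst].
apply: cvgM; first by apply: continuous_comp => //; exact: continuous_dstep.
apply: cvgM; last exact: cvg_cst.
apply: cvgM; first exact: continuous_wronsk.
by apply: cvgV; [rewrite expf_neq0// lt0r_neq0|apply: cvgM; exact: continuous_tors].
Qed.

(** Stated away from -1 and 1, because the ratio is divided by [tors], which vanishes there; the
    boundary strips are estimated separately in [flux_bound]. *)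
Lemma prim_eta a b : -1 < a -> b < 1 -> prim deta eta a b.
Proof.
move=> a1 b1; apply: prim_derive => [x hx|]; first by apply: is_derive_eta; lra.
apply: continuous_in_subspaceT => x; rewrite inE/= in_itv/= => hx.
by apply: continuous_deta; lra.
Qed.

Lemma bdm_deta a b : -1 < a -> b < 1 -> bdm `]a, b[ deta.
Proof.
move=> a1 b1; apply: (@bdmS _ `[a, b]) => //; first exact: subset_itv_oo_cc.
apply: bdm_within; apply: continuous_in_subspaceT => x; rewrite inE/= in_itv/= => hx.
by apply: continuous_deta; lra.
Qed.

End smoothed.

End Flux.

(** * The flux through level points, bounded by an integral over the superlevel set *)

Section FluxBound.
Variable R : realType.
Implicit Types (x y h d e p c b : R) (E : set R).

Variables f k u : R -> R.
Hypothesis bf : bdm (D R) f.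
Hypothesis f01 : forall x, D R x -> 0 <= f x <= 1.
Hypothesis gd : green_data f k u.

Let bk : bdm (D R) k. Proof. by have [] := green_data_bdm bf gd. Qed.
Let bu : bdm (D R) u. Proof. by have [] := green_data_bdm bf gd. Qed.
Let pk : prim (fun x => - f x) k (-1) 1. Proof. by case: gd. Qed.
Let pu : prim k u (-1) 1. Proof. by case: gd. Qed.

Notation q := (wronsk k u).

Lemma continuous_ratio_deriv x : -1 < x < 1 ->
  {for x, continuous (fun x => q x / tors x ^+ 2)}.
Proof.
move=> hx; apply: cvgM; first exact: (continuous_wronsk bf gd hx).
apply: cvgV; first by rewrite expf_neq0// lt0r_neq0// tors_gt0.
by apply: cvgM; exact: continuous_tors.
Qed.

Lemma prim_ratio a b : -1 < a -> b < 1 ->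
  prim (fun x => q x / tors x ^+ 2) (fun x => u x / tors x) a b.
Proof.
move=> a1 b1; apply: prim_derive => [x hx|].
  by apply: (is_derive_ratio bf gd); lra.
apply: continuous_in_subspaceT => x; rewrite inE/= in_itv/= => hx.
by apply: continuous_ratio_deriv; lra.
Qed.

Lemma bdm_ratio_deriv a b : -1 < a -> b < 1 -> bdm `]a, b[ (fun x => q x / tors x ^+ 2).
Proof.
move=> a1 b1; apply: (@bdmS _ `[a, b]) => //; first exact: subset_itv_oo_cc.
apply: bdm_within; apply: continuous_in_subspaceT => x; rewrite inE/= in_itv/= => hx.
by apply: continuous_ratio_deriv; lra.
Qed.

Let bq : bdm (D R) q.
Proof.
have bw : bdm (D R) (fun x => u x - f x * tors x).
  by apply: bdmB => //; apply: bdmM => //; exact: bdm_tors.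
exact: prim_bdm bw (prim_wronsk bf gd).
Qed.

Lemma bdm_deta_wronsk h d a b : 0 < d -> -1 < a -> b < 1 ->
  bdm `]a, b[ (fun x => deta k u h d x * q x).
Proof.
move=> d0 a1 b1; apply: bdmM; first exact: (bdm_deta bf gd).
by apply: bdm_sub bq; exact: ltW.
Qed.

(** The Wronskian occurs squared, so level points that are not considered can only help and may be
    ignored. *)
Lemma deta_wronsk_ge0 h d x : 0 < d -> -1 < x < 1 -> 0 <= deta k u h d x * q x.
Proof.
move=> d0 hx; rewrite /deta -mulrA mulr_ge0 ?dstep_ge0//.
rewrite (_ : _ * q x = q x ^+ 2 / tors x ^+ 2 / d); last by ring.
by apply: divr_ge0; [apply: divr_ge0; exact: sqr_ge0|exact: ltW].
Qed.

(* Across a level point [p] the ramp [eta] passes from 0 to 1 or back, so its derivative is an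
   approximate Dirac mass at [p]. *)
Lemma flux_local h c p b e : -1 < c -> c < p -> p < b -> b < 1 -> u p = h * tors p -> 0 < e ->
  exists2 d1 : R, 0 < d1 & forall d, 0 < d < d1 ->
    `|q p| - e <= itg (fun x => deta k u h d x * q x) c b.
Proof.
move=> c1 cp pb b1 up e0.
have t0 : 0 < tors p by apply: tors_gt0; lra.
case: (leP `|q p| e) => qe.
  exists 1 => // d /andP[d0 _]; apply: (@le_trans _ _ 0); first lra.
  apply: Rintegral_ge0 => x /=; rewrite in_itv/= => hx.
  by apply: deta_wronsk_ge0 => //; lra.
pose m := `|q p| - e / 2.
have m0 : 0 < m by rewrite /m; lra.
pose s : R := if 0 < q p then 1 else -1.
have ss : s * s = 1 by rewrite /s; case: ifP => _; ring.
have sq : s * q p = `|q p|.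
  rewrite /s; case: ifPn => h0; first by rewrite mul1r gtr0_norm.
  by rewrite mulN1r ler0_norm// leNgt.
have : \forall x \near p, `|q p - q x| < e / 2.
  have hp : -1 < p < 1 by lra.
  have := continuous_wronsk bf gd hp => /cvgrPdist_lt/(_ (e / 2)); apply.
  by rewrite divr_gt0.
move=> /nbhs_ballP[r0 /= r00 hr0].
pose r := Num.min (r0 / 2) (Num.min ((p - c) / 2) ((b - p) / 2)).
have r1 : 0 < r by rewrite !lt_min !divr_gt0// subr_gt0.
have ra : r <= r0 / 2 by rewrite ge_min lexx.
have rb : r <= (p - c) / 2 by rewrite !ge_min lexx orbT.
have rc : r <= (b - p) / 2 by rewrite !ge_min lexx !orbT.
have [] : [/\ -1 < p - r, p + r < 1, c <= p - r & p + r <= b] by split; lra.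
move=> o1 o2 o3 o4.
have [ o5 o6 ] : p - r <= p /\ p <= p + r by split; lra.
have o7 : p - r <= p + r by exact: le_trans o6.
have near_q x : p - r <= x <= p + r -> m <= s * q x.
  move=> hx; have : `|q p - q x| < e / 2.
    by apply: hr0; rewrite /ball/= ltr_distl; lra.
  rewrite ltr_distl => hq; move: sq; rewrite /m /s; case: ifP => _ <-; lra.
have inD z : p - r < z < p + r -> -1 < z < 1.
  by move=> /andP[z1 z2]; rewrite (lt_trans o1 z1) (lt_trans z2 o2).
have pr := @prim_ratio (p - r) (p + r) o1 o2.
have br := @bdm_ratio_deriv (p - r) (p + r) o1 o2.
(* Since [tors <= 1], division by its square does not decrease the slope of the ratio. *)
have vlow x y : p - r <= x -> x <= y -> y <= p + r -> m * (y - x) <= s * (u y / tors y - u x / tors x).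
  move=> hx xy hy; rewrite (pr x y)// -itgZ; last exact: bdm_sub br.
  rewrite -itg_cst//; apply: le_itg; [exact: bdm_cst|apply: bdmM; [exact: bdm_cst|exact: bdm_sub br]|].
  move=> z /andP[z1 z2]; have zz : p - r < z < p + r.
    by rewrite (le_lt_trans hx z1) (lt_le_trans z2 hy).
  have hm : m <= s * q z.
    by apply: near_q; rewrite (ltW (le_lt_trans hx z1)) (ltW (lt_le_trans z2 hy)).
  have tz := tors_gt0 (inD z zz).
  have tz1 : tors z ^+ 2 <= 1.
    by rewrite expr_le1 ?tors_le1// ltW.
  rewrite mulrA ler_pdivlMr ?exprn_gt0//; apply: le_trans hm.
  by rewrite ler_piMr// ltW.
have vp : u p / tors p = h by rewrite up mulfK// lt0r_neq0.
have v1 := vlow p (p + r) o5 o6 (lexx _).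
have v2 := vlow (p - r) p (lexx _) o5 o6.
rewrite vp in v1 v2.
(* On either side of [p] the ratio moves by at least [m * r], so for [d < m * r] the whole ramp is
   traversed inside [[p - r, p + r]]. *)
exists (m * r); first exact: mulr_gt0.
move=> d /andP[d0 dm].
have Bd : bdm `]c, b[ (fun x => deta k u h d x * q x) by exact: bdm_deta_wronsk.
have n0 x y : c <= x -> y <= b -> 0 <= itg (fun x => deta k u h d x * q x) x y.
  move=> cx yb; apply: Rintegral_ge0 => z /=; rewrite in_itv/= => /andP[xz zy].
  apply: deta_wronsk_ge0 => //.
  by rewrite (lt_le_trans c1 (le_trans cx (ltW xz))) (lt_trans (lt_le_trans zy yb) b1).
have o8 : p - r <= b by exact: le_trans o4.
rewrite (@itg_cat _ _ c (p - r) b)//.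
rewrite (@itg_cat _ _ (p - r) (p + r) b)//; last by apply: bdm_sub Bd.
have i1 := n0 c (p - r) (lexx _) o8.
have i2 := n0 (p + r) b (le_trans o3 o7) (lexx _).
suff : m <= itg (fun x => deta k u h d x * q x) (p - r) (p + r).
  by move: i1 i2; rewrite /m; lra.
have pe := @prim_eta R f k u bf gd h d (p - r) (p + r) o1 o2.
have bd : bdm `](p - r), (p + r)[ (deta k u h d) by exact: (bdm_deta bf gd).
have : m * s * (eta u h d (p + r) - eta u h d (p - r)) <= itg (fun x => deta k u h d x * q x) (p - r) (p + r).
  rewrite (pe (p - r) (p + r))// -itgZ//.
  apply: le_itg.
  - by apply: bdmM => //; exact: bdm_cst.
  - exact: bdm_deta_wronsk.
  move=> z hz; have tz := tors_gt0 (inD z hz).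
  have hz2 : m <= s * q z by case/andP: hz => z1 z2; apply: near_q; rewrite !ltW.
  have sd : 0 <= s * deta k u h d z.
    rewrite /deta (_ : s * _ = dstep (ratio u h d z) * (s * q z / tors z ^+ 2 / d)); last by ring.
    by rewrite mulr_ge0 ?dstep_ge0// divr_ge0 ?(ltW d0)// divr_ge0 ?sqr_ge0// (le_trans (ltW m0)).
  have -> : deta k u h d z * q z = s * deta k u h d z * (s * q z).
    by rewrite mulrACA ss mul1r.
  by rewrite (_ : m * s * deta k u h d z = s * deta k u h d z * m) ?ler_wpM2l//; ring.
apply: le_trans; rewrite /eta /ratio.
have k1 : 1 <= s * (u (p + r) / tors (p + r) - h) / d.
  by rewrite ler_pdivlMr// mul1r (le_trans (ltW dm))//; move: v1; rewrite (_ : p + r - p = r)//; ring.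
have k2 : s * (u (p - r) / tors (p - r) - h) / d <= -1.
  rewrite ler_pdivrMr// mulN1r lerNr (le_trans (ltW dm))//.
  by move: v2; rewrite subKr -[_ / _ - h]opprB mulrN opprK.
move: k1 k2; rewrite /s; case: ifP => _; rewrite ?mul1r ?mulN1r ?mulNr => k1 k2.
  by rewrite step1// step0// subr0 !mulr1.
by rewrite step0 ?step1 ?sub0r ?mulrN1 ?mulrNN ?mulr1// -lerN2 ?opprK.
Qed.

Lemma ramp_le (S Y Z : R) : 0 <= S -> S <= 1 -> - Y <= Z -> Z <= Y -> 0 <= Y ->
  S * Z <= Z + Y /\ S * Z <= Y.
Proof. by move=> s1 s2 z1 z2 y0; split; nra. Qed.

(* Integration by parts of [eta * wronsk], whose second factor has derivative
   [u - f * tors]; the layer where [eta] is not an indicator has mass O(d) by hypothesis. *)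
Lemma flux_bound h (alpha b0 : R) : b0 < 1 ->
  (exists K d1 : R, [/\ 0 <= K, 0 < d1 & forall d E, 0 < d < d1 ->
    measurable E -> (forall x, D R x -> E x -> `|u x - h * tors x| <= d * tors x) ->
    tmass E <= K * d]) ->
  (forall e b, 0 < e -> b0 <= b -> b < 1 -> exists2 d1 : R, 0 < d1 & forall d, 0 < d < d1 ->
    alpha - e <= itg (fun x => deta k u h d x * q x) (- b) b) ->
  alpha <= inner (fun x => f x * tors x - u x) \1_(D R `&` [set x | 0 < u x - h * tors x]).
Proof.
move=> b01 [K [dK [K0 dK0 hK]]] hal.
have mw := (bdm_level bf gd h).1.
set E := _ `&` _; have mE : measurable E by case: (measurable_level mw).
have [C C0 hC] := green_le_tors bf gd.
pose zeta x := f x * tors x - u x.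
have bz : bdm (D R) zeta by apply: bdmB => //; apply: bdmM => //; exact: bdm_tors.
have zC x : D R x -> `|zeta x| <= (1 + C) * tors x.
  move=> Dx; have := f01 Dx; have := hC x Dx.
  have t0 : 0 < tors x by apply: tors_gt0; move: Dx; rewrite /D/= in_itv.
  rewrite /zeta !ler_norml => /andP[h1 h2] /andP[h3 h4]; nra.
have bw : bdm (D R) (fun x => u x - f x * tors x).
  by apply: bdmB => //; apply: bdmM => //; exact: bdm_tors.
have [L L0 hL] := prim_lip bw (prim_wronsk bf gd).
have [q0 q1] := wronsk_ends gd.
apply/ler_addgt0Pr => e e0.
have e3 : 0 < e / 3 by rewrite divr_gt0.
(* The error [e] is split into thirds: the loss in the lower bound, the layer of width [d], and the
   strips beyond [- b] and [b]. [M] collects the cost of the strips: the boundary terms, with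
   Lipschitz constant [L], and the tails of [g], which is at least [- (1 + C)]. *)
pose M := 2 * L + 2 * (1 + C).
have M0 : 0 < M by rewrite /M; lra.
pose b := Num.max (Num.max b0 0) (1 - e / (3 * M)).
have b1 : b < 1 by rewrite !gt_max b01 ltr01/= gtrBl divr_gt0// mulr_gt0.
have bb : b0 <= b by rewrite !le_max lexx.
have bp : 0 <= b by rewrite !le_max lexx orbT.
have b2 : -1 < - b by rewrite ltrN2.
have hbb : - b <= b by rewrite -subr_ge0 opprK addr_ge0.
have [ b1' b2' ] := (ltW b1, ltW b2).
have C1 : 0 <= 1 + C by rewrite addr_ge0.
have bM : M * (1 - b) <= e / 3.
  have : 1 - e / (3 * M) <= b by rewrite !le_max lexx orbT.
  have -> : e / (3 * M) = e / 3 / M by field; rewrite gt_eqF.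
  by rewrite lerBlDr -lerBlDl ler_pdivlMr// mulrC.
have [d1 d10 hd1] := hal _ _ e3 bb b1.
pose d := Num.min (d1 / 2) (Num.min (dK / 2) (e / (3 * ((1 + C) * K + 1)))).
have CK : 0 < (1 + C) * K + 1 by rewrite ltr_wpDl// mulr_ge0//; lra.
have d0 : 0 < d by rewrite !lt_min !divr_gt0// mulr_gt0.
have dd1 : 0 < d < d1 by rewrite d0/=; apply: (@le_lt_trans _ _ (d1 / 2)); [rewrite ge_min lexx|lra].
have ddK : 0 < d < dK by rewrite d0/=; apply: (@le_lt_trans _ _ (dK / 2)); [rewrite !ge_min lexx orbT|lra].
have dC : ((1 + C) * K + 1) * d <= e / 3.
  have : d <= e / (3 * ((1 + C) * K + 1)) by rewrite !ge_min lexx !orbT.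
  have -> : e / (3 * ((1 + C) * K + 1)) = e / 3 / ((1 + C) * K + 1) by field; rewrite gt_eqF.
  by rewrite ler_pdivlMr// mulrC.
have low := hd1 d dd1.
pose B := D R `&` [set x | 0 <= d * tors x - `|u x - h * tors x|].
have mB : measurable B.
  have bb' : bdm (D R) (fun x => d * tors x - `|u x - h * tors x|).
    apply: bdmB; last by apply: bdm_norm; exact: bdm_level bf gd h.
    by apply: bdmM; [exact: bdm_cst|exact: bdm_tors].
  by case: (measurable_level bb'.1).
have hB : tmass B <= K * d.
  by apply: hK => // x _ [_ /=]; rewrite subr_ge0.
(* A majorant of [eta * zeta]: off [B] the ramp equals the indicator of [E], and on [B] the bound
   [|zeta| <= (1 + C) * tors] pays for the difference. *)
pose g x := zeta x * \1_E x + (1 + C) * (tors x * \1_B x).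
have bzE : bdm (D R) (fun x => zeta x * \1_E x) by apply: bdmM => //; exact: bdm_ind.
have btB : bdm (D R) (fun x => tors x * \1_B x).
  by apply: bdmM; [exact: bdm_tors|exact: bdm_ind].
have bcB : bdm (D R) (fun x => (1 + C) * (tors x * \1_B x)) by apply: bdmM => //; exact: bdm_cst.
have bg : bdm (D R) g by exact: bdmD.
have ig : itg g (-1) 1 = inner zeta \1_E + (1 + C) * tmass B.
  by rewrite itgD// itgZ.
have glow x : -1 < x < 1 -> - (1 + C) <= g x.
  move=> hx; have Dx : D R x by rewrite /D/= in_itv.
  have t0 := tors_gt0 hx; have t1 := tors_le1 x.
  have := zC x Dx; rewrite ler_norml => /andP[z1 _].
  have z3 : - (1 + C) <= zeta x by rewrite (le_trans _ z1)// lerN2 ler_piMr.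
  have z4 : 0 <= (1 + C) * tors x by rewrite mulr_ge0// ltW.
  have z5 : - (1 + C) <= 0 by rewrite oppr_le0.
  rewrite /g !indicE; case: (_ \in E); case: (_ \in B); rewrite ?mulr1n ?mulr0n ?mulr1 ?mulr0 ?addr0 ?add0r//.
    by rewrite (le_trans z3)// lerDl.
  exact: le_trans z4.
have tail a c : -1 <= a -> a <= c -> c <= 1 -> - (1 + C) * (c - a) <= itg g a c.
  move=> a1 ac c1; rewrite -itg_cst//; apply: le_itg; [exact: bdm_cst|exact: bdm_sub bg|].
  by move=> x /andP[h1 h2]; apply: glow; rewrite (le_lt_trans a1 h1) (lt_le_trans h2 c1).
have t1 := tail (-1) (- b) (lexx _) b2' (le_trans hbb b1').
have t2 := tail b 1 (le_trans b2' hbb) b1' (lexx _).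
have cat : itg g (-1) 1 = itg g (-1) (- b) + (itg g (- b) b + itg g b 1).
  rewrite -(@itg_cat _ g (- b) b 1)//; last exact: bdm_sub bg.
  by rewrite -(@itg_cat _ g (-1) (- b) 1)// (le_trans hbb).
have pe := @prim_eta R f k u bf gd h d (- b) b b2 b1.
have be := @bdm_deta R f k u bf gd h d (- b) b b2 b1.
have beta : bdm `](- b), b[ (eta u h d) by exact: prim_bdm be pe.
have sub (F : R -> R) : bdm (D R) F -> bdm `](- b), b[ F by exact: bdm_sub.
have pM := primM be (sub _ bw) pe (prim_sub (ltW b2) (ltW b1) (prim_wronsk bf gd)).
have := pM (- b) b (lexx _) hbb (lexx _).
rewrite itgD; [|exact: bdm_deta_wronsk|by apply: bdmM => //; exact: sub].
have up : itg (fun x => eta u h d x * zeta x) (- b) b <= itg g (- b) b.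
  apply: le_itg; [by apply: bdmM => //; exact: sub|exact: sub|].
  move=> x /andP[hx hx']; have hx1 : -1 < x < 1 by rewrite (lt_trans b2 hx) (lt_trans hx' b1).
  have Dx : D R x by rewrite /D/= in_itv.
  have tp := tors_gt0 hx1; have := zC x Dx; rewrite ler_norml => /andP[z1 z2].
  have /andP[s1 s2] := step01 (ratio u h d x).
  rewrite /g /eta !indicE; have [xB|xB] := boolP (x \in B).
    rewrite mulr1n mulr1; move: s1 s2 z1 z2 (mulr_ge0 C1 (ltW tp)).
    move: ((1 + C) * tors x) (zeta x) (step _) => Y Z S s1 s2 z1 z2 Y0.
    have [r1 r2] := ramp_le s1 s2 z1 z2 Y0.
    by case: (_ \in E); rewrite ?mulr1n ?mulr0n ?mulr1 ?mulr0 ?add0r.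
  have : d * tors x < `|u x - h * tors x|.
    by rewrite ltNge -subr_ge0; apply: contra xB => hh; rewrite inE.
  have wr : ratio u h d x * (d * tors x) = u x - h * tors x.
    by rewrite /ratio; field; rewrite !gt_eqF.
  have dt : 0 < d * tors x by exact: mulr_gt0.
  case: (ltP 0 (u x - h * tors x)) => hw.
    rewrite (gtr0_norm hw) => hh; rewrite (mem_set (_ : E x))//.
    rewrite step1 ?mulr1n ?mulr0n ?mulr0 ?mul1r ?mulr1 ?addr0//.
    by rewrite -(ler_pM2r dt) wr mul1r ltW.
  rewrite (ler0_norm hw) => hh; rewrite memNset; last by case=> _ /=; rewrite ltNge hw.
  rewrite step0 ?mulr0n ?mulr0 ?mul0r ?addr0//.
  by rewrite -(ler_pM2r dt) wr mulN1r lerNr ltW.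
have -> : itg (fun x => eta u h d x * (u x - f x * tors x)) (- b) b =
    - itg (fun x => eta u h d x * zeta x) (- b) b.
  rewrite -itgN; last by apply: bdmM => //; exact: sub.
  by apply: eq_itg => x _; rewrite /zeta; ring.
have qb : `|eta u h d b * q b| <= L * (1 - b).
  have /andP[s1 s2] := step01 (ratio u h d b).
  have m11 : -1 <= 1 :> R by exact: le_trans (le_trans b2' hbb) b1'.
  have := hL b 1; rewrite (le_trans b2' hbb) b1' m11 lexx => /(_ isT isT).
  rewrite q1 sub0r normrN (ger0_norm (x := 1 - b)) ?subr_ge0//.
  by move=> hq; rewrite normrM (ger0_norm s1) (le_trans _ hq)// ler_piMl.
have qa : `|eta u h d (- b) * q (- b)| <= L * (1 - b).
  have /andP[s1 s2] := step01 (ratio u h d (- b)).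
  have m11 : -1 <= 1 :> R by exact: le_trans (le_trans b2' hbb) b1'.
  have := hL (- b) (-1); rewrite b2' (le_trans hbb b1') m11 lexx => /(_ isT isT).
  rewrite q0 sub0r normrN (ler0_norm (x := -1 - - b)) ?subr_le0//.
  rewrite (_ : - (-1 - - b) = 1 - b); last by ring.
  by move=> hq; rewrite normrM (ger0_norm s1) (le_trans _ hq)// ler_piMl.
move: qa qb; rewrite !ler_norml => /andP[qa1 qa2] /andP[qb1 qb2] eqn.
have mB0 : (1 + C) * tmass B <= ((1 + C) * K + 1) * d.
  by rewrite (mulrDl ((1 + C) * K)) mul1r -(mulrA (1 + C)) ler_wpDr ?(ltW d0)// ler_wpM2l.
have Mb : M * (1 - b) = 2 * (L * (1 - b)) + 2 * ((1 + C) * (1 - b)) by rewrite /M; ring.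
have e1 : - (1 + C) * (- b - -1) = - ((1 + C) * (1 - b)) by ring.
have e2 : - (1 + C) * (1 - b) = - ((1 + C) * (1 - b)) by ring.
rewrite e1 in t1; rewrite e2 in t2; rewrite Mb in bM.
move: (L * (1 - b)) ((1 + C) * (1 - b)) bM t1 t2 qa1 qa2 qb1 qb2 => X Y bM t1 t2 qa1 qa2 qb1 qb2.
rewrite cat in ig; clear -low eqn up bM t1 t2 qa1 qa2 qb1 qb2 mB0 dC ig.
lra.
Qed.

End FluxBound.

(** * The second difference near one level point *)

Section Band.
Variable R : realType.
Implicit Types (x y h d e p c b X : R) (E : set R).

Variables f k u : R -> R.
Hypothesis bf : bdm (D R) f.
Hypothesis f01 : forall x, D R x -> 0 <= f x <= 1.
Hypothesis gd : green_data f k u.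

Notation q := (wronsk k u).

Lemma primZ (g G : R -> R) c a b : bdm `]a, b[ g -> prim g G a b ->
  prim (fun x => c * g x) (fun x => c * G x) a b.
Proof.
move=> bg pG x y ax xy yb; rewrite itgZ; last exact: bdm_sub bg.
by rewrite -pG// mulrBr.
Qed.

Lemma itg_tent p r c : 0 <= r -> itg (fun x => c * (r - `|x - p|)) (p - r) (p + r) = c * r ^+ 2.
Proof.
move=> r0.
have o1 : p - r <= p by rewrite gerBl.
have o2 : p <= p + r by rewrite lerDl.
have bt a b : bdm `]a, b[ (fun x => c * (r - `|x - p|)).
  apply: bdmM; first exact: bdm_cst.
  apply: bdmB; first exact: bdm_cst.
  by apply: bdm_norm; apply: bdmB; [exact: bdm_id|exact: bdm_cst].
rewrite (@itg_cat _ _ (p - r) p (p + r))//.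
rewrite (eq_itg (a := p - r) (g := fun x => ((c / 2)%:P * 'X^2 + (c * (r - p))%:P * 'X)^`().[x])); last first.
  by move=> x hx; rewrite ltr0_norm ?subr_lt0; [rewrite !poly.derivE !hornerE /=; field|case/andP: hx].
rewrite (eq_itg (a := p) (g := fun x => ((- (c / 2))%:P * 'X^2 + (c * (r + p))%:P * 'X)^`().[x])); last first.
  by move=> x hx; rewrite gtr0_norm ?subr_gt0; [rewrite !poly.derivE !hornerE /=; field|case/andP: hx].
rewrite -(@prim_horner R _ (p - r) p (p - r) p)// -(@prim_horner R _ p (p + r) p (p + r))//.
by rewrite !hornerE /=; field.
Qed.

(** Linearising [u - h * tors] at [p], the band integral contains a triangle of area about
    [d ^+ 2 * tors p ^+ 3 / |q p|]. Writing the bound as [X * |q p| < tors p ^+ 3] admits [q p = 0],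
    in which case every [X] is allowed. *)
Lemma band_local h p c b X : -1 < c -> c < p -> p < b -> b < 1 -> u p = h * tors p ->
  0 <= X -> X * `|q p| < tors p ^+ 3 ->
  exists2 d1 : R, 0 < d1 & forall d, 0 < d < d1 ->
    X * d ^+ 2 <= itg (fun x => Num.max (d * tors x - `|u x - h * tors x|) 0) c b.
Proof.
move=> c1 cp pb b1 up X0 Xq.
have hp : -1 < p < 1 by rewrite (lt_trans c1 cp) (lt_trans pb b1).
have t0 := tors_gt0 hp.
have t1 := tors_le1 p.
(* The derivative of [u - h * tors] at [p]; at a level point the Wronskian is [tors p] times it. *)
pose a := k p + h * p.
have qa : q p = tors p * a by rewrite /wronsk up /a; ring.
have {Xq} Xa : X * `|a| < tors p ^+ 2.
  by move: Xq; rewrite qa normrM (gtr0_norm t0) exprS mulrCA ltr_pM2l.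
(* The slack is shared: raising the slope from [|a|] to [kap] costs at most [g / 4], and lowering
   [tors p] to [tau] costs at most [g / 2] in the square, so [X * kap <= tau ^+ 2]. The denominator
   [X + 1] covers [X = 0]. *)
pose g := tors p ^+ 2 - X * `|a|.
have g0 : 0 < g by rewrite subr_gt0.
pose kap := `|a| + g / (4 * (X + 1)).
have X1 : 0 < X + 1 by rewrite ltr_wpDl.
pose s := g / (4 * (X + 1)).
have s0 : 0 < s by rewrite divr_gt0// mulr_gt0.
have sX : X * s <= g / 4.
  have -> : X * s = g / 4 * (X / (X + 1)) by rewrite /s; field; rewrite gt_eqF.
  by rewrite ler_piMr ?divr_ge0 ?(ltW g0)// ler_pdivrMr// mul1r lerDl.
have kap0 : 0 < kap by rewrite /kap -/s ltr_wpDl.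
pose tau := tors p - Num.min (g / 4) (tors p / 2).
have m0 : 0 < Num.min (g / 4) (tors p / 2) by rewrite lt_min; apply/andP; split; apply: divr_gt0.
have tau1 : tau < tors p by rewrite /tau gtrBl.
have tau0 : 0 < tau.
  have : Num.min (g / 4) (tors p / 2) <= tors p / 2 by rewrite ge_min lexx orbT.
  rewrite /tau; lra.
have Xk : X * kap <= tau ^+ 2.
  have h4 : Num.min (g / 4) (tors p / 2) <= g / 4 by rewrite ge_min lexx.
  have : tors p ^+ 2 - g / 2 <= tau ^+ 2.
    rewrite /tau; move: (Num.min _ _) m0 h4 => m m0 h4; nra.
  rewrite /kap mulrDr -/s /g; rewrite /g in sX; lra.
have [r0 r00 hr0] : exists2 r0 : R, 0 < r0 & forall x, `|x - p| < r0 ->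
    `|u x - h * tors x| <= kap * `|x - p| /\ tau <= tors x.
  have [bk bu] := green_data_bdm bf gd; case: (gd) => pk pu _ _.
  pose w' x := k x - h * - x.
  have bi : bdm (D R) (fun x : R => - x) by apply: bdmN; exact: bdm_id.
  have bw' : bdm (D R) w'.
    by apply: bdmB => //; apply: bdmM => //; exact: bdm_cst.
  have pw : prim w' (fun x => u x - h * tors x) (-1) 1.
    apply: primB pu _ => //; first by apply: bdmM => //; exact: bdm_cst.
    by apply: primZ => //; exact: prim_tors.
  have cw : {for p, continuous w'}.
    apply: cvgB; first exact: prim_continuous (bdmN bf) pk hp.
    by apply: cvgM; [exact: cvg_cst|apply: cvgN; exact: cvg_id].
  have ct : {for p, continuous (@tors R)} by exact: continuous_tors.
  have near1 : \forall x \near p, `|w' p - w' x| < s by have := cw => /cvgrPdist_lt/(_ s); apply.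
  have near2 : \forall x \near p, tau < tors x by have := ct => /cvgr_gt/(_ tau); apply.
  have [r1 /= r10 hr1] : \forall x \near p, `|w' p - w' x| < s /\ tau < tors x.
    by near=> x; split; near: x.
  pose r0 := Num.min r1 (Num.min (1 - p) (p + 1)).
  exists r0.
    by case/andP: (hp) => hp1 hp2; rewrite !lt_min r10 subr_gt0 hp2 -ltrBlDr sub0r.
  move=> x; rewrite !lt_min => /and3P[x1 x2 x3].
  have hb z : `|z - p| < r1 -> `|w' z| <= kap.
    move=> hz; have [] := hr1 z; first by rewrite /ball/= distrC.
    have -> : w' p = a by rewrite /w' /a; ring.
    rewrite /kap -/s => hs _; rewrite -(subrK a (w' z)) (le_trans (ler_normD _ _))//.
    by rewrite addrC lerD2l distrC ltW.
  split; last by apply: ltW; have [] := hr1 x; rewrite /ball/= distrC.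
  have up0 : u p - h * tors p = 0 by rewrite up subrr.
  move: x1 x2 x3; rewrite !ltr_norml => /andP[x1 x1'] /andP[_ x2] /andP[x3 _].
  have [xp|xp] := leP p x.
    rewrite -[u x - _]subr0 -up0 (pw p x)//; [|lra|lra].
    rewrite (ger0_norm (x := x - p)) ?subr_ge0//; apply: itg_norm => //.
      by apply: bdm_sub bw'; lra.
    by move=> z hz; apply: hb; rewrite ltr_norml; lra.
  rewrite -normrN -[- _]add0r -up0 (pw x p); [|lra|exact: ltW|lra].
  rewrite (ltr0_norm (x := x - p)) ?subr_lt0// opprB; apply: itg_norm; first exact: ltW.
    by apply: bdm_sub bw'; lra.
  by move=> z hz; apply: hb; rewrite ltr_norml; lra.
pose r := Num.min (r0 / 2) (Num.min (p - c) (b - p)).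
have r1 : 0 < r by rewrite !lt_min divr_gt0// !subr_gt0 cp.
exists (kap * r / tau); first by rewrite divr_gt0// mulr_gt0.
move=> d /andP[d0]; rewrite ltr_pdivlMr// => dr.
pose l := d * tau / kap.
have l0 : 0 < l by rewrite divr_gt0// mulr_gt0.
have lr : l < r by rewrite ltr_pdivrMr// mulrC mulrC (mulrC r).
have rr0 : r <= r0 / 2 by rewrite ge_min lexx.
have rc : r <= p - c by rewrite !ge_min lexx orbT.
have rb : r <= b - p by rewrite !ge_min lexx !orbT.
have bB := bdm_band bf gd h d.
have Bd : bdm `]c, b[ (fun x => Num.max (d * tors x - `|u x - h * tors x|) 0).
  by apply: bdm_sub bB; exact: ltW.
have o1 : c <= p - l by rewrite lerBrDr -lerBrDl (le_trans (ltW lr)).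
have o2 : p + l <= b by rewrite -lerBrDl (le_trans (ltW lr)).
have o3 : p - l <= p + l by rewrite lerD2l (le_trans _ (ltW l0))// oppr_le0 ltW.
rewrite (@itg_cat _ _ c (p - l) b)//; last exact: le_trans o2.
rewrite (@itg_cat _ _ (p - l) (p + l) b)//; last by apply: bdm_sub Bd.
have n0 x y : 0 <= itg (fun x => Num.max (d * tors x - `|u x - h * tors x|) 0) x y.
  by apply: Rintegral_ge0 => z _; rewrite le_max lexx orbT.
apply: (@le_trans _ _ (kap * l ^+ 2)).
  have -> : kap * l ^+ 2 = tau ^+ 2 / kap * d ^+ 2 by rewrite /l; field; rewrite gt_eqF.
  by rewrite ler_wpM2r ?sqr_ge0// ler_pdivlMr.
rewrite -(itg_tent p _ (ltW l0)).
apply: (@le_trans _ _ (itg (fun x => Num.max (d * tors x - `|u x - h * tors x|) 0) (p - l) (p + l))).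
  apply: le_itg.
  - apply: bdmM; first exact: bdm_cst.
    apply: bdmB; first exact: bdm_cst.
    by apply: bdm_norm; apply: bdmB; [exact: bdm_id|exact: bdm_cst].
  - exact: bdm_sub Bd.
  move=> x hx; have xp : `|x - p| < l by rewrite ltr_distl.
  have [|h1 h2] := hr0 x; first by apply: lt_trans xp _; apply: (lt_le_trans lr); lra.
  rewrite le_max; apply/orP; left.
  have -> : kap * (l - `|x - p|) = d * tau - kap * `|x - p|.
    by rewrite /l; field; rewrite gt_eqF.
  by rewrite lerB// ler_wpM2l// ltW.
have := n0 c (p - l); have := n0 (p + l) b; lra.
Unshelve. all: by end_near. Qed.

End Band.

(** * The isoperimetric comparison *)

Section Isoperimetry.
Variable R : realType.
Implicit Types (x y p a b : R).

(* The quotient [cap y ^ 2 / tors (1 - y) ^ 3] is strictly increasing. *)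
Lemma cap_tors_lt y1 y0 : 0 < y1 -> y1 < y0 -> y0 <= 1 ->
  cap y1 ^+ 2 * (y0 - y0 ^+ 2 / 2) ^+ 3 < cap y0 ^+ 2 * (y1 - y1 ^+ 2 / 2) ^+ 3.
Proof.
move=> y1p y10 y01.
have e1 : cap y1 ^+ 2 * (y0 - y0 ^+ 2 / 2) ^+ 3 =
    (y1 * y0) ^+ 3 / 288 * (((2 - y0) * (3 - y1)) ^+ 2 * ((2 - y0) * y1)) by rewrite /cap; field.
have e2 : cap y0 ^+ 2 * (y1 - y1 ^+ 2 / 2) ^+ 3 =
    (y1 * y0) ^+ 3 / 288 * (((2 - y1) * (3 - y0)) ^+ 2 * ((2 - y1) * y0)) by rewrite /cap; field.
rewrite e1 e2 ltr_pM2l; last first.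
  by apply: divr_gt0; [rewrite exprn_gt0// mulr_gt0// (lt_trans y1p)|rewrite ltr0n].
have p0 : 0 < (2 - y0) * (3 - y1) by rewrite mulr_gt0//; lra.
have p1 : (2 - y0) * (3 - y1) <= (2 - y1) * (3 - y0) by lra.
have p2 : 0 < (2 - y0) * y1 by rewrite mulr_gt0//; lra.
have p3 : (2 - y0) * y1 < (2 - y1) * y0 by lra.
move: p0 p1 p2 p3; move: (_ * (3 - y1)) (_ * (3 - y0)) ((2 - y0) * y1) ((2 - y1) * y0).
move=> A B U V A0 AB U0 UV.
apply: (@le_lt_trans _ _ (B ^+ 2 * U)).
  by rewrite ler_wpM2r ?(ltW U0)// ler_sqr// nnegrE ltW// (lt_le_trans A0).
by rewrite ltr_pM2l// exprn_gt0// (lt_le_trans A0).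
Qed.

Lemma cap_gt0 y : 0 < y -> y <= 2 -> 0 < cap y.
Proof.
move=> y0 y2; have -> : cap y = y ^+ 2 * ((3 - y) / 6) by rewrite /cap; field.
by rewrite mulr_gt0 ?exprn_gt0// divr_gt0//; lra.
Qed.

Lemma cap_lt y1 y2 : 0 <= y1 -> y1 < y2 -> y2 <= 2 -> cap y1 < cap y2.
Proof.
move=> y10 y12 y22; rewrite -subr_gt0.
have -> : cap y2 - cap y1 = (y2 - y1) * (y1 * (2 - y1) + y2 * (2 - y2) +
    (y1 * (2 - y2) / 2 + y2 * (2 - y1) / 2)) / 6 by rewrite /cap; field.
rewrite divr_gt0// mulr_gt0 ?subr_gt0//.
have h1 : 0 <= y1 * (2 - y1) by rewrite mulr_ge0//; lra.
have h2 : 0 <= y2 * (2 - y2) by rewrite mulr_ge0//; lra.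
have h3 : 0 <= y1 * (2 - y2) by rewrite mulr_ge0//; lra.
have h4 : 0 < y2 * (2 - y1) by rewrite mulr_gt0//; lra.
lra.
Qed.

(* A superlevel set with two boundary points loses against one with a single boundary point:
   with [c_i = cap y_i], AM-GM gives [2 sqrt (a_i b_i Q R2) <= a_i R2 + b_i Q]. *)
Lemma iso_contra y0 y1 y2 a1 a2 b1 b2 Q R2 :
  0 < y1 -> y1 < y0 -> 0 < y2 -> y2 < y0 -> y0 <= 1 ->
  cap y0 <= cap y1 + cap y2 ->
  0 < a1 -> 0 < a2 -> 0 < b1 -> 0 < b2 -> a1 + a2 <= Q -> b1 + b2 <= R2 ->
  a1 * b1 = (y1 - y1 ^+ 2 / 2) ^+ 3 -> a2 * b2 = (y2 - y2 ^+ 2 / 2) ^+ 3 ->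
  Q * R2 <= (y0 - y0 ^+ 2 / 2) ^+ 3 -> False.
Proof.
move=> p1 l1 p2 l2 y01 cc a10 a20 b10 b20 aQ bR e1 e2 QR.
have c0 : 0 < cap y0 by apply: cap_gt0; lra.
have c1 : 0 < cap y1 by apply: cap_gt0; lra.
have c2 : 0 < cap y2 by apply: cap_gt0; lra.
have k1 := cap_tors_lt p1 l1 y01; have k2 := cap_tors_lt p2 l2 y01.
rewrite -e1 in k1; rewrite -e2 in k2.
have Q0 : 0 < Q by apply: lt_le_trans aQ; exact: addr_gt0.
have R0 : 0 < R2 by apply: lt_le_trans bR; exact: addr_gt0.
have am (a b c : R) : 0 < a -> 0 < b -> 0 < c ->
    cap y0 ^+ 2 * (a * b) > c ^+ 2 * (Q * R2) -> 2 * c * (Q * R2) < cap y0 * (a * R2 + b * Q).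
  move=> a0 b0 cp h.
  have QR0 : 0 < Q * R2 by exact: mulr_gt0.
  have L0 : 0 <= 2 * c * (Q * R2) by rewrite !mulr_ge0// ltW.
  have M0 : 0 <= cap y0 * (a * R2 + b * Q).
    exact: mulr_ge0 (ltW c0) (addr_ge0 (mulr_ge0 (ltW a0) (ltW R0)) (mulr_ge0 (ltW b0) (ltW Q0))).
  rewrite -ltr_sqr ?nnegrE//.
  apply: (@lt_le_trans _ _ (4 * (Q * R2) * (cap y0 ^+ 2 * (a * b)))).
    have -> : (2 * c * (Q * R2)) ^+ 2 = 4 * (Q * R2) * (c ^+ 2 * (Q * R2)) by ring.
    by rewrite ltr_pM2l// mulr_gt0.
  rewrite -subr_ge0; have -> : (cap y0 * (a * R2 + b * Q)) ^+ 2 - 4 * (Q * R2) * (cap y0 ^+ 2 * (a * b)) =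
    (cap y0 * (a * R2 - b * Q)) ^+ 2 by ring.
  exact: sqr_ge0.
have h1 : 2 * cap y1 * (Q * R2) < cap y0 * (a1 * R2 + b1 * Q).
  by apply: am => //; apply: le_lt_trans k1; rewrite ler_wpM2l// sqr_ge0.
have h2 : 2 * cap y2 * (Q * R2) < cap y0 * (a2 * R2 + b2 * Q).
  by apply: am => //; apply: le_lt_trans k2; rewrite ler_wpM2l// sqr_ge0.
have h3 : cap y0 * ((a1 + a2) * R2 + (b1 + b2) * Q) <= cap y0 * (2 * (Q * R2)).
  rewrite ler_pM2l//; have : (a1 + a2) * R2 <= Q * R2 by rewrite ler_pM2r.
  have : (b1 + b2) * Q <= R2 * Q by rewrite ler_pM2r.
  lra.
have h4 : 2 * cap y0 * (Q * R2) <= 2 * (cap y1 + cap y2) * (Q * R2).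
  by rewrite ler_pM2r ?mulr_gt0// ler_pM2l.
lra.
Qed.

(** [p] is the supremum of the points of [[x, y]] at which [g] is non-negative. *)
Lemma last_zero (g : R -> R) x y : x < y ->
  (forall z, x <= z <= y -> {for z, continuous g}) -> 0 < g x -> g y < 0 ->
  exists p, [/\ x < p < y, g p = 0 & forall z, p < z <= y -> g z < 0].
Proof.
move=> xy cg gx gy.
pose S := [set z | x <= z <= y /\ 0 <= g z].
have Sx : S x by split; [rewrite lexx ltW|exact: ltW].
have hS : has_sup S by split; [exists x|exists y => z [/andP[]]].
pose p := sup S.
have xp : x <= p by apply: ub_le_sup => //; case: hS.
have py : p <= y by apply: ge_sup; [exists x|move=> z [/andP[]]].
have after z : p < z <= y -> g z < 0.
  move=> /andP[pz zy]; rewrite ltNge; apply/negP => gz.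
  have : z <= p by apply: ub_le_sup; [case: hS|split => //; rewrite zy (le_trans xp (ltW pz))].
  by rewrite leNgt pz.
have cp := cg p; rewrite xp py in cp; have {}cp := cp isT.
have gp : g p = 0.
  case: (ltgtP (g p) 0) => // gp.
    have : \forall z \near p, g z < 0 by have := cp => /cvgr_lt/(_ 0); apply.
    move=> /nbhs_ballP[e /= e0 he].
    have [z Sz pz] := sup_adherent e0 hS.
    have zp : z <= p by apply: ub_le_sup => //; case: hS.
    have : g z < 0.
      by apply: he; rewrite /ball/= ger0_norm ?subr_ge0// ltrBlDr addrC -ltrBlDr.
    by rewrite ltNge; case: Sz => _ ->.
  have : \forall z \near p, 0 < g z by have := cp => /cvgr_gt/(_ 0); apply.
  move=> /nbhs_ballP[e /= e0 he].
  have py' : p < y by rewrite lt_neqAle py andbT; apply: contraTneq gp => ->; rewrite -leNgt ltW.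
  pose z := p + Num.min (e / 2) (y - p).
  have m0 : 0 < Num.min (e / 2) (y - p) by rewrite lt_min divr_gt0// subr_gt0.
  have m1 : Num.min (e / 2) (y - p) <= e / 2 by rewrite ge_min lexx.
  have m2 : Num.min (e / 2) (y - p) <= y - p by rewrite ge_min lexx orbT.
  have : 0 < g z by apply: he; rewrite /ball/= /z opprD addNKr normrN gtr0_norm//; lra.
  by rewrite ltNge ltW//; apply: after; rewrite /z ltrDl m0/= -lerBrDl.
exists p; split => //; rewrite !lt_neqAle xp py !andbT; apply/andP; split.
  by apply: contraTneq gx => ->; rewrite gp ltxx.
by apply: contraTneq gy => <-; rewrite gp ltxx.
Qed.

End Isoperimetry.

(** * Flux and curvature bounds at one or two level points *)

Section LevelPoints.
Variable R : realType.
Implicit Types (x y h d e p c b X : R) (E : set R).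

Lemma tmass_le E F : measurable E -> measurable F ->
  (forall x, D R x -> E x -> F x) -> tmass E <= tmass F.
Proof.
move=> mE mF EF; apply: le_itg.
- by apply: bdmM; [exact: bdm_tors|exact: bdm_ind].
- by apply: bdmM; [exact: bdm_tors|exact: bdm_ind].
move=> x hx; rewrite ler_wpM2l ?(ltW (tors_gt0 hx))// !indicE.
have [Ex|_] := boolP (x \in E); last by rewrite ler0n.
by rewrite mem_set//; apply: EF; [rewrite /D/= in_itv|exact: set_mem].
Qed.

Lemma tmass_itv a b : -1 <= a -> a <= b -> b <= 1 ->
  tmass `]a, b[ = cap (1 + b) - cap (1 + a).
Proof.
move=> a1 ab b1; rewrite /tmass innerE.
set g := fun x => _.
have bg : bdm `](-1), 1[ g by apply: bdmM; [exact: bdm_tors|exact: bdm_ind].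
have b1' := le_trans a1 ab.
rewrite (@itg_cat _ _ (-1) a 1)//; last exact: le_trans b1.
rewrite (@itg_cat _ _ a b 1)//; last exact: bdm_sub bg.
have z c d : c <= d -> (forall x, c < x < d -> ~ (a < x < b)) -> itg g c d = 0.
  move=> cd h; rewrite (eq_itg (g := fun=> 0)) ?itg_cst ?mul0r// => x hx.
  by rewrite /g indicE memNset ?mulr0//= in_itv/=; exact: h hx.
rewrite z//; last by move=> x /andP[_ xa] /andP[ax _]; have := lt_trans xa ax; rewrite ltxx.
rewrite (z b 1)//; last by move=> x /andP[bx _] /andP[_ xb]; have := lt_trans xb bx; rewrite ltxx.
rewrite add0r addr0 (eq_itg (g := @tors R)) -?(@prim_capl R a b a b)// => x hx.
by rewrite /g indicE mem_set ?mulr1//= in_itv.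
Qed.

Lemma cap_compl x : cap (1 + x) + cap (1 - x) = 2 / 3 :> R.
Proof. by rewrite /cap; field. Qed.

Lemma tmassU a b : -1 <= a -> a <= b -> b <= 1 ->
  tmass (`](-1), a[ `|` `]b, 1[) = cap (1 + a) + cap (1 - b).
Proof.
move=> a1 ab b1.
have e : forall x, D R x -> (\1_(`](-1), a[ `|` `]b, 1[) : R -> R) x = \1_`](-1), a[ x + \1_`]b, 1[ x.
  move=> x _; rewrite !indicE in_setU.
  have [xa|_] := boolP (x \in `](-1), a[%classic); have [xb|_] := boolP (x \in `]b, 1[%classic);
    rewrite /= ?addr0 ?add0r//.
  move: xa xb; rewrite !inE/= !in_itv/= => /andP[_ xa] /andP[bx _].
  by have := lt_trans xa (le_lt_trans ab bx); rewrite ltxx.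
have -> : tmass (`](-1), a[ `|` `]b, 1[) = tmass `](-1), a[ + tmass `]b, 1[.
  rewrite /tmass !innerE -itgD; last 2 first.
  - by apply: bdmM; [exact: bdm_tors|exact: bdm_ind].
  - by apply: bdmM; [exact: bdm_tors|exact: bdm_ind].
  by apply: eq_itg => x hx; rewrite e ?mulrDr// /D/= in_itv.
have a1' := le_trans ab b1; have b1' := le_trans a1 ab.
rewrite !tmass_itv//.
have -> : cap (1 - b) = 2 / 3 - cap (1 + b) by rewrite -(cap_compl b) addrAC subrr add0r.
by rewrite /cap; field.
Qed.

Lemma le_of_lt (b r : R) : 0 < b -> (forall X, 0 <= X -> X < b -> X <= r) -> b <= r.
Proof.
move=> b0 h; rewrite leNgt; apply/negP => rb.
have r0 : 0 <= r by exact: h.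
have := h ((r + b) / 2); lra.
Qed.

Lemma le_of_lt2 (b1 b2 r : R) : 0 < b1 -> 0 < b2 ->
  (forall X1 X2, 0 <= X1 -> X1 < b1 -> 0 <= X2 -> X2 < b2 -> X1 + X2 <= r) -> b1 + b2 <= r.
Proof.
move=> b10 b20 h; rewrite -lerBrDr; apply: le_of_lt => // X1 h1 h2.
rewrite lerBrDr addrC -lerBrDr; apply: le_of_lt => // X2 h3 h4.
by rewrite lerBrDr addrC h.
Qed.

Variables f k u : R -> R.
Hypothesis bf : bdm (D R) f.
Hypothesis f01 : forall x, D R x -> 0 <= f x <= 1.
Hypothesis gd : green_data f k u.

Notation q := (wronsk k u).

Variables h0 s0 R2 t : R.
Hypothesis taylor : forall e, 0 < e -> exists2 d1 : R, 0 < d1 & forall d, `|d| < d1 ->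
  excess u (h0 + d) <= excess u h0 - s0 * d + (R2 / 2 + e) * d ^+ 2.
Hypothesis mass_f : inner f (@tors R) <= t.

Let w x := u x - h0 * tors x.
Let E0 := D R `&` [set x | 0 < w x].
Let Q := Num.min s0 t - excess u h0 - h0 * s0.

Let mw := (bdm_level bf gd h0).1.
Let mE0 : measurable E0. Proof. by case: (measurable_level mw). Qed.

Lemma tmass_E0 : tmass E0 = s0.
Proof.
apply: (tmass_level bf gd taylor mE0) => x Dx; first by move=> wx; split.
by case=> _; exact: ltW.
Qed.

(** Over [E0] the integral of [u] is [excess u h0 + h0 * s0], while that of [f * tors] is at most
    [s0] because [f <= 1], and at most [t] by [mass_f]. For the interval the smaller of the two
    changes at the level [a / 2]. *)
Lemma flux_le : inner (fun x => f x * tors x - u x) \1_E0 <= Q.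
Proof.
have [bk bu] := green_data_bdm bf gd.
have bt := @bdm_tors R (-1) 1; have bi := bdm_ind `](-1), 1[ mE0.
have bft : bdm (D R) (fun x => f x * tors x) by exact: bdmM.
have -> : inner (fun x => f x * tors x - u x) \1_E0 =
    inner (fun x => f x * tors x) \1_E0 - inner u \1_E0.
  by apply: innerBl; exact: L2_bdm.
have -> : inner u \1_E0 = excess u h0 + h0 * s0.
  have btE : bdm (D R) (fun x => tors x * \1_E0 x) by exact: bdmM.
  rewrite -tmass_E0 /tmass !innerE -itgZ// -itgD//; last 2 first.
  - by apply: bdm_max; [exact: bdm_level bf gd h0|exact: bdm_cst].
  - by apply: bdmM => //; exact: bdm_cst.
  apply: eq_itg => x hx; rewrite indicE.
  have [Ex|Ex] := boolP (x \in E0).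
    move: Ex; rewrite inE => -[_ /=]; rewrite /w => wx; rewrite max_l ?(ltW wx)// mulr1 mulr1; ring.
  have : u x - h0 * tors x <= 0.
    by rewrite leNgt; apply: contra Ex => wx; rewrite inE; split => //; rewrite /D/= in_itv.
  by move=> wx; rewrite max_r// !mulr0 addr0.
rewrite /Q opprD addrA !lerB// le_min; apply/andP; split.
  rewrite -tmass_E0; apply: le_itg; [exact: bdmM|exact: bdmM|].
  move=> x hx; have Dx : D R x by rewrite /D/= in_itv.
  have /andP[f0 f1] := f01 Dx.
  apply: ler_wpM2r; first by rewrite indicE ler0n.
  by rewrite ler_piMl// ltW// tors_gt0.
apply: le_trans mass_f; apply: le_itg; [exact: bdmM|exact: bft|].
move=> x hx; have Dx : D R x by rewrite /D/= in_itv.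
have /andP[g0 g1] := f01 Dx.
apply: ler_piMr; last by rewrite indicE; case: (_ \in _).
by apply: mulr_ge0 => //; rewrite ltW// tors_gt0.
Qed.

Let band := tmass_band bf gd taylor.

Lemma flux1 p : -1 < p < 1 -> w p = 0 -> `|q p| <= Q.
Proof.
move=> /andP[p1 p2] wp; apply: le_trans flux_le.
have up : u p = h0 * tors p by apply/eqP; rewrite -subr_eq0; apply/eqP.
have np : `|p| < 1 by rewrite ltr_norml p1.
have := ler_norm p; have := ler_norm (- p); rewrite normrN => np1 np2.
apply: (flux_bound bf f01 gd (b0 := (1 + `|p|) / 2)) => //; first by lra.
move=> e b e0 pb b1.
have [i1 i2 i3] : [/\ -1 < - b, - b < p & p < b] by split; lra.
have [d1 d10 hd1] := flux_local bf gd i1 i2 i3 b1 up e0.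
by exists d1.
Qed.

Lemma flux2 p1 p2 : -1 < p1 -> p1 < p2 -> p2 < 1 -> w p1 = 0 -> w p2 = 0 ->
  `|q p1| + `|q p2| <= Q.
Proof.
move=> l1 l12 l2 wp1 wp2; apply: le_trans flux_le.
have up1 : u p1 = h0 * tors p1 by apply/eqP; rewrite -subr_eq0; apply/eqP.
have up2 : u p2 = h0 * tors p2 by apply/eqP; rewrite -subr_eq0; apply/eqP.
(* The midpoint separates the two ramps, so their fluxes come from disjoint intervals and add up. *)
pose m := (p1 + p2) / 2.
have n1 : `|p1| < 1 by rewrite ltr_norml l1 (lt_trans l12).
have n2 : `|p2| < 1 by rewrite ltr_norml (lt_trans l1) .
pose r := Num.max `|p1| `|p2|.
have r1 : r < 1 by rewrite gt_max n1.
have np1 : - r <= p1 by rewrite lerNl (le_trans (ler_norm _))// normrN le_max lexx.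
have np2 : p2 <= r by rewrite (le_trans (ler_norm _))// le_max lexx orbT.
apply: (flux_bound bf f01 gd (b0 := (1 + r) / 2)) => //; first by lra.
move=> e b e0 pb b1.
have e2 : 0 < e / 2 by rewrite divr_gt0.
have [ o1 o2 o3 o4] : [/\ -1 < - b, - b < p1, p1 < m & m < 1] by split; rewrite /m; lra.
have [ o5 o6 o7] : [/\ -1 < m, m < p2 & p2 < b] by split; rewrite /m; lra.
have [d1 d10 hd1] := flux_local bf gd o1 o2 o3 o4 up1 e2.
have [d2 d20 hd2] := flux_local bf gd o5 o6 o7 b1 up2 e2.
exists (Num.min d1 d2); first by rewrite lt_min d10.
move=> d; rewrite lt_min => /and3P[d0 dd1 dd2].
have := hd1 d; rewrite d0 => /(_ dd1); have := hd2 d; rewrite d0 => /(_ dd2).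
rewrite (@itg_cat _ _ (- b) m b); [lra|exact: ltW (lt_trans o2 o3)|exact: ltW (lt_trans o6 o7)|].
exact: (bdm_deta_wronsk bf gd).
Qed.

Let bB d := bdm_band bf gd h0 d.

Lemma itg_band_sub d a b c e : -1 <= a -> a <= c -> c <= e -> e <= b -> b <= 1 ->
  itg (fun x => Num.max (d * tors x - `|w x|) 0) c e <=
  itg (fun x => Num.max (d * tors x - `|w x|) 0) a b.
Proof.
move=> a1 ac ce eb b1.
have B : bdm `]a, b[ (fun x => Num.max (d * tors x - `|w x|) 0) by exact: bdm_sub (bB d).
have n0 x y : 0 <= itg (fun x => Num.max (d * tors x - `|w x|) 0) x y.
  by apply: Rintegral_ge0 => z _; rewrite le_max lexx orbT.
rewrite (@itg_cat _ _ a c b)//; last exact: le_trans eb.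
rewrite (@itg_cat _ _ c e b)//; last exact: bdm_sub B.
have := n0 a c; have := n0 e b; lra.
Qed.

Lemma le_R2 X : (forall e, 0 < e -> exists2 d1 : R, 0 < d1 & forall d, 0 < d < d1 ->
  X * d ^+ 2 <= itg (fun x => Num.max (d * tors x - `|w x|) 0) (-1) 1) -> X <= R2.
Proof.
move=> h; apply/ler_addgt0Pr => e e0.
have [d1 d10 hd1] := h e e0.
have [d2 d20 hd2] := excess_diff2_le bf gd taylor e0.
pose d := Num.min d1 d2 / 2.
have m0 : 0 < Num.min d1 d2 by rewrite lt_min d10.
have m1 : Num.min d1 d2 <= d1 by rewrite ge_min lexx.
have m2 : Num.min d1 d2 <= d2 by rewrite ge_min lexx orbT.
have dp : 0 < d by rewrite divr_gt0.
have i1 : 0 < d < d1 by rewrite dp/= /d; lra.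
have i2 : 0 < d < d2 by rewrite dp/= /d; lra.
have := le_trans (hd1 d i1) (hd2 d i2).
by rewrite ler_pM2r// exprn_gt0.
Qed.

Lemma band1 p X : -1 < p < 1 -> w p = 0 -> 0 <= X -> X * `|q p| < tors p ^+ 3 -> X <= R2.
Proof.
move=> /andP[p1 p2] wp X0 Xq.
have up : u p = h0 * tors p by apply/eqP; rewrite -subr_eq0; apply/eqP.
apply: le_R2 => e e0.
have [c1 c2] : -1 < (p - 1) / 2 /\ (p - 1) / 2 < p by lra.
have [c3 c4] : p < (p + 1) / 2 /\ (p + 1) / 2 < 1 by lra.
have [d1 d10 hd1] := band_local bf gd c1 c2 c3 c4 up X0 Xq.
exists d1 => // d hd; apply: le_trans (hd1 d hd) _.
by apply: itg_band_sub => //; [exact: ltW|exact: ltW (lt_trans c2 c3)|exact: ltW].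
Qed.

Lemma band2 p1 p2 X1 X2 : -1 < p1 -> p1 < p2 -> p2 < 1 -> w p1 = 0 -> w p2 = 0 ->
  0 <= X1 -> X1 * `|q p1| < tors p1 ^+ 3 -> 0 <= X2 -> X2 * `|q p2| < tors p2 ^+ 3 ->
  X1 + X2 <= R2.
Proof.
move=> l1 l12 l2 wp1 wp2 X10 Xq1 X20 Xq2.
have up1 : u p1 = h0 * tors p1 by apply/eqP; rewrite -subr_eq0; apply/eqP.
have up2 : u p2 = h0 * tors p2 by apply/eqP; rewrite -subr_eq0; apply/eqP.
apply: le_R2 => e e0; pose m := (p1 + p2) / 2.
have [a1 a2] : -1 < (p1 - 1) / 2 /\ (p1 - 1) / 2 < p1 by lra.
have [a3 a4] : p1 < m /\ m < p2 by rewrite /m; lra.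
have [a5 a6] : p2 < (p2 + 1) / 2 /\ (p2 + 1) / 2 < 1 by lra.
have m1 := lt_trans a4 l2; have m2 := lt_trans l1 a3.
have [d1 d10 hd1] := band_local bf gd a1 a2 a3 m1 up1 X10 Xq1.
have [d2 d20 hd2] := band_local bf gd m2 a4 a5 a6 up2 X20 Xq2.
exists (Num.min d1 d2); first by rewrite lt_min d10.
move=> d; rewrite lt_min => /and3P[d0 dd1 dd2].
have := hd1 d; rewrite d0 => /(_ dd1) i1; have := hd2 d; rewrite d0 => /(_ dd2) i2.
rewrite (@itg_cat _ _ (-1) m 1); [|exact: ltW|exact: ltW|exact: bB].
rewrite mulrDl lerD//.
  apply: le_trans i1 _; apply: itg_band_sub; rewrite ?lexx//; [exact: ltW|exact: ltW (lt_trans a2 a3)|exact: ltW].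
apply: le_trans i2 _; apply: itg_band_sub; rewrite ?lexx//; [exact: ltW|exact: ltW (lt_trans a4 a5)|exact: ltW].
Qed.

(** At a level point with vanishing Wronskian [band1] would bound every [X >= 0] by [R2], in
    particular [|R2| + 1]. *)
Lemma wronsk_level_gt0 p : -1 < p < 1 -> w p = 0 -> 0 < `|q p|.
Proof.
move=> hp wp; rewrite lt_neqAle normr_ge0 andbT eq_sym; apply/negP => /eqP q0.
have := @band1 p (`|R2| + 1) hp wp; rewrite q0 mulr0 exprn_gt0 ?tors_gt0// => /(_ _ isT).
have := ler_norm R2; have := normr_ge0 R2; lra.
Qed.

Lemma slope1 p : -1 < p < 1 -> w p = 0 -> tors p ^+ 3 / `|q p| <= R2.
Proof.
move=> hp wp; have q0 := wronsk_level_gt0 hp wp.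
apply: le_of_lt; first by rewrite divr_gt0// exprn_gt0// tors_gt0.
by move=> X X0; rewrite ltr_pdivlMr// => Xq; exact: band1 Xq.
Qed.

Lemma slope2 p1 p2 : -1 < p1 -> p1 < p2 -> p2 < 1 -> w p1 = 0 -> w p2 = 0 ->
  tors p1 ^+ 3 / `|q p1| + tors p2 ^+ 3 / `|q p2| <= R2.
Proof.
move=> l1 l12 l2 wp1 wp2.
have hp1 : -1 < p1 < 1 by rewrite l1 (lt_trans l12).
have hp2 : -1 < p2 < 1 by rewrite l2 (lt_trans l1).
have q1 := wronsk_level_gt0 hp1 wp1; have q2 := wronsk_level_gt0 hp2 wp2.
apply: le_of_lt2; [by rewrite divr_gt0// exprn_gt0// tors_gt0..|].
move=> X1 X2 h1 h2 h3 h4; rewrite !ltr_pdivlMr// in h2 h4.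
exact: band2 h2 h3 h4.
Qed.

End LevelPoints.

(** * The level set at a touching point is a single point *)

Section Rigidity.
Variable R : realType.
Implicit Types (x y h d e p c b X : R) (E : set R).

(* The last hypothesis is to be read: the set where [g] is positive has at least the mass of
   [(r, 1)], hence reaches out to both sides of [-r, r]. *)
Lemma two_zeros (g : R -> R) r : 0 <= r -> r < 1 ->
  (forall z, -1 < z < 1 -> {for z, continuous g}) -> (forall z, `|z| <= r -> g z < 0) ->
  (forall a b, -1 <= a -> a <= - r -> r <= b -> b <= 1 ->
     (forall x, D R x -> 0 < g x -> x < a \/ b < x) ->
     cap (1 - r) <= cap (1 + a) + cap (1 - b)) ->
  exists p1 p2, [/\ -1 < p1 < - r, r < p2 < 1, g p1 = 0, g p2 = 0 &
     cap (1 - r) <= cap (1 + p1) + cap (1 - p2)].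
Proof.
move=> r0 r1 cg gr hm.
have left : (forall z, -1 < z < - r -> g z <= 0) \/
    exists p, [/\ -1 < p < - r, g p = 0 & forall z, p < z <= - r -> g z < 0].
  have [h|/existsNP[x /not_implyP[hx /negP]]] := pselect (forall z, -1 < z < - r -> g z <= 0); first by left.
  rewrite -ltNge => gx; right; case/andP: (hx) => x1 x2.
  have [||p [/andP[h1 h2] h3 h4]] := last_zero x2 _ gx; last by exists p; split => //; rewrite h2 (lt_trans x1).
    by move=> z hz; apply: cg; lra.
  by apply: gr; rewrite normrN ger0_norm.
have right : (forall z, r < z < 1 -> g z <= 0) \/
    exists p, [/\ r < p < 1, g p = 0 & forall z, r <= z < p -> g z < 0].
  have [h|/existsNP[x /not_implyP[hx /negP]]] := pselect (forall z, r < z < 1 -> g z <= 0); first by left.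
  rewrite -ltNge => gx; right; case/andP: (hx) => x1 x2.
  have xr : - x < - r by rewrite ltrN2.
  have [| | |p [/andP[h1 h2] h3 h4]] := @last_zero R (g \o -%R) _ _ xr.
  - move=> z hz; apply: continuous_comp; first exact: opp_continuous.
    by apply: cg; lra.
  - by rewrite /= opprK.
  - by rewrite /= opprK; apply: gr; rewrite ger0_norm.
  exists (- p); split => //; first lra.
  by move=> z hz; have := h4 (- z); rewrite /= opprK; apply; lra.
have nr z : - r <= z <= r -> g z < 0 by rewrite -ler_norml; exact: gr.
have c0 : 0 < cap (1 - r) by apply: cap_gt0; lra.
have cap0 : cap 0 = 0 :> R by rewrite /cap; field.
have capm y : 0 <= y -> y < 1 - r -> cap y < cap (1 - r) by move=> y0 yr; apply: cap_lt; lra.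
have inD x : D R x -> -1 < x < 1 by rewrite /D/= in_itv.
case: left => [hl|[p1 [hp1 g1 n1]]]; case: right => [hr|[p2 [hp2 g2 n2]]].
- have := hm (-1) 1 (lexx _) ltac:(lra) ltac:(lra) (lexx _).
  rewrite !subrr cap0 addr0 leNgt c0 /= => H; exfalso.
  suff // : false by []; apply: H => x /inD hx gx; exfalso.
  have [xl|xl] := ltP x (- r); first by have := hl x; rewrite xl; lra.
  have [xr|xr] := ltP r x; first by have := hr x; rewrite xr; lra.
  by have := nr x; rewrite xl xr => /(_ isT); lra.
- have := hm (-1) p2 (lexx _) ltac:(lra) ltac:(lra) ltac:(lra).
  rewrite subrr cap0 add0r leNgt capm; [|lra|lra].
  move=> /= H; exfalso; suff // : false by []; apply: H => x /inD hx gx.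
  have [xl|xl] := ltP x (- r); first by have := hl x; rewrite xl; lra.
  right; rewrite ltNge; apply/negP => xp.
  case: (ltgtP x p2) xp => // [xp _|xe _]; last by rewrite xe g2 ltxx in gx.
  have [xr|xr] := ltP r x; first by have := n2 x; rewrite xp (ltW xr) => /(_ isT); lra.
  by have := nr x; rewrite xl xr => /(_ isT); lra.
- have := hm p1 1 ltac:(lra) ltac:(lra) ltac:(lra) (lexx _).
  rewrite subrr cap0 addr0 leNgt capm; [|lra|lra].
  move=> /= H; exfalso; suff // : false by []; apply: H => x /inD hx gx.
  have [xl|xl] := ltP r x; first by have := hr x; rewrite xl; lra.
  left; rewrite ltNge; apply/negP => xp.
  case: (ltgtP p1 x) xp => // [xp _|xe _]; last by rewrite -xe g1 ltxx in gx.
  have [xr|xr] := ltP x (- r); first by have := n1 x; rewrite xp (ltW xr) => /(_ isT); lra.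
  by have := nr x; rewrite xl xr => /(_ isT); lra.
exists p1, p2; split => //; apply: hm; try lra.
move=> x /inD hx gx.
have [xl|xl] := ltP x (- r).
  left; rewrite ltNge; apply/negP => xp.
  case: (ltgtP p1 x) xp => // [xp _|xe _]; last by rewrite -xe g1 ltxx in gx.
  by have := n1 x; rewrite xp (ltW xl) => /(_ isT); lra.
have [xr|xr] := ltP r x; last by have := nr x; rewrite xl xr => /(_ isT); lra.
right; rewrite ltNge; apply/negP => xp.
case: (ltgtP x p2) xp => // [xp _|xe _]; last by rewrite xe g2 ltxx in gx.
by have := n2 x; rewrite xp (ltW xr) => /(_ isT); lra.
Qed.

Lemma same_sign (g : R -> R) x y : x <= y ->
  (forall z, x <= z <= y -> {for z, continuous g}) -> (forall z, x <= z <= y -> g z != 0) ->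
  (0 < g x) = (0 < g y).
Proof.
move=> xy cg gz.
have cw : {within `[x, y], continuous g}.
  by apply: continuous_in_subspaceT => z; rewrite inE/= in_itv/=; exact: cg.
have no : ~~ (Num.min (g x) (g y) <= 0 <= Num.max (g x) (g y)).
  apply/negP => h; have [c] := IVT xy cw h; rewrite in_itv/= => /gz/eqP; exact.
have gx : g x != 0 by apply: gz; rewrite lexx.
have gy : g y != 0 by apply: gz; rewrite lexx xy.
move: no; rewrite ge_min le_max negb_and !negb_or -!ltNge.
case: (ltgtP (g x) 0) gx => //; case: (ltgtP (g y) 0) gy => //; lra.
Qed.

Variables f k u : R -> R.
Hypothesis bf : bdm (D R) f.
Hypothesis f01 : forall x, D R x -> 0 <= f x <= 1.
Hypothesis gd : green_data f k u.
Variables h0 s0 R2 t x0 : R.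
Hypothesis taylor : forall e, 0 < e -> exists2 d1 : R, 0 < d1 & forall d, `|d| < d1 ->
  excess u (h0 + d) <= excess u h0 - s0 * d + (R2 / 2 + e) * d ^+ 2.
Hypothesis mass_f : inner f (@tors R) <= t.
Hypothesis x01 : -1 < x0 < 1.
Hypothesis s0E : s0 = cap (1 - x0).

Let w x := u x - h0 * tors x.
Let Q := Num.min s0 t - excess u h0 - h0 * s0.
Notation q := (wronsk k u).
Hypothesis QR : Q * R2 <= tors x0 ^+ 3.

Let cw z : -1 < z < 1 -> {for z, continuous w}.
Proof.
have [bk bu] := green_data_bdm bf gd; case: (gd) => _ pu _ _.
move=> hz; apply: cvgB; first exact: prim_continuous bk pu hz.
by apply: cvgM; [exact: cvg_cst|exact: continuous_tors].
Qed.

Let mw := (bdm_level bf gd h0).1.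
Let tl := tmass_level bf gd taylor.

(** Here [tors p >= tors x0], so the product of [|q p| <= Q] and [tors p ^+ 3 / |q p| <= R2] is
    already at least [tors x0 ^+ 3 >= Q * R2]. All these inequalities are equalities; in particular
    [|q p| = Q] leaves no flux for a second level point. *)
Lemma level_outside p : -1 < p < 1 -> w p = 0 -> `|p| <= `|x0| ->
  [/\ Q * R2 = tors x0 ^+ 3, `|p| = `|x0| &
   forall p', -1 < p' < 1 -> w p' = 0 -> p' = p].
Proof.
move=> hp wp px.
have q0 := wronsk_level_gt0 bf gd taylor hp wp.
have f1 := flux1 bf f01 gd taylor mass_f hp wp; rewrite -/Q in f1.
have s1 := slope1 bf gd taylor hp wp.
have t0 := tors_gt0 hp; have t00 := tors_gt0 x01.
have tt : tors x0 <= tors p.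
  have : p ^+ 2 <= x0 ^+ 2 by rewrite -(real_normK (num_real p)) -(real_normK (num_real x0)) ler_sqr.
  by rewrite /tors; lra.
have tt3 : tors x0 ^+ 3 <= tors p ^+ 3 by rewrite lerXn2r// nnegrE ltW.
have b0 : 0 < tors p ^+ 3 / `|q p| by rewrite divr_gt0// exprn_gt0.
have R0 : 0 < R2 by exact: lt_le_trans s1.
have Q0 : 0 < Q by exact: lt_le_trans f1.
have ab : `|q p| * (tors p ^+ 3 / `|q p|) = tors p ^+ 3 by rewrite mulrCA divff ?mulr1// gt_eqF.
have c1 : `|q p| * (tors p ^+ 3 / `|q p|) <= Q * R2 by rewrite ler_pM// ltW.
have QRE : Q * R2 = tors x0 ^+ 3 by apply/eqP; rewrite eq_le QR (le_trans tt3)// -ab.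
have tpe : tors p ^+ 3 = tors x0 ^+ 3 by apply/eqP; rewrite eq_le tt3 andbT -QRE -ab.
have qQ : `|q p| = Q.
  apply/eqP; rewrite eq_le f1 leNgt; apply/negP => qlt.
  have : `|q p| * (tors p ^+ 3 / `|q p|) < Q * R2.
    by apply: (@lt_le_trans _ _ (Q * (tors p ^+ 3 / `|q p|))); [rewrite ltr_pM2r|rewrite ler_pM2l].
  by rewrite ab tpe QRE ltxx.
split => //.
  have : tors p = tors x0 by apply: (@pexpIrn _ 3) => //; rewrite nnegrE ltW.
  rewrite /tors => he; have : p ^+ 2 = x0 ^+ 2 by lra.
  by move=> /(congr1 Num.sqrt); rewrite !sqrtr_sqr.
move=> p' hp' wp'; apply/eqP; rewrite eq_le !leNgt; apply/andP; split; apply/negP => pp.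
  have := flux2 bf f01 gd taylor mass_f (_ : -1 < p) pp (_ : p' < 1) wp wp'.
  have := wronsk_level_gt0 bf gd taylor hp' wp'; rewrite -/Q qQ.
  by case/andP: hp => hp1 _; case/andP: hp' => _ hp2; move=> h /(_ hp1 hp2); lra.
have := flux2 bf f01 gd taylor mass_f (_ : -1 < p') pp (_ : p < 1) wp' wp.
have := wronsk_level_gt0 bf gd taylor hp' wp'; rewrite -/Q qQ.
by case/andP: hp => _ hp1; case/andP: hp' => hp2 _; move=> h /(_ hp2 hp1); lra.
Qed.

(** Otherwise [w] has one sign on [[-r, r]] with [r = |x0|], and the set of the opposite sign lies
    outside. It has at least the mass of [(r, 1)], so it needs both sides, and its two inner level
    points contradict [iso_contra]. *)
Lemma level_exists : exists2 p, -1 < p < 1 & w p = 0 /\ `|p| <= `|x0|.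
Proof.
apply: contrapT => no.
pose r := `|x0|.
have r0 : 0 <= r by exact: normr_ge0.
have r1 : r < 1 by rewrite ltr_norml.
have wn (z : R) : `|z| <= r -> w z != 0.
  move=> hz; apply/eqP => wz; apply: no; exists z => //.
  by rewrite -ltr_norml (le_lt_trans hz).
have inD (z : R) : - r <= z <= r -> -1 < z < 1 by lra.
have ss z : `|z| <= r -> (0 < w z) = (0 < w (- r)).
  rewrite ler_norml => /andP[z1 z2]; apply/esym/same_sign => // y /andP[y1 y2].
    by apply: cw; apply: inD; rewrite y1 (le_trans y2).
  by apply: wn; rewrite ler_norml y1 (le_trans y2).
(* One bound is for the superlevel set, of mass [s0], the other for its complement, of mass
   [2 / 3 - s0 = cap (1 + x0)]; whichever set avoids [[-r, r]] is large enough. *)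
have caps : cap (1 - r) <= s0 /\ cap (1 - r) <= cap (1 + x0).
  have xr := ler_norm x0; have xr' := ler_norm (- x0); rewrite normrN -/r in xr xr'.
  split; first rewrite s0E.
    by case: (ltgtP x0 r) xr => // [l _|-> _//]; apply/ltW/cap_lt; lra.
  by case: (ltgtP (- x0) r) xr' => // [l _|e _]; [apply/ltW/cap_lt; lra|rewrite -e opprK].
have [E1m E2m] := measurable_level mw.
(* Stated for a general [g] because it is applied both to [w] and to [- w]. *)
have fin (g : R -> R) : (forall z, -1 < z < 1 -> {for z, continuous g}) -> (forall z, `|z| <= r -> g z < 0) ->
    (forall z, g z = 0 -> w z = 0) ->
    (forall a b, -1 <= a -> a <= - r -> r <= b -> b <= 1 ->
     (forall x, D R x -> 0 < g x -> x < a \/ b < x) ->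
     cap (1 - r) <= cap (1 + a) + cap (1 - b)) -> False.
  move=> cg gr gw hm.
  have [p1 [p2 [hp1 hp2 g1 g2 hc]]] := two_zeros r0 r1 cg gr hm.
  have i1 : -1 < p1 by case/andP: hp1.
  have i2 : p1 < p2 by lra.
  have i3 : p2 < 1 by case/andP: hp2.
  have j1 : -1 < p1 < 1 by lra.
  have j2 : -1 < p2 < 1 by lra.
  have q1 := wronsk_level_gt0 bf gd taylor j1 (gw _ g1).
  have q2 := wronsk_level_gt0 bf gd taylor j2 (gw _ g2).
  have fl := flux2 bf f01 gd taylor mass_f i1 i2 i3 (gw _ g1) (gw _ g2).
  have sl := slope2 bf gd taylor i1 i2 i3 (gw _ g1) (gw _ g2).
  have t1 := tors_gt0 j1; have t2 := tors_gt0 j2.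
  have y1 : tors p1 = (1 + p1) - (1 + p1) ^+ 2 / 2 by rewrite /tors; field.
  have y2 : tors p2 = (1 - p2) - (1 - p2) ^+ 2 / 2 by rewrite /tors; field.
  have y0 : tors x0 = (1 - r) - (1 - r) ^+ 2 / 2.
    by rewrite /tors -(real_normK (num_real x0)) -/r; field.
  have QR' := QR; rewrite y0 in QR'.
  have z1 : 0 < 1 + p1 by rewrite -ltrBlDl sub0r.
  have z2 : 1 + p1 < 1 - r by rewrite ltrD2l; case/andP: hp1.
  have z3 : 0 < 1 - p2 by rewrite subr_gt0.
  have z4 : 1 - p2 < 1 - r by rewrite ltrD2l ltrN2; case/andP: hp2.
  have z5 : 1 - r <= 1 by rewrite gerBl.
  apply: (@iso_contra R (1 - r) (1 + p1) (1 - p2) `|q p1| `|q p2|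
     (tors p1 ^+ 3 / `|q p1|) (tors p2 ^+ 3 / `|q p2|) Q R2) => //.
  - by rewrite divr_gt0// exprn_gt0.
  - by rewrite divr_gt0// exprn_gt0.
  - by rewrite -y1 mulrCA divff ?mulr1// gt_eqF.
  - by rewrite -y2 mulrCA divff ?mulr1// gt_eqF.
have [neg|pos] := leP (w (- r)) 0.
  apply: (fin w) => //.
    by move=> z hz; rewrite lt_neqAle wn//= leNgt ss// -leNgt.
  move=> a b a1 ar rb b1 hE; apply: (le_trans caps.1).
  rewrite -tmassU//; last by lra.
  rewrite -(tl E1m) => [|x Dx wx|x Dx [_ /ltW]//]; last by split.
  apply: tmass_le => //; first exact: measurableU.
  move=> x Dx [_ wx]; have := hE x Dx wx; move: Dx; rewrite /D/= !in_itv/= => /andP[h1 h2].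
  by case=> h; [left; rewrite h1|right; rewrite h].
apply: (fin (fun x => - w x)).
- by move=> z hz; apply: cvgN; exact: cw.
- by move=> z hz; rewrite oppr_lt0 ss.
- by move=> z /eqP; rewrite oppr_eq0 => /eqP.
move=> a b a1 ar rb b1 hE; apply: (le_trans caps.2).
have ab : a <= b by lra.
have : tmass `]a, b[ <= s0.
  rewrite -(tl E2m) => [|x Dx wx|x Dx [_ ]//]; last by split => //; exact: ltW.
  apply: tmass_le => // x Dx; rewrite /= in_itv/= => /andP[h1 h2]; split => //=.
  rewrite leNgt; apply/negP => wx; have := hE x Dx; rewrite oppr_gt0 => /(_ wx)[h|h].
    by have := lt_trans h1 h; rewrite ltxx.
  by have := lt_trans h2 h; rewrite ltxx.
rewrite tmass_itv// s0E; have := cap_compl b; have := cap_compl x0; lra.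
Qed.

(** The level point is unique, so [w] has one sign on each side of it. Equal signs would give a
    superlevel set of mass 0 or 2/3, whereas [0 < s0 < 2 / 3]; opposite signs determine [p] through
    its mass, since [cap] is injective on [[0, 2]]. *)
Lemma rigidity : Q * R2 = tors x0 ^+ 3 /\
  ((forall x, D R x -> (0 < w x) = (x0 < x) /\ (w x = 0 -> x = x0)) \/
   (forall x, D R x -> (0 < w x) = (x < - x0) /\ (w x = 0 -> x = - x0))).
Proof.
have [p hp [wp px]] := level_exists.
have [QRE pe uni] := level_outside hp wp px; split => //.
have wn (z : R) : D R z -> z != p -> w z != 0.
  rewrite /D/= in_itv/= => hz; apply: contraNneq => wz; apply/eqP; exact: uni.
case/andP: (hp) => p1 p2.
have lsign x : D R x -> x < p -> (0 < w x) = (0 < w ((p - 1) / 2)).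
  move=> Dx xp; have := Dx; rewrite /D/= in_itv/= => /andP[x1 x2].
  have [h|h] := leP x ((p - 1) / 2).
    apply: same_sign => // z hz; first by apply: cw; lra.
    by apply: wn; [rewrite /D/= in_itv/=; lra|apply/eqP; lra].
  apply/esym; apply: same_sign => [|z hz|z hz]; [exact: ltW|by apply: cw; lra|].
  by apply: wn; [rewrite /D/= in_itv/=; lra|apply/eqP; lra].
have rsign x : D R x -> p < x -> (0 < w x) = (0 < w ((p + 1) / 2)).
  move=> Dx xp; have := Dx; rewrite /D/= in_itv/= => /andP[x1 x2].
  have [h|h] := leP x ((p + 1) / 2).
    apply: same_sign => // z hz; first by apply: cw; lra.
    by apply: wn; [rewrite /D/= in_itv/=; lra|apply/eqP; lra].
  apply/esym; apply: same_sign => [|z hz|z hz]; [exact: ltW|by apply: cw; lra|].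
  by apply: wn; [rewrite /D/= in_itv/=; lra|apply/eqP; lra].
have [xa xb] := andP x01.
have s00 : 0 < s0 by rewrite s0E; apply: cap_gt0; lra.
have cap0 : cap 0 = 0 :> R by rewrite /cap; field.
have capinj (y z : R) : 0 <= y <= 2 -> 0 <= z <= 2 -> cap y = cap z -> y = z.
  move=> hy hz; case: (ltgtP y z) => // h e.
    have hl : cap y < cap z by apply: cap_lt; lra.
    by rewrite e ltxx in hl.
  have hl : cap z < cap y by apply: cap_lt; lra.
  by rewrite e ltxx in hl.
have mI a b : measurable (`]a, b[%classic : set R) by exact: measurable_itv.
case L : (0 < w ((p - 1) / 2)) in lsign; case Rr : (0 < w ((p + 1) / 2)) in rsign.
- exfalso; have : tmass (D R) = s0.
    apply: (tl (@measurable_D R)) => // x Dx _; case: (ltgtP x p) => [xp|xp|->].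
    + by apply/ltW; rewrite -/(w x) lsign.
    + by apply/ltW; rewrite -/(w x) rsign.
    + by rewrite -/(w p) wp.
  have m11 : -1 <= 1 :> R by lra.
  rewrite (tmass_itv (lexx _) m11 (lexx _)) s0E subrr cap0 subr0 => e.
  have h2 : cap (1 - x0) < cap (1 + 1) by apply: cap_lt; lra.
  by rewrite e ltxx in h2.
- right; have e : tmass `](-1), p[ = s0.
    apply: (tl (mI _ _)) => x Dx.
      move=> wx; rewrite /= in_itv/=; move: (Dx); rewrite /D/= in_itv/= => /andP[-> _] /=.
      case: (ltgtP x p) => // [xp|xp]; first by have := rsign x Dx xp; rewrite -/(w x) in wx; rewrite wx.
      by rewrite xp -/(w p) wp ltxx in wx.
    by rewrite /= in_itv/= => /andP[_ xp]; apply: ltW; rewrite -/(w x) lsign.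
  rewrite tmass_itv// in e; [|lra|lra]; rewrite subrr cap0 subr0 s0E in e.
  have pe' : p = - x0 by have := capinj (1 + p) (1 - x0) ltac:(lra) ltac:(lra) e; lra.
  move=> x Dx; rewrite -pe'; split; last by move: Dx; rewrite /D/= in_itv/=; exact: uni.
  case: (ltgtP x p) => [xp|xp|->]; [exact: lsign|exact: rsign|by rewrite wp ltxx].
- left; have e : tmass `]p, 1[ = s0.
    apply: (tl (mI _ _)) => x Dx.
      move=> wx; rewrite /= in_itv/=; move: (Dx); rewrite /D/= in_itv/= => /andP[_ ->]; rewrite andbT.
      case: (ltgtP x p) => // [xp|xp]; first by have := lsign x Dx xp; rewrite -/(w x) in wx; rewrite wx.
      by rewrite xp -/(w p) wp ltxx in wx.
    by rewrite /= in_itv/= => /andP[xp _]; apply: ltW; rewrite -/(w x) rsign.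
  rewrite tmass_itv// in e; [|lra|lra].
  have pe' : p = x0.
    have e' : cap (1 - p) = cap (1 - x0) by have := cap_compl p; have := cap_compl (1 : R); rewrite subrr cap0 -s0E; lra.
    by have := capinj (1 - p) (1 - x0) ltac:(lra) ltac:(lra) e'; lra.
  move=> x Dx; rewrite -pe'; split; last by move: Dx; rewrite /D/= in_itv/=; exact: uni.
  case: (ltgtP p x) => [xp|xp|<-]; [exact: rsign|exact: lsign|by rewrite wp ltxx].
(* The empty set, written as an interval so that [tmass_itv] computes its mass. *)
- exfalso; have : tmass `](-1), (-1)[ = s0.
    apply: (tl (mI _ _)) => x Dx; last by rewrite /= in_itv/= => /andP[h1 h2]; have := lt_trans h1 h2; rewrite ltxx.
    move=> wx; rewrite -/(w x) in wx; case: (ltgtP x p) => [xp|xp|xp].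
    + by rewrite lsign in wx.
    + by rewrite rsign in wx.
    + by rewrite xp wp ltxx in wx.
  have m11 : -1 <= 1 :> R by lra.
  by rewrite (tmass_itv (lexx _) (lexx _) m11) subrr => e; rewrite -e ltxx in s00.
Qed.

End Rigidity.

(** * Comparison with the profile of an interval *)

Section Profile.
Variable R : realType.
Implicit Types (a h d e y : R).

(* For [A = (1 - a, 1)] and [h <= a / 2] the set [u > h * psi] is [(1 - y, 1)] with
   [y = a ^ 2 / (2 * h)]; [lprof a] is the resulting value of [excess], and [lcurv y h] its second
   derivative. *)
Definition lprof a h := - a ^+ 3 / 6 + a ^+ 4 / (8 * h) - a ^+ 6 / (96 * h ^+ 2).
Definition lcurv y h := (y ^+ 2 - y ^+ 3 / 2) / h.

Lemma lprof_taylor a h0 e : 0 < h0 -> 0 < e -> exists2 d1 : R, 0 < d1 & forall d, `|d| < d1 ->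
  lprof a (h0 + d) <= lprof a h0 - cap (a ^+ 2 / (2 * h0)) * d
    + (lcurv (a ^+ 2 / (2 * h0)) h0 / 2 + e) * d ^+ 2.
Proof.
move=> h00 e0.
(* The exact second order remainder of [lprof] divided by [d ^+ 2]; its continuity at 0 gives the
   bound. *)
pose rho d := a ^+ 4 / 8 / ((h0 + d) * h0 ^+ 2)
  - a ^+ 6 / 96 * (2 * (h0 + d) + h0) / ((h0 + d) ^+ 2 * h0 ^+ 3).
have ci : (fun d : R => h0 + d) @ (0 : R) --> h0 + 0.
  by apply: cvgD; [exact: cvg_cst|exact: cvg_id].
have n0 : h0 != 0 by rewrite gt_eqF.
have cr : {for 0, continuous rho}.
  apply: cvgB.
    apply: cvgM; first exact: cvg_cst.
    apply: cvgV; first by rewrite addr0 mulf_neq0// expf_neq0.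
    by apply: cvgM => //; exact: cvg_cst.
  apply: cvgM.
    apply: cvgM; first exact: cvg_cst.
    by apply: cvgD; [apply: cvgM => //; exact: cvg_cst|exact: cvg_cst].
  apply: cvgV; first by rewrite addr0 mulf_neq0// expf_neq0.
  by apply: cvgM; [exact: cvgM|exact: cvg_cst].
have rho0 : rho 0 = lcurv (a ^+ 2 / (2 * h0)) h0 / 2.
  by rewrite /rho /lcurv; field.
have [r /= r0 hr] : \forall d \near (0 : R), `|rho 0 - rho d| < e.
  by have := cr => /cvgrPdist_lt/(_ e); apply.
exists (Num.min r (h0 / 2)); first by rewrite lt_min r0 divr_gt0.
move=> d; rewrite lt_min => /andP[d1 d2].
have hd : 0 < h0 + d by move: d2; rewrite ltr_norml => /andP[h _]; lra.
have : `|rho 0 - rho d| < e by apply: hr; rewrite /ball/= sub0r normrN.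
rewrite ltr_distl rho0 => /andP[h1 _].
have -> : lprof a (h0 + d) = lprof a h0 - cap (a ^+ 2 / (2 * h0)) * d + rho d * d ^+ 2.
  by rewrite /lprof /cap /rho; field; rewrite n0 gt_eqF.
rewrite lerD2l ler_wpM2r ?sqr_ge0// ltW//; lra.
Qed.

(** The differential equation of the profile. For the interval the first factor is [|q|] at the
    level point [1 - y], the second is [tors ^+ 3 / |q|] there, and the right-hand side is the cube
    of [tors (1 - y)]. *)
Lemma lprof_identity a y h : 0 < a -> 0 < y -> h = a ^+ 2 / (2 * y) ->
  (cap a - lprof a h - h * cap y) * lcurv y h = (y - y ^+ 2 / 2) ^+ 3.
Proof.
move=> a0 y0 ->; rewrite /cap /lprof /lcurv; field.
by rewrite !gt_eqF.
Qed.

End Profile.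

(** * Continuity of [excess] and its values at extreme levels *)

Section Comparison.
Variable R : realType.
Implicit Types (x y h d e : R).
Variables f k u : R -> R.
Hypothesis bf : bdm (D R) f.
Hypothesis gd : green_data f k u.

(** The subgradients are masses of subsets of [D], hence at most the total mass [2 / 3]. *)
Lemma excess_lip h h' : `|excess u h' - excess u h| <= 2 / 3 * `|h' - h|.
Proof.
have cap0 : cap (1 + -1) = 0 :> R by rewrite /cap; field.
have m11 : -1 <= 1 :> R by lra.
have key g g' : excess u g - excess u g' <= 2 / 3 * `|g' - g|.
  pose E := D R `&` [set x | 0 < u x - g * tors x].
  have mE : measurable E by case: (measurable_level (bdm_level bf gd g).1).
  have := excess_subgrad bf gd g' mE (h := g) (fun x Dx wx => conj Dx wx).
  move=> /(_ (fun x _ Ex => ltW Ex.2)) sg.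
  have m0 : 0 <= tmass E.
    apply: Rintegral_ge0 => x hx.
    by rewrite mulr_ge0 ?indicE ?ler0n// ltW// tors_gt0.
  have m1 : tmass E <= 2 / 3.
    have := @tmass_le R E (D R) mE (@measurable_D R) (fun x Dx _ => Dx).
    rewrite (tmass_itv (lexx _) m11 (lexx _)) cap0 subr0.
    by have -> : cap (1 + 1) = 2 / 3 :> R by rewrite /cap; field.
  have : (g' - g) * tmass E <= `|g' - g| * (2 / 3).
    apply: (@le_trans _ _ (`|g' - g| * tmass E)); first by rewrite ler_wpM2r// ler_norm.
    by rewrite ler_wpM2l.
  lra.
rewrite ler_norml; apply/andP; split; last by rewrite distrC; exact: key.
by rewrite lerNl opprB; exact: key.
Qed.

Lemma excess_bound h : exists2 C : R, 0 <= C & forall E, measurable E ->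
  (forall x, D R x -> 0 < u x - h * tors x -> E x) -> excess u h <= C * tmass E.
Proof.
have [C C0 hC] := green_le_tors bf gd.
exists (C + `|h|); first by rewrite addr_ge0.
move=> E mE hE; rewrite /tmass innerE -itgZ; last first.
  by apply: bdmM; [exact: bdm_tors|exact: bdm_ind].
apply: le_itg.
- by apply: bdm_max; [exact: bdm_level bf gd h|exact: bdm_cst].
- by apply: bdmM; [exact: bdm_cst|apply: bdmM; [exact: bdm_tors|exact: bdm_ind]].
move=> x hx; have Dx : D R x by rewrite /D/= in_itv.
have t0 := tors_gt0 hx.
have Ct : 0 <= (C + `|h|) * (tors x * \1_E x).
  by rewrite mulr_ge0 ?addr_ge0// mulr_ge0 ?(ltW t0)// indicE ler0n.
rewrite ge_max Ct andbT; have [wx|wx] := leP (u x - h * tors x) 0; first exact: le_trans Ct.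
rewrite indicE mem_set; last exact: hE.
rewrite mulr1 mulrDl; have := hC x Dx; rewrite ler_norml => /andP[_ h1].
have : - h * tors x <= `|h| * tors x by rewrite ler_pM2r// -normrN ler_norm.
lra.
Qed.

(** If the superlevel set carries the full mass, the positive part may be dropped, and the integral
    of [u] is [inner f tors] by self-adjointness. *)
Lemma excess_full h E : measurable E -> tmass E = 2 / 3 ->
  (forall x, D R x -> E x -> 0 < u x - h * tors x) ->
  (forall x, D R x -> 0 < u x - h * tors x -> E x) ->
  excess u h <= inner f (@tors R) - h * (2 / 3).
Proof.
move=> mE tE E1 E2.
have [bk bu] := green_data_bdm bf gd.
have [C C0 hC] := green_le_tors bf gd.
have b1 : bdm (D R) (fun=> 1) by exact: bdm_cst.
have iu : itg u (-1) 1 = inner f (@tors R).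
  rewrite -(is_green_inner bf b1 (green_is_green bf gd) (@green_data_tors R)) innerE.
  by apply: eq_itg => x _; rewrite mulr1.
have cap0 : cap (1 + -1) = 0 :> R by rewrite /cap; field.
have m11 : -1 <= 1 :> R by lra.
have bt := @bdm_tors R (-1) 1.
have it : itg (@tors R) (-1) 1 = 2 / 3.
  by rewrite -(@prim_capl R (-1) 1 (-1) 1)// cap0 subr0 /cap; field.
have bi := bdm_ind `](-1), 1[ mE.
(* [M * tors] dominates [|u - h * tors|], so adding it off [E] makes the bound pointwise; the added
   term integrates to 0. *)
pose M := C + `|h|.
have : excess u h <= itg (fun x => (u x - h * tors x) + M * (tors x - tors x * \1_E x)) (-1) 1.
  apply: le_itg.
  - by apply: bdm_max; [exact: bdm_level bf gd h|exact: bdm_cst].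
  - apply: bdmD; first exact: bdm_level bf gd h.
    by apply: bdmM; [exact: bdm_cst|apply: bdmB => //; exact: bdmM].
  move=> x hx; have Dx : D R x by rewrite /D/= in_itv.
  have t0 := tors_gt0 hx.
  rewrite indicE; have [Ex|Ex] := boolP (x \in E).
    by rewrite mulr1 subrr mulr0 addr0 max_l// ltW// E1//; exact: set_mem.
  have wx : u x - h * tors x <= 0.
    by rewrite leNgt; apply: contra Ex => wx; rewrite inE; exact: E2.
  rewrite max_r// mulr0 subr0 /M mulrDl.
  have := hC x Dx; rewrite ler_norml => /andP[h1 _].
  have : h * tors x <= `|h| * tors x by rewrite ler_pM2r// ler_norm.
  lra.
have bw := bdm_level bf gd h.
have bd : bdm (D R) (fun x => tors x - tors x * \1_E x) by apply: bdmB => //; exact: bdmM.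
have btE : bdm (D R) (fun x => tors x * \1_E x) by exact: bdmM.
have bht : bdm (D R) (fun x => h * tors x) by apply: bdmM => //; exact: bdm_cst.
rewrite itgD//; last by apply: bdmM => //; exact: bdm_cst.
rewrite itgZ// itgB// itgB// itgZ// it iu.
have -> : itg (fun x => tors x * \1_E x) (-1) 1 = 2 / 3 by [].
by rewrite subrr mulr0 addr0.
Qed.

End Comparison.

(** * The maximum principle for [excess] minus the profile *)

Section Talenti.
Variable R : realType.
Implicit Types (x y h d e : R).
Variable a : R.
Hypothesis a0 : 0 < a.
Hypothesis a2 : a < 2.

(** For the interval [(1 - a, 1)] the ratio of its solution to [tors] increases from [lo], its limit
    at -1, to [hi], its limit at 1. *)
Let lo : R := a ^+ 2 / 4.
Let hi : R := 1 - (2 - a) ^+ 2 / 4.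
Let t : R := cap a.

(* For [h >= a / 2] the excess is obtained from that of the complementary interval by [u -> psi - u]
   and reflection. *)
Definition rprof h := lprof (2 - a) (1 - h) + t - h * (2 / 3).
Definition prof h := if h <= a / 2 then lprof a h else rprof h.

Let lo0 : 0 < lo. Proof. by rewrite /lo divr_gt0// exprn_gt0. Qed.
Let lo_mid : lo < a / 2. Proof. have h : 0 < a * (2 - a) by rewrite mulr_gt0 ?subr_gt0.
by rewrite /lo; lra. Qed.
Let mid_hi : a / 2 < hi. Proof. have h : 0 < a * (2 - a) by rewrite mulr_gt0 ?subr_gt0.
by rewrite /hi; lra. Qed.
Let hi1 : hi < 1. Proof. by rewrite /hi ltrBlDr ltrDl divr_gt0// exprn_gt0// subr_gt0. Qed.
Let an0 : a != 0. Proof. by rewrite gt_eqF. Qed.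
Let bn0 : 2 - a != 0. Proof. by rewrite gt_eqF// subr_gt0. Qed.

Lemma rprof_mid : rprof (a / 2) = lprof a (a / 2).
Proof.
rewrite /rprof /lprof /t /cap.
have -> : 1 - a / 2 = (2 - a) / 2 by field.
by field; rewrite an0 bn0.
Qed.

Lemma rprof_taylor h0 e : h0 < 1 -> 0 < e -> exists2 d1 : R, 0 < d1 & forall d, `|d| < d1 ->
  rprof (h0 + d) <= rprof h0 - cap (2 - (2 - a) ^+ 2 / (2 * (1 - h0))) * d
    + (lcurv ((2 - a) ^+ 2 / (2 * (1 - h0))) (1 - h0) / 2 + e) * d ^+ 2.
Proof.
move=> h1 e0; have h0' : 0 < 1 - h0 by rewrite subr_gt0.
have [d1 d10 hd] := lprof_taylor (2 - a) h0' e0.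
exists d1 => // d dd; have := hd (- d); rewrite normrN => /(_ dd).
rewrite /rprof sqrrN (_ : 1 - (h0 + d) = 1 - h0 - d); last by ring.
pose y := (2 - a) ^+ 2 / (2 * (1 - h0)); rewrite -/y; have -> : cap (2 - y) = 2 / 3 - cap y :> R by rewrite /cap; field.
lra.
Qed.

Lemma prof_left h : h <= a / 2 -> prof h = lprof a h.
Proof. by rewrite /prof => ->. Qed.

Lemma prof_right h : a / 2 <= h -> prof h = rprof h.
Proof.
rewrite /prof le_eqVlt => /orP[/eqP <-|h1]; first by rewrite lexx rprof_mid.
by rewrite leNgt h1.
Qed.

(** Here [x0] is the end point of the superlevel set of the interval at height [h0]. It reaches -1
    at [lo] and 1 at [hi], which accounts for the extreme slopes recorded at the end. *)
Lemma prof_taylor h0 : lo <= h0 -> h0 <= hi -> exists x0 s0 R2,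
  [/\ s0 = cap (1 - x0), 0 <= R2, (Num.min s0 t - prof h0 - h0 * s0) * R2 = tors x0 ^+ 3,
     (forall e, 0 < e -> exists2 d1 : R, 0 < d1 & forall d, `|d| < d1 ->
        prof (h0 + d) <= prof h0 - s0 * d + (R2 / 2 + e) * d ^+ 2) &
     [/\ (lo < h0 -> h0 < hi -> -1 < x0 < 1), (h0 = lo -> s0 = 2 / 3),
      (h0 = hi -> s0 = 0) & (h0 = a / 2 -> x0 = 1 - a)]].
Proof.
move=> l1 l2.
have h0p : 0 < h0 by exact: lt_le_trans l1.
have h0n : 0 < 1 - h0 by rewrite subr_gt0 (le_lt_trans l2).
pose y := a ^+ 2 / (2 * h0); pose z := (2 - a) ^+ 2 / (2 * (1 - h0)).
have b0 : 0 < 2 - a by rewrite subr_gt0.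
have y0 : 0 < y by rewrite divr_gt0 ?exprn_gt0// mulr_gt0.
have z0 : 0 < z by rewrite divr_gt0 ?exprn_gt0// mulr_gt0.
have yh : h0 = a ^+ 2 / (2 * y) by rewrite /y; field; rewrite an0 gt_eqF.
have zh : 1 - h0 = (2 - a) ^+ 2 / (2 * z) by rewrite /z; field; rewrite bn0 gt_eqF.
have y2 : y <= 2.
  by rewrite /y ler_pdivrMr ?mulr_gt0//; move: l1; rewrite /lo; lra.
have z2 : z <= 2.
  by rewrite /z ler_pdivrMr ?mulr_gt0//; move: l2; rewrite /hi; lra.
have curv0 v w : 0 < v -> v <= 2 -> 0 < w -> 0 <= lcurv v w.
  move=> v0 v2 w0; rewrite /lcurv divr_ge0 ?(ltW w0)//.
  have -> : v ^+ 2 - v ^+ 3 / 2 = v ^+ 2 * (1 - v / 2) by field.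
  by rewrite mulr_ge0 ?sqr_ge0//; lra.
have cap00 : cap 0 = 0 :> R by rewrite /cap; field.
have capmono v w : 0 <= v -> v <= w -> w <= 2 -> cap v <= cap w.
  by move=> v0; rewrite le_eqVlt => /orP[/eqP ->//|vw] w2; exact/ltW/cap_lt.
have [hl|hr] := leP h0 (a / 2).
  exists (1 - y), (cap y), (lcurv y h0).
  have ya : a <= y by rewrite /y ler_pdivlMr ?mulr_gt0//; nra.
  split.
  - by rewrite subKr.
  - exact: curv0.
  - rewrite min_r; last by apply: capmono => //; exact: ltW.
    rewrite prof_left// /t (@lprof_identity R a y h0)//.
    by rewrite /tors; congr (_ ^+ 3); field.
  - move=> e e0; have [d1 d10 hd1] := lprof_taylor a h0p e0; rewrite -/y in hd1.
    (* At [a / 2] the two branches of the profile agree up to second order, so one Taylor bound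
       serves both signs of [d]. *)
    have [hlt|heq] : h0 < a / 2 \/ h0 = a / 2.
      by move: hl; rewrite le_eqVlt => /orP[/eqP|]; [right|left].
      exists (Num.min d1 (a / 2 - h0)); first by rewrite lt_min d10 subr_gt0.
      move=> d; rewrite lt_min => /andP[i1 i2].
      rewrite !prof_left//; first exact: hd1.
      by have := ler_norm d; lra.
    have h1 : h0 < 1 by rewrite -subr_gt0.
    have [d2 d20 hd2] := rprof_taylor h1 e0; rewrite -/z in hd2.
    exists (Num.min d1 d2); first by rewrite lt_min d10.
    move=> d; rewrite lt_min => /andP[i1 i2].
    have ye : y = a by rewrite /y heq; field; rewrite an0.
    have ze : z = 2 - a.
      by rewrite /z heq (_ : 1 - a / 2 = (2 - a) / 2); [field; rewrite bn0|field].
    have [dn|dp] := leP d 0.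
      by rewrite !prof_left//; [exact: hd1|lra].
    have -> : lcurv y h0 = lcurv z (1 - h0).
      rewrite ye ze /lcurv heq (_ : 1 - a / 2 = (2 - a) / 2); last by field.
      by field; rewrite an0 bn0.
    rewrite !prof_right//; [|by rewrite heq|lra].
    by have := hd2 d i2; rewrite ye ze subKr.
  split.
  - move=> g1 g2; suff : y < 2 by lra.
    by rewrite /y ltr_pdivrMr ?mulr_gt0//; move: g1; rewrite /lo; lra.
  - move=> e; have -> : y = 2 by rewrite /y e /lo; field; rewrite an0.
    by rewrite /cap; field.
  - by move=> e; move: hl; rewrite e leNgt mid_hi.
  - by move=> e; rewrite /y e; field; rewrite an0.
exists (1 - (2 - z)), (cap (2 - z)), (lcurv z (1 - h0)).
have za : 2 - a <= z by rewrite /z ler_pdivlMr ?mulr_gt0//; nra.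
split.
- by rewrite subKr.
- exact: curv0.
- rewrite min_l; last by apply: capmono; lra.
  rewrite prof_right ?(ltW hr)//.
  have -> : cap (2 - z) - rprof h0 - h0 * cap (2 - z) =
     cap (2 - a) - lprof (2 - a) (1 - h0) - (1 - h0) * cap z.
    by rewrite /rprof /t; move: (lprof _ _) => l; rewrite /cap; field.
  rewrite (@lprof_identity R (2 - a) z (1 - h0))//.
  by rewrite /tors; congr (_ ^+ 3); field.
- move=> e e0; have h1 : h0 < 1 by rewrite -subr_gt0.
  have [d2 d20 hd2] := rprof_taylor h1 e0; rewrite -/z in hd2.
  exists (Num.min d2 (h0 - a / 2)); first by rewrite lt_min d20 subr_gt0.
  move=> d; rewrite lt_min => /andP[i1 i2].
  rewrite !prof_right ?(ltW hr)//; first exact: hd2.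
  by have := ler_norm (- d); rewrite normrN; lra.
split.
- move=> g1 g2; suff : z < 2 by lra.
  by rewrite /z ltr_pdivrMr ?mulr_gt0//; move: g2; rewrite /hi; lra.
- by move=> e; move: hr; rewrite e => hh; have := lt_trans hh lo_mid; rewrite ltxx.
- move=> e; have -> : z = 2.
    by rewrite /z e /hi (_ : 1 - (1 - (2 - a) ^+ 2 / 4) = (2 - a) ^+ 2 / 4); [field; rewrite bn0|ring].
  by rewrite subrr.
- by move=> e; move: hr; rewrite e ltxx.
Qed.

Lemma prof_lo : prof lo = t - lo * (2 / 3).
Proof.
rewrite prof_left ?(ltW lo_mid)// /lprof /lo /t /cap; field.
by rewrite an0.
Qed.

Lemma prof_hi : prof hi = 0.
Proof.
rewrite prof_right ?(ltW mid_hi)// /rprof /lprof /hi.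
rewrite (_ : 1 - (1 - (2 - a) ^+ 2 / 4) = (2 - a) ^+ 2 / 4); last by ring.
by rewrite /t /cap; field; rewrite bn0.
Qed.

Variables f k u : R -> R.
Hypothesis bf : bdm (D R) f.
Hypothesis f01 : forall x, D R x -> 0 <= f x <= 1.
Hypothesis gd : green_data f k u.
Hypothesis mass_f : inner f (@tors R) <= t.

Let gap h := excess u h - prof h.

Let E h : set R := D R `&` [set x | 0 < u x - h * tors x].
Let mE h : measurable (E h).
Proof. by case: (measurable_level (bdm_level bf gd h).1). Qed.
Let sub h h' : excess u h - (h' - h) * tmass (E h) <= excess u h'.
Proof.
apply: (excess_subgrad bf gd h' (mE h)) => x Dx; first by move=> wx; split.
by case=> _; exact: ltW.
Qed.

Let tmE h : 0 <= tmass (E h) <= 2 / 3.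
Proof.
have cap0 : cap (1 + -1) = 0 :> R by rewrite /cap; field.
have m11 : -1 <= 1 :> R by lra.
apply/andP; split.
  apply: Rintegral_ge0 => x hx.
  by rewrite mulr_ge0 ?indicE ?ler0n// ltW// tors_gt0.
have := @tmass_le R (E h) (D R) (mE h) (@measurable_D R) (fun x Dx _ => Dx).
rewrite (tmass_itv (lexx _) m11 (lexx _)) cap0 subr0.
by have -> : cap (1 + 1) = 2 / 3 :> R by rewrite /cap; field.
Qed.

Let slope_le0 (m K d1 : R) : 0 < d1 -> (forall d, 0 < d < d1 -> m * d <= K * d ^+ 2) -> m <= 0.
Proof.
move=> d10 h; rewrite leNgt; apply/negP => m0.
pose d := Num.min (d1 / 2) (m / (2 * (`|K| + 1))).
have K1 : 0 < 2 * (`|K| + 1) by rewrite mulr_gt0// ltr_wpDl.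
have dp : 0 < d by rewrite lt_min !divr_gt0.
have dd : d < d1 by apply: (@le_lt_trans _ _ (d1 / 2)); [rewrite ge_min lexx|lra].
have dK : d * (2 * (`|K| + 1)) <= m by rewrite -ler_pdivlMr// ge_min lexx orbT.
have := h d; rewrite dp dd => /(_ isT).
rewrite expr2 mulrA ler_pM2r//.
have : K * d <= `|K| * d by rewrite ler_pM2r// ler_norm.
by rewrite mulrDr mulrDr in dK; nra.
Qed.

(** At an end point only a one-sided slope inequality is available. It suffices because the slope is
    extreme there: it forces the superlevel set to have full mass at [lo] and mass 0 at [hi], where
    [excess] can be bounded directly. *)
Lemma gap_max_le0 h0 : lo <= h0 -> h0 <= hi ->
  (forall h, lo <= h -> h <= hi -> gap h <= gap h0) -> gap h0 <= 0.
Proof.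
move=> l1 l2 mx.
have [x0 [s0 [R2 [s0E R20 QRE tay [xin slo shi _]]]]] := prof_taylor l1 l2.
have [hl|nl] := eqVneq h0 lo.
  have [d1 d10 hd1] := tay 1 ltr01.
  have s0' := slo hl.
  have : 2 / 3 - tmass (E h0) <= 0.
    apply: (@slope_le0 _ (R2 / 2 + 1) (Num.min d1 (hi - lo))).
      by rewrite lt_min d10 subr_gt0 (lt_trans lo_mid).
    move=> d; rewrite lt_min => /and3P[dp i1 i2].
    have := hd1 d; rewrite gtr0_norm// => /(_ i1).
    have := mx (h0 + d); rewrite (le_trans l1) ?lerDl ?(ltW dp)// => /(_ isT).
    have -> : h0 + d <= hi by rewrite hl addrC -lerBrDr ltW.
    move=> /(_ isT); rewrite /gap.
    have := sub h0 (h0 + d); rewrite (addrC h0 d) addrK s0'; lra.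
  have /andP[_ m1] := tmE h0 => m2.
  have tE : tmass (E h0) = 2 / 3 by lra.
  have := excess_full bf gd (mE h0) tE (fun x _ Ex => Ex.2) (fun x Dx wx => conj Dx wx).
  by have mf := mass_f; rewrite /gap hl prof_lo; lra.
have [hh|nh] := eqVneq h0 hi.
  have [d1 d10 hd1] := tay 1 ltr01.
  have s0' := shi hh.
  have : tmass (E h0) <= 0.
    apply: (@slope_le0 _ (R2 / 2 + 1) (Num.min d1 (hi - lo))).
      by rewrite lt_min d10 subr_gt0 (lt_trans lo_mid).
    move=> d; rewrite lt_min => /and3P[dp i1 i2].
    have := hd1 (- d); rewrite normrN gtr0_norm// => /(_ i1).
    have := mx (h0 - d); have -> : lo <= h0 - d by rewrite hh lerBrDr addrC -lerBrDr ltW.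
    have -> : h0 - d <= hi by rewrite hh gerBl ltW.
    move=> /(_ isT isT); rewrite /gap.
    have := sub h0 (h0 - d); rewrite (addrC h0 (- d)) addrK s0' sqrrN; lra.
  move=> m0; have [C C0 hC] := excess_bound bf gd h0.
  have := hC _ (mE h0) (fun x Dx wx => conj Dx wx).
  have : C * tmass (E h0) <= 0 by rewrite mulr_ge0_le0.
  by rewrite /gap hh prof_hi; lra.
have l1' : lo < h0 by rewrite lt_neqAle eq_sym nl.
have l2' : h0 < hi by rewrite lt_neqAle nh.
rewrite leNgt; apply/negP => g0.
have taylor e : 0 < e -> exists2 d1 : R, 0 < d1 & forall d, `|d| < d1 ->
    excess u (h0 + d) <= excess u h0 - s0 * d + (R2 / 2 + e) * d ^+ 2.
  move=> e0; have [d1 d10 hd1] := tay e e0.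
  exists (Num.min d1 (Num.min (h0 - lo) (hi - h0))).
    by rewrite !lt_min d10 !subr_gt0 l1'.
  move=> d; rewrite !lt_min => /and3P[i1 i2 i3].
  have := hd1 d i1; have := mx (h0 + d); rewrite /gap.
  have n1 := ler_norm d; have n2 := ler_norm (- d); rewrite normrN in n2.
  have -> : lo <= h0 + d by rewrite -lerBlDl -lerN2 opprB (le_trans n2)// ltW.
  have -> : h0 + d <= hi by rewrite -lerBrDl (le_trans n1)// ltW.
  by move=> /(_ isT isT); lra.
have x01 := xin l1' l2'.
have t0 : 0 < tors x0 ^+ 3 by rewrite exprn_gt0// tors_gt0.
have R2p : 0 < R2.
  rewrite lt_neqAle R20 andbT eq_sym; apply: contraTneq t0 => R2e.
  by rewrite -QRE R2e mulr0 ltxx.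
(* A positive gap makes this product strictly smaller than for the profile, whereas [rigidity] turns
   any such inequality into an equality. *)
have hQ : (Num.min s0 t - excess u h0 - h0 * s0) * R2 < tors x0 ^+ 3.
  by rewrite -QRE ltr_pM2r//; move: g0; rewrite /gap; lra.
have [QE _] := rigidity bf f01 gd taylor mass_f x01 s0E (ltW hQ).
by move: hQ; rewrite QE ltxx.
Qed.

Lemma excess_le_prof h : lo <= h -> h <= hi -> excess u h <= prof h.
Proof.
have lipP c d : {within `[c, d], continuous (excess u)}.
  by apply: (lip_within (C := 2 / 3)) => x y _ _; exact: excess_lip bf gd _ _.
have cP z : {for z, continuous (excess u)}.
  have z12 : z - 1 < z < z + 1 by lra.
  have : {within `]z - 1, z + 1[, continuous (excess u)}.
    by apply: continuous_subspaceW (lipP (z - 1) (z + 1)); exact: subset_itv_oo_cc.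
  by rewrite continuous_open_subspace//; apply; rewrite inE/= in_itv/=.
have clb b h' : 0 < h' -> {for h', continuous (lprof b)}.
  move=> h0; have n0 : h' != 0 by rewrite gt_eqF.
  have cid : (fun x : R => x) @ h' --> h' by exact: cvg_id.
  apply: cvgB.
    apply: cvgD; first exact: cvg_cst.
    apply: cvgM; first exact: cvg_cst.
    apply: cvgV; first by rewrite mulf_neq0.
    by apply: cvgM => //; exact: cvg_cst.
  apply: cvgM; first exact: cvg_cst.
  apply: cvgV; first by rewrite mulf_neq0// expf_neq0.
  by apply: cvgM; [exact: cvg_cst|exact: cvgM].
have cl := clb a.
have mid0 : lo <= a / 2 by exact: ltW.
have mid1 : a / 2 <= hi by exact: ltW.
(* The profile is given by two formulas, so a maximum is found for each; the larger one is a global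
   maximum of the gap. *)
have [c1 hc1 m1] : exists2 c, c \in `[lo, a / 2] &
    forall h, h \in `[lo, a / 2] -> excess u h - lprof a h <= excess u c - lprof a c.
  apply: EVT_max => //; apply: continuous_in_subspaceT => z; rewrite inE/= in_itv/= => /andP[z1 _].
  apply: cvgB; first exact: cP.
  by apply: cl; exact: lt_le_trans z1.
have [c2 hc2 m2] : exists2 c, c \in `[a / 2, hi] &
    forall h, h \in `[a / 2, hi] -> excess u h - rprof h <= excess u c - rprof c.
  apply: EVT_max => //; apply: continuous_in_subspaceT => z; rewrite inE/= in_itv/= => /andP[_ z1].
  apply: cvgB; first exact: cP.
  apply: cvgB; last by apply: cvgM; [exact: cvg_id|exact: cvg_cst].
  apply: cvgD; last exact: cvg_cst.
  have hz : 0 < 1 - z by rewrite subr_gt0 (le_lt_trans z1).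
  apply: (@continuous_comp _ _ _ (fun y : R => 1 - y) (lprof (2 - a))); last exact: clb.
  by apply: cvgB; [exact: cvg_cst|exact: cvg_id].
rewrite in_itv/= in hc1; rewrite in_itv/= in hc2.
case/andP: hc1 => c1l c1r; case/andP: hc2 => c2l c2r.
have g1 : gap c1 = excess u c1 - lprof a c1 by rewrite /gap prof_left.
have g2 : gap c2 = excess u c2 - rprof c2 by rewrite /gap prof_right.
have all1 z : lo <= z -> z <= hi -> gap z <= Num.max (gap c1) (gap c2).
  move=> z1 z2; rewrite le_max; have [zm|zm] := leP z (a / 2).
    by rewrite g1 {1}/gap prof_left// m1// in_itv/= z1.
  by rewrite g2 orbC {1}/gap prof_right ?(ltW zm)// m2// in_itv/= z2 ltW.
move=> h1 h2; rewrite -subr_le0 -/(gap h); apply: le_trans (all1 h h1 h2) _.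
have [cc|cc] := leP (gap c1) (gap c2).
  apply: gap_max_le0 => //; first exact: le_trans c2l.
  by move=> z z1 z2; have := all1 z z1 z2; rewrite max_r.
apply: gap_max_le0 => //; first exact: le_trans mid1.
by move=> z z1 z2; have := all1 z z1 z2; rewrite max_l// ltW.
Qed.

(** Equality makes [a / 2] a maximum of the gap, with value 0, so the Taylor bound of the profile
    passes to [excess] and [rigidity] applies with [x0 = 1 - a]. *)
Lemma excess_eq_prof : excess u (a / 2) = lprof a (a / 2) ->
  (forall x, D R x -> (0 < u x - a / 2 * tors x) = (1 - a < x) /\
     (u x - a / 2 * tors x = 0 -> x = 1 - a)) \/
  (forall x, D R x -> (0 < u x - a / 2 * tors x) = (x < - (1 - a)) /\
     (u x - a / 2 * tors x = 0 -> x = - (1 - a))).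
Proof.
move=> eqP.
have mid0 : lo <= a / 2 by exact: ltW.
have mid1 : a / 2 <= hi by exact: ltW.
have [x0 [s0 [R2 [s0E R20 QRE tay [xin _ _ xmid]]]]] := prof_taylor mid0 mid1.
have x0E := xmid erefl.
have pe : prof (a / 2) = excess u (a / 2) by rewrite prof_left.
have taylor e : 0 < e -> exists2 d1 : R, 0 < d1 & forall d, `|d| < d1 ->
    excess u (a / 2 + d) <= excess u (a / 2) - s0 * d + (R2 / 2 + e) * d ^+ 2.
  move=> e0; have [d1 d10 hd1] := tay e e0.
  exists (Num.min d1 (Num.min (a / 2 - lo) (hi - a / 2))).
    by rewrite !lt_min d10 !subr_gt0 lo_mid.
  move=> d; rewrite !lt_min => /and3P[i1 i2 i3].
  have := hd1 d i1; rewrite pe; apply: le_trans.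
  have n1 := ler_norm d; have n2 := ler_norm (- d); rewrite normrN in n2.
  apply: excess_le_prof.
    by rewrite -lerBlDl -lerN2 opprB (le_trans n2)// ltW.
  by rewrite -lerBrDl (le_trans n1)// ltW.
have hQ : (Num.min s0 t - excess u (a / 2) - a / 2 * s0) * R2 <= tors x0 ^+ 3.
  by rewrite -QRE pe.
have := rigidity bf f01 gd taylor mass_f (xin lo_mid mid_hi) s0E hQ.
by rewrite x0E => -[_].
Qed.

End Talenti.

(** * Explicit values and the equality case *)

Section Final.
Variable R : realType.
Notation mu := (@lebesgue_measure R).
Implicit Types (x y h d e a : R) (A B : set R).

(** [psi] is a representative chosen by [xget], so it is reached only through inner products:
    self-adjointness is used twice, via the solution for [\1_B]. *)
Lemma inner_psi B : measurable B -> inner (@psi R) \1_B = tmass B.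
Proof.
move=> mB; have bB := bdm_ind (D R) mB.
have bD := bdm_ind (D R) (@measurable_D R).
have b1 : bdm (D R) (fun=> 1) by exact: bdm_cst.
have [k [u gd]] := green_data_exists bB.
rewrite (inner_G bD bB gd) innerC.
have -> : inner u \1_(D R) = inner u (fun=> 1).
  by apply: eq_Rintegral => x xD; rewrite indicE xD.
rewrite (is_green_inner bB b1 (green_is_green bB gd) (@green_data_tors R)).
exact: innerC.
Qed.

Lemma itg_poly (f : R -> R) (p : {poly R}) a b : a <= b ->
  (forall x, a < x < b -> f x = p^`().[x]) -> itg f a b = p.[b] - p.[a].
Proof. by move=> ab fp; rewrite (eq_itg fp) -(@prim_horner R p a b a b). Qed.

Lemma torsion_right a : 0 < a -> a < 2 -> forall k u,
  green_data (\1_(`]1 - a, 1[) : R -> R) k u ->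
  inner \1_(`]1 - a, 1[) u = a ^+ 3 / 3 - a ^+ 4 / 8.
Proof.
move=> a0 a2 k u [pk pu u0 u1].
pose c := 1 - a.
have [c0 c1] : -1 <= c /\ c <= 1 by rewrite /c; lra.
have kr x : c <= x <= 1 -> k x = k 1 + (1 - x).
  move=> /andP[x1 x2]; have : k 1 - k x = - (1 - x); last by lra.
  rewrite pk//; last exact: le_trans x1.
  rewrite (eq_itg (g := fun=> -1)) ?itg_cst ?mulN1r// => z /andP[z1 z2].
  by rewrite indicE mem_set//= in_itv/= z2 (le_lt_trans x1).
have kl x : -1 <= x <= c -> k x = k 1 + a.
  move=> /andP[x1 x2]; have := kr c; rewrite lexx c1 => /(_ isT).
  have : k c - k x = 0; last by rewrite /c; lra.
  rewrite pk// (eq_itg (g := fun=> 0)) ?itg_cst ?mul0r// => z /andP[z1 z2].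
  by rewrite indicE memNset ?oppr0//= in_itv/= => /andP[h _]; have := lt_trans h z2; rewrite ltxx.
have ur x : c <= x <= 1 -> u x = - k 1 * (1 - x) - (1 - x) ^+ 2 / 2.
  move=> /andP[x1 x2]; have : u 1 - u x = k 1 * (1 - x) + (1 - x) ^+ 2 / 2; last by rewrite u1; lra.
  rewrite pu//; last exact: le_trans x1.
  rewrite (@itg_poly _ ((k 1 + 1)%:P * 'X - (2^-1)%:P * 'X^2))//.
    by rewrite !hornerE /=; field.
  move=> z /andP[z1 z2]; rewrite kr; last by rewrite (ltW z2) (le_trans x1 (ltW z1)).
  by rewrite !poly.derivE !hornerE /=; field.
have uc : u c = (k 1 + a) * (c - -1).
  rewrite -[u c]subr0 -u0 pu// (eq_itg (g := fun=> k 1 + a)) ?itg_cst// => z /andP[z1 z2].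
  by rewrite kl// !ltW.
(* The two formulas for [u] must agree at [c], which fixes the remaining constant. *)
have k1 : k 1 = a ^+ 2 / 4 - a.
  by move: uc; rewrite ur ?lexx// /c; lra.
have b1 : bdm `](-1), 1[ (fun x => (\1_(`]1 - a, 1[) : R -> R) x * u x).
  apply: bdmM; first exact: bdm_ind.
  have bk : bdm `](-1), 1[ k by apply: prim_bdm pk; apply: bdmN; exact: bdm_ind.
  exact: prim_bdm bk pu.
rewrite innerE (@itg_cat _ _ (-1) c 1)//.
rewrite (eq_itg (g := fun=> 0)) ?itg_cst ?mul0r ?add0r//; last first.
  move=> z /andP[z1 z2]; rewrite indicE memNset ?mul0r//= in_itv/= => /andP[h _].
  by have := lt_trans h z2; rewrite ltxx.
rewrite (@itg_poly _ ((- k 1 - 2^-1)%:P * 'X + ((k 1 + 1) / 2)%:P * 'X^2 - (6^-1)%:P * 'X^3))//.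
  by rewrite !hornerE /= k1 /c; field.
move=> z /andP[z1 z2]; rewrite indicE mem_set; last by rewrite /= in_itv/= z2 z1.
rewrite ur; last by rewrite !ltW.
by rewrite !poly.derivE !hornerE /=; field.
Qed.

(** The mirror image of [torsion_right]: the reflected interval has the same energy. *)
Lemma torsion_left a : 0 < a -> a < 2 -> forall k u,
  green_data (\1_(`](-1), a - 1[) : R -> R) k u ->
  inner \1_(`](-1), a - 1[) u = a ^+ 3 / 3 - a ^+ 4 / 8.
Proof.
move=> a0 a2 k u [pk pu u0 u1].
pose c := a - 1; pose K := k (-1).
have [c0 c1] : -1 <= c /\ c <= 1 by rewrite /c; lra.
have kr x : -1 <= x <= c -> k x = K - (1 + x).
  move=> /andP[x1 x2]; have : k x - K = - (x - -1); last by lra.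
  rewrite pk//; last exact: le_trans c1.
  rewrite (eq_itg (g := fun=> -1)) ?itg_cst ?mulN1r// => z /andP[z1 z2].
  by rewrite indicE mem_set//= in_itv/= z1 (lt_le_trans z2).
have kl x : c <= x <= 1 -> k x = K - a.
  move=> /andP[x1 x2]; have := kr c; rewrite lexx c0 => /(_ isT).
  have : k x - k c = 0; last by rewrite /c; lra.
  rewrite pk// (eq_itg (g := fun=> 0)) ?itg_cst ?mul0r// => z /andP[z1 z2].
  by rewrite indicE memNset ?oppr0//= in_itv/= => /andP[_ h]; have := lt_trans h z1; rewrite ltxx.
have ur x : -1 <= x <= c -> u x = K * (1 + x) - (1 + x) ^+ 2 / 2.
  move=> /andP[x1 x2]; have : u x - u (-1) = K * (1 + x) - (1 + x) ^+ 2 / 2; last by rewrite u0; lra.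
  rewrite pu//; last exact: le_trans c1.
  rewrite (@itg_poly _ ((K - 1)%:P * 'X - (2^-1)%:P * 'X^2))//.
    by rewrite !hornerE /=; field.
  move=> z /andP[z1 z2]; rewrite kr; last by rewrite (ltW z1) (le_trans (ltW z2)).
  by rewrite !poly.derivE !hornerE /=; field.
have uc : - u c = (K - a) * (1 - c).
  rewrite -[- u c]add0r -u1 pu// (eq_itg (g := fun=> K - a)) ?itg_cst// => z /andP[z1 z2].
  by rewrite kl// !ltW.
have k1 : K = a - a ^+ 2 / 4.
  by move: uc; rewrite ur ?lexx ?andbT// /c; lra.
have b1 : bdm `](-1), 1[ (fun x => (\1_(`](-1), a - 1[) : R -> R) x * u x).
  apply: bdmM; first exact: bdm_ind.
  have bk : bdm `](-1), 1[ k by apply: prim_bdm pk; apply: bdmN; exact: bdm_ind.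
  exact: prim_bdm bk pu.
rewrite innerE (@itg_cat _ _ (-1) c 1)//.
rewrite [X in _ + X](eq_itg (g := fun=> 0)) ?itg_cst ?mul0r ?addr0//; last first.
  move=> z /andP[z1 z2]; rewrite indicE memNset ?mul0r//= in_itv/= => /andP[_ h].
  by have := lt_trans h z1; rewrite ltxx.
rewrite (@itg_poly _ ((K - 2^-1)%:P * 'X + ((K - 1) / 2)%:P * 'X^2 - (6^-1)%:P * 'X^3))//.
  by rewrite !hornerE /= k1 /c; field.
move=> z /andP[z1 z2]; rewrite indicE mem_set; last by rewrite /= in_itv/= z2 z1.
rewrite ur; last by rewrite !ltW.
by rewrite !poly.derivE !hornerE /=; field.
Qed.

Lemma xiP (t : R) : 0 < t -> t < 2 / 3 -> D R (xi t) /\ cap (1 - xi t) = t.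
Proof.
move=> t0 t1.
have vE x : D R x -> varphi x = cap (1 - x).
  rewrite /D/= in_itv/= => /andP[x1 x2]; rewrite /varphi innerC inner_psi//.
  by rewrite (tmass_itv (ltW x1) (ltW x2) (lexx _)) /cap; field.
have [y] : exists2 y, y \in `[(0 : R), 2] & cap y = t.
  apply: IVT => //.
    apply: continuous_subspaceT => y.
    apply: cvgB; (apply: cvgM; last exact: cvg_cst).
      by apply: cvgM; exact: cvg_id.
    by apply: cvgM; [exact: cvg_id|apply: cvgM; exact: cvg_id].
  have -> : cap 0 = 0 :> R by rewrite /cap; field.
  have -> : cap 2 = 2 / 3 :> R by rewrite /cap; field.
  by rewrite ge_min le_max (ltW t0) (ltW t1) orbT.
rewrite in_itv/= => /andP[y0 y2] cy.
have cap0 : cap 0 = 0 :> R by rewrite /cap; field.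
have cap2 : cap 2 = 2 / 3 :> R by rewrite /cap; field.
have y0' : 0 < y.
  rewrite lt_neqAle y0 andbT; apply: contraTneq t0 => e.
  by rewrite -cy -e cap0 ltxx.
have y2' : y < 2.
  rewrite lt_neqAle y2 andbT; apply: contraTneq t1 => e.
  by rewrite -cy e cap2 ltxx.
have Dy : D R (1 - y) by rewrite /D/= in_itv/=; lra.
have : exists x, D R x /\ varphi x = t.
  by exists (1 - y); split => //; rewrite vE// subKr.
rewrite /xi => -[x hx].
have [h1 h2] := @xgetPex R 0 [set x | D R x /\ varphi x = t] (ex_intro _ x hx).
by split => //; rewrite -vE.
Qed.

(** The deficit is kept as an explicit integral, because its vanishing identifies [A] in the
    equality case. *)
Lemma energy_le (f : R -> R) (k u : R -> R) h : bdm (D R) f -> green_data f k u ->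
  (forall x, D R x -> 0 <= f x <= 1) ->
  inner f u <= excess u h + h * inner f (@tors R) /\
  inner f u = excess u h + h * inner f (@tors R) -
    itg (fun x => Num.max (u x - h * tors x) 0 - f x * (u x - h * tors x)) (-1) 1.
Proof.
move=> bf gd f01; have [bk bu] := green_data_bdm bf gd.
have bw := bdm_level bf gd h.
have bm : bdm (D R) (fun x => Num.max (u x - h * tors x) 0) by apply: bdm_max => //; exact: bdm_cst.
have bfw : bdm (D R) (fun x => f x * (u x - h * tors x)) by exact: bdmM.
have bft : bdm (D R) (fun x => f x * tors x) by apply: bdmM => //; exact: bdm_tors.
have e : inner f u = excess u h + h * inner f (@tors R) -
    itg (fun x => Num.max (u x - h * tors x) 0 - f x * (u x - h * tors x)) (-1) 1.
  rewrite itgB// /excess.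
  have -> : inner f u = itg (fun x => f x * (u x - h * tors x)) (-1) 1 + h * inner f (@tors R).
    rewrite !innerE -itgZ// -itgD//; last by apply: bdmM => //; exact: bdm_cst.
    by apply: eq_itg => x _; ring.
  by ring.
split => //; rewrite e gerBl; apply: Rintegral_ge0 => x Dx.
have /andP[f0 f1] := f01 x Dx; rewrite subr_ge0 le_max.
have [w|w] := leP 0 (u x - h * tors x).
  by apply/orP; left; rewrite ler_piMl.
by apply/orP; right; rewrite mulr_ge0_le0// ltW.
Qed.

Lemma measurable_reflect_itv a : [set - x | x in `]1 - a, 1[%classic] = `](-1), a - 1[%classic :> set R.
Proof.
apply/seteqP; split => [_ [x /= hx <-]|x /= hx].
  by move: hx; rewrite !in_itv/=; lra.
by exists (- x); rewrite ?opprK//; move: hx; rewrite /= !in_itv/=; lra.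
Qed.

Lemma eq_mod_null_inner A B : measurable A -> measurable B -> eq_mod_null A B ->
  inner (G \1_A) \1_A = inner (G \1_B) \1_B.
Proof.
move=> mA mB nAB.
have bA := bdm_ind (D R) mA; have bB := bdm_ind (D R) mB.
have AB : {ae mu, forall x, D R x -> (\1_A : R -> R) x = \1_B x}.
  move: nAB; rewrite /eq_mod_null; apply: negligibleS => x /= hx; apply: contrapT => nx; apply: hx => _.
  suff e : (x \in A) = (x \in B) by rewrite !indicE e.
  apply/idP/idP; rewrite !inE => h; apply: contrapT => h'; apply: nx.
    by left.
  by right.
have [k [u gdA]] := green_data_exists bA.
have gdB := green_data_ae bA bB AB gdA.
rewrite (inner_G bA bA gdA) (inner_G bB bB gdB).
have bu : bdm (D R) u by have [] := green_data_bdm bA gdA.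
by apply: ae_inner AB; [exact: bA.1|exact: bB.1|exact: bu.1].
Qed.

(** The integrand is non-negative, hence zero almost everywhere. Where [w] is not 0, that is off the
    null set [{c}], its vanishing makes membership in [A] equivalent to [0 < w]. *)
Lemma eq_mod_null_of_itg0 A B (w : R -> R) (c : R) : measurable A -> A `<=` D R -> B `<=` D R ->
  bdm (D R) w -> (forall x, D R x -> (0 < w x <-> B x) /\ (w x = 0 -> x = c)) ->
  itg (fun x => Num.max (w x) 0 - \1_A x * w x) (-1) 1 = 0 -> eq_mod_null A B.
Proof.
move=> mA AD BD bw hw i0.
set g := (fun x => Num.max (w x) 0 - \1_A x * w x) in i0.
have bg : bdm (D R) g.
  by apply: bdmB; [apply: bdm_max => //; exact: bdm_cst|apply: bdmM => //; exact: bdm_ind].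
have g0 x : 0 <= g x.
  rewrite /g indicE; case: (_ \in _); rewrite ?mul1r ?mul0r ?subr0 ?subr_ge0 le_max lexx ?orbT//.
have : ae_eq mu (D R) (EFin \o g) (cst 0%E).
  have mg : measurable_fun (D R) (EFin \o g) by apply/measurable_EFinP; exact: bg.1.
  apply: (ae_eq_integral_abs mu (measurable_itv _) mg).1.
  have fi : (\int[mu]_(x in D R) (g x)%:E)%E \is a fin_num.
    by apply: integrable_fin_num (bdm_itg bg); exact: measurable_itv.
  transitivity (\int[mu]_(x in D R) (g x)%:E)%E.
    by apply: eq_integral => x _; rewrite /= ger0_norm.
  by rewrite -[LHS]fineK//; congr EFin.
move=> h; apply: (@negligibleS _ _ _ mu (~` [set x | D R x -> (EFin \o g) x = (cst 0%E) x] `|` [set c])).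
  move=> x /= hx; have Dx : D R x by case: hx => -[h1 _]; [exact: AD|exact: BD].
  have [->|/eqP xc] := eqVneq x c; first by right.
  left => /(_ Dx) [gx]; have [wB w0] := hw x Dx.
  have {w0} wn : w x <> 0 by move=> /w0.
  case: hx => -[h1 h2].
    have wx : w x <= 0 by rewrite leNgt; apply/negP => /wB.
    by move: gx; rewrite /g indicE mem_set// mul1r max_r// sub0r => /eqP; rewrite oppr_eq0 => /eqP.
  have wx : 0 < w x by apply/wB.
  by move: gx; rewrite /g indicE memNset// mul0r subr0 max_l// ltW.
apply: negligibleU; first exact: h.
apply/negligibleP; first exact: measurable_set1.
exact: lebesgue_measure_set1.
Qed.

End Final.

Theorem theorem1p3 (R : realType) (t : R) (ht0 : 0 < t) (ht1 : t < 2 / 3)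
    (A : set R) (hA : open A) (hAD : A `<=` D R)
    (hAt : inner psi \1_A <= t) :
  inner (G \1_A) \1_A <= inner (G \1_(At t)) \1_(At t) /\
  (inner (G \1_A) \1_A = inner (G \1_(At t)) \1_(At t) <->
   eq_mod_null A (At t) \/ eq_mod_null A [set - x | x in At t]).
Proof.
have mA : measurable A by exact: open_measurable.
have [Dxi cxi] := xiP ht0 ht1.
pose a := 1 - xi t.
have [a0 a2] : 0 < a /\ a < 2 by move: Dxi; rewrite /D/= in_itv/= /a; lra.
have xiE : xi t = 1 - a by rewrite /a subKr.
have AtE : At t = `]1 - a, 1[%classic by rewrite /At xiE.
have tE : t = cap a by rewrite cxi.
clearbody a.
have h0 : 0 < a * (2 - a) by rewrite mulr_gt0 ?subr_gt0.
have lo : a ^+ 2 / 4 <= a / 2 by nra.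
have hi : a / 2 <= 1 - (2 - a) ^+ 2 / 4 by nra.
have bA := bdm_ind (D R) mA.
have [k [u gd]] := green_data_exists bA.
have f01 x : D R x -> 0 <= (\1_A : R -> R) x <= 1.
  by move=> _; rewrite indicE; case: (_ \in _); rewrite ?lexx ?ler01.
have mf : inner \1_A (@tors R) <= cap a by rewrite -tE innerC; move: hAt; rewrite inner_psi.
have JE : inner (G \1_A) \1_A = inner \1_A u by exact: inner_G gd.
have mI : measurable (`]1 - a, 1[%classic : set R) by exact: measurable_itv.
have mJ : measurable (`](-1), a - 1[%classic : set R) by exact: measurable_itv.
have bI := bdm_ind (D R) mI; have bJ := bdm_ind (D R) mJ.
have JI : inner (G \1_(`]1 - a, 1[)) \1_(`]1 - a, 1[) = a ^+ 3 / 3 - a ^+ 4 / 8.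
  have [k' [u' gd']] := green_data_exists bI.
  by rewrite (inner_G bI bI gd'); exact: torsion_right gd'.
have JJ : inner (G \1_(`](-1), a - 1[)) \1_(`](-1), a - 1[) = a ^+ 3 / 3 - a ^+ 4 / 8.
  have [k' [u' gd']] := green_data_exists bJ.
  by rewrite (inner_G bJ bJ gd'); exact: torsion_left gd'.
have [en1 en2] := energy_le (a / 2) bA gd f01.
have cmp := excess_le_prof a0 a2 bA f01 gd mf lo hi.
rewrite prof_left// in cmp.
(* At the level [a / 2] the upper bound coincides with the energy of the interval. *)
have val : lprof a (a / 2) + a / 2 * cap a = a ^+ 3 / 3 - a ^+ 4 / 8.
  by rewrite /lprof /cap; field; rewrite gt_eqF.
have am : a / 2 * inner \1_A (@tors R) <= a / 2 * cap a.
  by rewrite ler_pM2l// divr_gt0.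
rewrite AtE measurable_reflect_itv JE JI; split; first by rewrite -val; move: en1 cmp am; clear; lra.
split=> [eJ|[] eAB]; last 2 first.
- by rewrite -JE (eq_mod_null_inner mA mI eAB).
- by rewrite -JE (eq_mod_null_inner mA mJ eAB).
(* The energy is bounded by the sum of an excess term and a mass term; equality leaves no slack in
   either, nor in the deficit integral. *)
have eP : excess u (a / 2) = lprof a (a / 2).
  by apply/eqP; rewrite eq_le cmp; move: en1 am; rewrite eJ -val; clear; lra.
have i0 : itg (fun x => Num.max (u x - a / 2 * tors x) 0 - \1_A x * (u x - a / 2 * tors x)) (-1) 1 = 0.
  have : 0 <= itg (fun x => Num.max (u x - a / 2 * tors x) 0 - \1_A x * (u x - a / 2 * tors x)) (-1) 1.
    apply: Rintegral_ge0 => x _; rewrite indicE.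
    by case: (_ \in _); rewrite ?mul1r ?mul0r ?subr0 ?subr_ge0 le_max lexx ?orbT.
  move: en2 am; rewrite eJ -val eP; clear; lra.
have bw := bdm_level bA gd (a / 2).
case: (excess_eq_prof a0 a2 bA f01 gd mf eP) => hw; [left|right].
- apply: (eq_mod_null_of_itg0 mA hAD _ bw _ i0 (c := 1 - a)).
    by apply: sub_oo => //; move: a0 a2; clear; lra.
  move=> x Dx; have [-> z] := hw x Dx; split => //.
  by move: Dx; rewrite /D/= !in_itv/= => /andP[_ ->]; rewrite andbT.
- apply: (eq_mod_null_of_itg0 mA hAD _ bw _ i0 (c := - (1 - a))).
    by apply: sub_oo => //; move: a0 a2; clear; lra.
  move=> x Dx; have [-> z] := hw x Dx; split => //.
  by move: Dx; rewrite /D/= !in_itv/= => /andP[-> _]; rewrite opprB.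
Qed.
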